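(* The canonical images of the elements $$\{X^\lambda\mathbf aT_w : \lambda\in\mathbb N^n,\ \lambda_i<d\text{ for all }i,\ \mathbf a\in B^{\otimes n},\ w\in S_n\}$$ form a basis (over $\Bbbk$) of $H_{n,+}^f(A,z)$ and of $H_n^f(A,z)$.
   Context: Conventions. $\Bbbk$ is a commutative ring of characteristic not equal to two, $z\in\Bbbk$, $\mathbb N$ is the set of nonnegative integers, and all tensor products are over $\Bbbk$. All algebras and modules are associative superalgebras and supermodules over $\Bbbk$; $\bar a$ is the parity of a homogeneous element $a$; $(a\otimes b)(c\otimes d)=(-1)^{\bar b\bar c}ac\otimes bd$. $A$ is a symmetric superalgebra: there is a parity-preserving linear map $\mathrm{tr}\colon A\to\Bbbk$ ($\Bbbk$ in parity zero) with $\mathrm{tr}(ab)=(-1)^{\bar a\bar b}\mathrm{tr}(ba)$ for homogeneous $a,b$, such that $a\mapsto(b\mapsto\mathrm{tr}(ab))$ is a parity-preserving isomorphism $A\to\mathrm{Hom}_\Bbbk(A,\Bbbk)$. $A$ is free over $\Bbbk$ with a homogeneous (necessarily finite) basis $B$, and dual basis $\{b^\vee\}$ given by $\mathrm{tr}(a^\vee b)=\delta_{a,b}$ for $a,b\in B$. $B^{\otimes n}$ denotes the basis of $A^{\otimes n}$ of pure tensors of elements of $B$. Fix an integer $n\ge1$. For $a\in A$, $a_i=1^{\otimes(i-1)}\otimes a\otimes1^{\otimes(n-i)}\in A^{\otimes n}$; $t_{i,j}=\sum_{b\in B}b_ib_j^\vee$ for $1\le i\ne j\le n$. $S_n$ acts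 on $A^{\otimes n}$ by superpermutation of factors; $s_i=(i,i+1)$. $H_n(A,z)$ is the algebra generated by $A^{\otimes n}$ and even elements $T_1,\dots,T_{n-1}$ (free product) modulo: $T_iT_j=T_jT_i$ for $|i-j|>1$; $T_iT_{i+1}T_i=T_{i+1}T_iT_{i+1}$; $T_i^2=zt_{i,i+1}T_i+1$; $T_i\mathbf a=s_i(\mathbf a)T_i$ for $\mathbf a\in A^{\otimes n}$ (so $H_1(A,z)=A$). $H_n^{\mathrm{aff}}(A,z)$ is the free product of $\Bbbk[X_1^{\pm1},\dots,X_n^{\pm1}]$ ($X_i$ even) and $H_n(A,z)$ modulo: $T_iX_j=X_jT_i$ for $j\ne i,i+1$; $T_iX_iT_i=X_{i+1}$; $X_i\mathbf a=\mathbf aX_i$ for $\mathbf a\in A^{\otimes n}$. $H_{n,+}^{\mathrm{aff}}(A,z)$ is the subalgebra generated by $H_n(A,z)$ and $X_1,\dots,X_n$. For $w\in S_n$ with reduced expression $w=s_{i_1}\cdots s_{i_k}$, $T_w=T_{i_1}\cdots T_{i_k}$. For $\lambda\in\mathbb Z^n$, $X^\lambda=X_1^{\lambda_1}\cdots X_n^{\lambda_n}$. Cyclotomic quotients. Let $Z(A)=\{a: ab=(-1)^{\bar a\bar b}ba\ \forall b\in A\}$ be the (super)center of $A$ and $Z(A)_0$ its even part. Identify $A$ with $A\otimes1^{\otimes(n-1)}\subseteq A^{\otimes n}$. Let $f=X_1^d+a_{(d-1)}X_1^{d-1}+\dots+a_{(1)}X_1+a_{(0)}$ be a monic polynomial of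 degree $d\ge1$ with all $a_{(i)}\in Z(A)_0$ and $a_{(0)}$ invertible. Then $H_n^f(A,z)=H_n^{\mathrm{aff}}(A,z)/\langle f\rangle$ and $H_{n,+}^f(A,z)=H_{n,+}^{\mathrm{aff}}(A,z)/\langle f\rangle_+$, where $\langle f\rangle$, $\langle f\rangle_+$ are the two-sided ideals generated by $f$ in $H_n^{\mathrm{aff}}(A,z)$ and $H_{n,+}^{\mathrm{aff}}(A,z)$ respectively. *)

(* Defs.v *)
From HB Require Import structures.
From mathcomp Require Import all_boot all_order all_algebra all_fingroup.
From mathcomp Require Import finmap boolp generic_quotient ring_quotient.
From mathcomp Require Import monalg.

Set Implicit Arguments.
Unset Strict Implicit.
Unset Printing Implicit Defensive.

Import GRing.Theory.
Local Open Scope ring_scope.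
Local Open Scope quotient_scope.

(* [algType] only covers nonzero algebras, which is not known a priori for an
   algebra given by generators and relations; [pzAlgType] allows 1 = 0. *)
HB.mixin Record PzRing_isPzAlgebra (R : pzRingType) A of GRing.PzRing A := {
  pzscale : R -> A -> A;
  pzscalerA : forall c d u, pzscale c (pzscale d u) = pzscale (c * d) u;
  pzscale1r : left_id 1 pzscale;
  pzscalerDr : right_distributive pzscale +%R;
  pzscalerDl : forall u, {morph pzscale^~ u : c d / c + d};
  pzscalerAl : forall c u v, pzscale c (u * v) = pzscale c u * v;
  pzscalerAr : forall c u v, pzscale c (u * v) = u * pzscale c v
}.

#[short(type="pzAlgType")]
HB.structure Definition PzAlgebra (R : pzRingType) :=
  {A of GRing.PzRing A & PzRing_isPzAlgebra R A}.

HB.instance Definition _ (R : pzRingType) (A : pzAlgType R) :=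
  GRing.Zmodule_isLmodule.Build R (PzAlgebra.sort A)
    (@pzscalerA R A) (@pzscale1r R A) (@pzscalerDr R A) (@pzscalerDl R A).

Lemma pzalg_scalerAl (R : pzRingType) (A : pzAlgType R) (c : R) (u v : A) :
  c *: (u * v) = (c *: u) * v.
Proof. exact: pzscalerAl. Qed.

Lemma pzalg_scalerAr (R : pzRingType) (A : pzAlgType R) (c : R) (u v : A) :
  c *: (u * v) = u * (c *: v).
Proof. exact: pzscalerAr. Qed.

(* The decomposition A = A_0 (+) A_1 is given by its two projections; the
   parity [false] is even and [true] is odd. *)
HB.mixin Record PzAlgebra_isSuper (R : pzRingType) A of PzAlgebra R A := {
  hproj : bool -> A -> A;
  hproj_linear_subproof : forall e c a b,
    hproj e (pzscale c a + b) = pzscale c (hproj e a) + hproj e b;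
  hprojD : forall a, hproj false a + hproj true a = a;
  hproj_proj : forall e e' a,
    hproj e (hproj e' a) = if e == e' then hproj e' a else 0;
  hproj1 : hproj false 1 = 1;
  hprojM : forall e e' a b,
    hproj (e (+) e') (hproj e a * hproj e' b) = hproj e a * hproj e' b
}.

#[short(type="superAlgType")]
HB.structure Definition SuperAlgebra (R : pzRingType) :=
  {A of PzAlgebra R A & PzAlgebra_isSuper R A}.

HB.instance Definition _ (R : pzRingType) (A : superAlgType R) :=
  GRing.Lmodule.copy (SuperAlgebra.sort A) (PzAlgebra.sort A).

Definition homog (R : pzRingType) (A : superAlgType R) (e : bool) (a : A) :=
  hproj e a = a.

Definition homogeneous (R : pzRingType) (A : superAlgType R) (a : A) :=
  exists e, homog e a.

Definition is_basis (R : pzRingType) (V : lmodType R) (J : finType)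
    (e : J -> V) :=
  forall v, exists! c : {ffun J -> R}, v = \sum_j c j *: e j.

Section SuperTheory.
Variables (R : pzRingType) (A : superAlgType R).

Fact hproj_linear e : linear (@hproj R A e).
Proof. exact: hproj_linear_subproof. Qed.

HB.instance Definition _ e :=
  GRing.isLinear.Build R A A *:%R (@hproj R A e) (hproj_linear e).

Lemma homog_hproj e (a : A) : homog e (hproj e a).
Proof. by rewrite /homog hproj_proj eqxx. Qed.

Lemma hproj_homog e e' (a : A) :
  homog e a -> hproj e' a = if e' == e then a else 0.
Proof. by move=> <-; rewrite hproj_proj. Qed.

Lemma homogM e e' (a b : A) :
  homog e a -> homog e' b -> homog (e (+) e') (a * b).
Proof. by move=> <- <-; exact: hprojM. Qed.

Lemma homog1 : homog false (1 : A). Proof. exact: hproj1. Qed.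

End SuperTheory.

(* Quotient operations and multilinear extensions are locked with this key:
   unfolding them makes unification diverge. *)

Fact lock_key : unit. Proof. by []. Qed.

Section LinearSpan.
Variables (R : pzRingType) (V : lmodType R) (S : V -> Prop).

Inductive lspan : V -> Prop :=
| lspan_gen x of S x : lspan x
| lspan0 : lspan 0
| lspan_lin c x y of lspan x & lspan y : lspan (c *: x + y).

Definition lspan_pred : {pred V} := fun x => `[< lspan x >].

Lemma lspanP x : reflect (lspan x) (x \in lspan_pred).
Proof. exact: asboolP. Qed.

Fact lspan_submod : submod_closed lspan_pred.
Proof.
split=> [|c x y /lspanP Sx /lspanP Sy]; apply/lspanP; first exact: lspan0.
exact: lspan_lin.
Qed.
HB.instance Definition _ :=
  GRing.isSubmodClosed.Build R V lspan_pred lspan_submod.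

Definition modQuot := Quotient.quot (lspan_pred : zmodClosed V).

HB.instance Definition _ := Choice.on modQuot.
HB.instance Definition _ := EqQuotient.on modQuot.
HB.instance Definition _ := GRing.Zmodule.on modQuot.

Definition mq : V -> modQuot := locked_with lock_key (\pi_modQuot).

Lemma mqE x : mq x = \pi_modQuot x. Proof. by rewrite /mq unlock. Qed.

Lemma mq_repr x : mq (repr x) = x. Proof. by rewrite mqE reprK. Qed.

Lemma mq_eqP x y : mq x = mq y <-> lspan (x - y).
Proof.
rewrite !mqE; have E := Quotient.idealrBE (lspan_pred : zmodClosed V) x y.
split=> [/eqP xy | /lspanP xy]; first by apply/lspanP; rewrite E.
by apply/eqP; rewrite -[_ == _]E.
Qed.

Lemma mq_surj (x : modQuot) : exists v, x = mq v.
Proof. by exists (repr x); rewrite mq_repr. Qed.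

Lemma mqD x y : mq (x + y) = mq x + mq y.
Proof. by rewrite !mqE !piE. Qed.

Definition mqscale : R -> modQuot -> modQuot :=
  locked_with lock_key (fun c x => mq (c *: repr x)).

Lemma mqscaleE c x : mqscale c (mq x) = mq (c *: x).
Proof.
rewrite /mqscale unlock; apply/mq_eqP; rewrite -scalerBr -[_ *: _]addr0; apply: lspan_lin lspan0.
by apply/mq_eqP; rewrite mq_repr.
Qed.

Fact mqscaleA c d x : mqscale c (mqscale d x) = mqscale (c * d) x.
Proof. by have [v ->] := mq_surj x; rewrite !mqscaleE scalerA. Qed.

Fact mqscale1 : left_id 1 mqscale.
Proof. by move=> x; have [v ->] := mq_surj x; rewrite !mqscaleE scale1r. Qed.

Fact mqscaleDr : right_distributive mqscale +%R.
Proof.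
move=> c x y; have [v ->] := mq_surj x; have [w ->] := mq_surj y.
by rewrite -mqD !mqscaleE -mqD scalerDr.
Qed.

Fact mqscaleDl x : {morph mqscale^~ x : c d / c + d}.
Proof.
move=> c d; have [v ->] := mq_surj x.
by rewrite !mqscaleE -mqD scalerDl.
Qed.

HB.instance Definition _ := GRing.Zmodule_isLmodule.Build R modQuot
  mqscaleA mqscale1 mqscaleDr mqscaleDl.

Fact mq_is_linear : linear mq.
Proof. by move=> c x y; rewrite [c *: mq x]mqscaleE mqD. Qed.
HB.instance Definition _ := GRing.isLinear.Build R V modQuot *:%R mq mq_is_linear.

Section Lift.
Variables (W : lmodType R) (f : {linear V -> W}).
Hypothesis fS : forall x, S x -> f x = 0.

Definition mqlift : modQuot -> W := locked_with lock_key (f \o repr).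

Lemma mqliftE x : mqlift (mq x) = f x.
Proof.
rewrite /mqlift unlock /=.
apply/eqP; rewrite -subr_eq0 -linearB; apply/eqP.
have: lspan (repr (mq x) - x) by apply/mq_eqP; rewrite mq_repr.
elim=> [y /fS //||c y y' _ IH _ IH']; first by rewrite linear0.
by rewrite linearP IH IH' scaler0 addr0.
Qed.

Lemma mqlift_is_linear : linear mqlift.
Proof.
move=> c x y; have [v ->] := mq_surj x; have [w ->] := mq_surj y.
by rewrite -linearP !mqliftE linearP.
Qed.
End Lift.

End LinearSpan.

Section AlgebraQuotient.
Variables (R : pzRingType) (E : pzAlgType R) (S : E -> Prop).

Inductive ideal_gen : E -> Prop :=
| IdealGen x s y of S s : ideal_gen (x * s * y).

(* The submodule spanned by the x s y is the two-sided ideal generated by S. *)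
Definition algQuot := modQuot ideal_gen.

HB.instance Definition _ := GRing.Lmodule.on algQuot.

Definition aq (x : E) : algQuot := mq ideal_gen x.
HB.instance Definition _ :=
  GRing.isLinear.Build R E algQuot *:%R aq (@mq_is_linear R E ideal_gen).

Lemma aq_surj (x : algQuot) : exists v, x = aq v.
Proof. exact: mq_surj. Qed.

Lemma lspan_ideal x u y : lspan ideal_gen u -> lspan ideal_gen (x * u * y).
Proof.
elim=> [_ [a s b Ss]||c v w _ IHv _ IHw].
- by rewrite !mulrA -(mulrA _ b y) ; apply/lspan_gen/IdealGen.
- by rewrite mulr0 mul0r; apply: lspan0.
- by rewrite mulrDr mulrDl -pzalg_scalerAr -pzalg_scalerAl; apply: lspan_lin.
Qed.

Lemma aq_eqP x y : aq x = aq y <-> lspan ideal_gen (x - y).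
Proof. exact: mq_eqP. Qed.

Definition aqone : algQuot := aq 1.
Definition aqmul : algQuot -> algQuot -> algQuot :=
  locked_with lock_key (fun x y => aq (repr x * repr y)).

Lemma aqmulE x y : aqmul (aq x) (aq y) = aq (x * y).
Proof.
have rK v : lspan ideal_gen (repr (aq v) - v).
  by apply/mq_eqP; rewrite mq_repr.
rewrite /aqmul unlock; apply/aq_eqP; set x' := repr _; set y' := repr _.
have -> : x' * y' - x * y = 1 *: (1 * (x' - x) * y') + x * (y' - y) * 1.
  by rewrite scale1r mul1r mulr1 mulrBl mulrBr addrA subrK.
by apply: lspan_lin; apply: lspan_ideal; apply: rK.
Qed.

Fact aqmulA : associative aqmul.
Proof.
move=> x y w; have [v ->] := aq_surj x; have [v' ->] := aq_surj y.
by have [v'' ->] := aq_surj w; rewrite !aqmulE mulrA.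
Qed.

Fact aqmul1 : left_id aqone aqmul.
Proof. by move=> x; have [v ->] := aq_surj x; rewrite aqmulE mul1r. Qed.

Fact aqmulr1 : right_id aqone aqmul.
Proof. by move=> x; have [v ->] := aq_surj x; rewrite aqmulE mulr1. Qed.

Fact aqmulDl : left_distributive aqmul +%R.
Proof.
move=> x y w; have [v ->] := aq_surj x; have [v' ->] := aq_surj y.
by have [v'' ->] := aq_surj w; rewrite -linearD !aqmulE mulrDl linearD.
Qed.

Fact aqmulDr : right_distributive aqmul +%R.
Proof.
move=> x y w; have [v ->] := aq_surj x; have [v' ->] := aq_surj y.
by have [v'' ->] := aq_surj w; rewrite -linearD !aqmulE mulrDr linearD.
Qed.

HB.instance Definition _ := GRing.Zmodule_isPzRing.Build algQuot
  aqmulA aqmul1 aqmulr1 aqmulDl aqmulDr.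

Lemma aqM x y : aq (x * y) = aq x * aq y.
Proof. by rewrite -[RHS]/(aqmul _ _) aqmulE. Qed.

Lemma aq1 : aq 1 = 1. Proof. by []. Qed.

HB.instance Definition _ :=
  GRing.isMonoidMorphism.Build E algQuot aq (conj aq1 aqM).

Fact aqscaleAl c (x y : algQuot) : c *: (x * y) = (c *: x) * y.
Proof.
have [v ->] := aq_surj x; have [w ->] := aq_surj y.
by rewrite -aqM -!linearZ /= -aqM pzalg_scalerAl.
Qed.

Fact aqscaleAr c (x y : algQuot) : c *: (x * y) = x * (c *: y).
Proof.
have [v ->] := aq_surj x; have [w ->] := aq_surj y.
by rewrite -aqM -!linearZ /= -aqM pzalg_scalerAr.
Qed.

HB.instance Definition _ :=
  PzRing_isPzAlgebra.Build R algQuot (@scalerA R _) (@scale1r R _)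
    (@scalerDr R _) (@scalerDl R _) aqscaleAl aqscaleAr.

End AlgebraQuotient.

Section Subalgebra.
Variables (R : pzRingType) (E : pzAlgType R) (S : E -> Prop).

Inductive subalg_gen : E -> Prop :=
| SubalgGen x of S x : subalg_gen x
| Subalg1 : subalg_gen 1
| SubalgLin c x y of subalg_gen x & subalg_gen y : subalg_gen (c *: x + y)
| SubalgM x y of subalg_gen x & subalg_gen y : subalg_gen (x * y).

Definition subalg_pred : {pred E} := fun x => `[< subalg_gen x >].

Lemma subalgP x : reflect (subalg_gen x) (x \in subalg_pred).
Proof. exact: asboolP. Qed.

Fact subalg_submod : submod_closed subalg_pred.
Proof.
have lin c x y : subalg_gen x -> subalg_gen y -> subalg_gen (c *: x + y).
  exact: SubalgLin.
split=> [|c x y /subalgP Sx /subalgP Sy]; apply/subalgP; last exact: lin.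
by have := lin (-1) 1 1 Subalg1 Subalg1; rewrite scaleN1r addNr.
Qed.
HB.instance Definition _ :=
  GRing.isSubmodClosed.Build R E subalg_pred subalg_submod.

Fact subalg_mulr : mulr_closed subalg_pred.
Proof.
split=> [|x y /subalgP Sx /subalgP Sy]; apply/subalgP; first exact: Subalg1.
exact: SubalgM.
Qed.
HB.instance Definition _ :=
  GRing.isMulClosed.Build E subalg_pred subalg_mulr.

Definition subalg := {x : E | x \in subalg_pred}.

HB.instance Definition _ := SubChoice.on subalg.
HB.instance Definition _ := [SubChoice_isSubZmodule of subalg by <:].
HB.instance Definition _ := [SubZmodule_isSubLmodule of subalg by <:].

Fact subalg_subring : subring_closed subalg_pred.
Proof. by split=> [|x y|x y]; [exact: rpred1 | exact: rpredB | exact: rpredM]. Qed.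
HB.instance Definition _ :=
  GRing.SubZmodule_isSubPzRing.Build E subalg_pred subalg subalg_subring.

Fact subalg_scalerAl c (x y : subalg) : c *: (x * y) = (c *: x) * y.
Proof. by apply: val_inj; rewrite !(linearZ, rmorphM) /= pzalg_scalerAl. Qed.

Fact subalg_scalerAr c (x y : subalg) : c *: (x * y) = x * (c *: y).
Proof. by apply: val_inj; rewrite !(linearZ, rmorphM) /= pzalg_scalerAr. Qed.

HB.instance Definition _ :=
  PzRing_isPzAlgebra.Build R subalg (@scalerA R _) (@scale1r R _)
    (@scalerDr R _) (@scalerDl R _) subalg_scalerAl subalg_scalerAr.

Definition insubalg x (Sx : S x) : subalg :=
  exist _ x (introT (subalgP x) (SubalgGen Sx)).

End Subalgebra.

Section FreeModule.
Variables (R : comNzRingType) (K : choiceType).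

Lemma malgZU c d (w : K) : c *: << d *g w >> = << c * d *g w >> :> {malg R[K]}.
Proof. by apply/malgP => v; rewrite mcoeffZ !mcoeffU mulrnAr. Qed.

Lemma malg_lin_ind (P : {malg R[K]} -> Prop) :
    P 0 -> (forall c w x, P x -> P (c *: << w >> + x)) -> forall x, P x.
Proof.
move=> P0 PS x; rewrite [x]monalgE; elim/big_rec: _ => // w y _ Py.
by rewrite -[x@_w]mulr1 -malgZU; apply: PS.
Qed.

Variables (W : lmodType R) (h : K -> W).

Definition malg_lift (x : {malg R[K]}) : W := \sum_(w <- msupp x) x@_w *: h w.

Lemma malg_liftEw (d : {fset K}) x : (msupp x `<=` d)%fset ->
  malg_lift x = \sum_(w <- d) x@_w *: h w.
Proof.
move=> le; rewrite [LHS](big_fset_incl _ le) => //= w _ /mcoeff_outdom ->.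
by rewrite scale0r.
Qed.

Fact malg_lift_is_linear : linear malg_lift.
Proof.
move=> c x y; pose d := (msupp x `|` msupp y `|` msupp (c *: x + y))%fset.
have [dx dy dxy] : [/\ msupp x `<=` d, msupp y `<=` d
                     & msupp (c *: x + y) `<=` d]%fset.
  by split; apply/fsubsetP => w wd; rewrite !in_fsetU wd ?orbT.
rewrite !(malg_liftEw (d := d)) // scaler_sumr -big_split /=.
by apply: eq_bigr => w _; rewrite mcoeffD mcoeffZ scalerDl scalerA.
Qed.
HB.instance Definition _ :=
  GRing.isLinear.Build R {malg R[K]} W *:%R malg_lift malg_lift_is_linear.

Lemma malg_liftU w : malg_lift << w >> = h w.
Proof. by rewrite (malg_liftEw msuppU_le) big_seq_fset1 mcoeffUU scale1r. Qed.

End FreeModule.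

Section FreeAlgebra.
Variables (R : comNzRingType) (G : choiceType).

Definition word := seq G.
HB.instance Definition _ := Choice.on word.

Fact word_unit (u v : word) : u ++ v = [::] -> u = [::] /\ v = [::].
Proof. by case: u. Qed.

HB.instance Definition _ := Choice_isMonomialDef.Build word
  (@catA G) (@cat0s G) (@cats0 G) word_unit.

Definition freeAlg := {malg R[word]}.

HB.instance Definition _ := GRing.Lalgebra.on freeAlg.

Definition fgen : G -> freeAlg :=
  locked_with lock_key (fun g => << ([:: g] : word) >>).

Fact freeAlg_scalerAl c (x y : freeAlg) : c *: (x * y) = (c *: x) * y.
Proof. exact: scalerAl. Qed.

Fact freeAlg_scalerAr c (x y : freeAlg) : c *: (x * y) = x * (c *: y).
Proof.
elim/malg_lin_ind: x c y => [|d w x IH] c y; first by rewrite !mul0r scaler0.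
rewrite !mulrDl scalerDr IH; congr (_ + _).
rewrite -!scalerAl scalerA mulrC -scalerA; congr (_ *: _).
elim/malg_lin_ind: y => [|e v y IHy]; first by rewrite scaler0 mulr0 scaler0.
rewrite scalerDr !mulrDr scalerDr IHy; congr (_ + _).
by rewrite !malgZU !malgM_def !fgmulUU malgZU !mul1r.
Qed.

HB.instance Definition _ :=
  PzRing_isPzAlgebra.Build R freeAlg (@scalerA R _) (@scale1r R _)
    (@scalerDr R _) (@scalerDl R _) freeAlg_scalerAl freeAlg_scalerAr.

Variables (E : pzAlgType R) (h : G -> E).

Definition word_eval (w : word) : E := \prod_(g <- w) h g.

Definition free_lift : freeAlg -> E := malg_lift word_eval.

HB.instance Definition _ := GRing.isLinear.Build R freeAlg E *:%R free_lift
  (malg_lift_is_linear word_eval).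

Lemma free_liftU (w : word) : free_lift << w >> = word_eval w.
Proof. exact: malg_liftU. Qed.

Lemma free_lift_gen g : free_lift (fgen g) = h g.
Proof. by rewrite /fgen unlock free_liftU /word_eval big_seq1. Qed.

Fact free_lift_is_monoid_morphism : monoid_morphism free_lift.
Proof.
have LD : {morph free_lift : x y / x + y} by exact: linearD.
have LZ c : {morph free_lift : x / c *: x} by exact: linearZ.
have L0 : free_lift 0 = 0 by exact: linear0.
split=> [|x y]; first by rewrite [LHS]free_liftU /word_eval big_nil.
elim/malg_lin_ind: x y => [|c w x IH] y; first by rewrite mul0r L0 mul0r.
rewrite mulrDl !LD IH mulrDl -scalerAl !LZ -pzalg_scalerAl.
congr (_ *: _ + _).
elim/malg_lin_ind: y => [|d v y IHy]; first by rewrite mulr0 L0 mulr0.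
rewrite mulrDr !LD IHy mulrDr -[_ * (d *: _)]freeAlg_scalerAr !LZ.
rewrite -pzalg_scalerAr; congr (_ *: _ + _).
by rewrite malgM_def fgmulUU mul1r !free_liftU /word_eval big_cat.
Qed.
HB.instance Definition _ :=
  GRing.isMonoidMorphism.Build freeAlg E free_lift free_lift_is_monoid_morphism.

End FreeAlgebra.

Section TensorPower.
Variables (R : comNzRingType) (A : superAlgType R) (n : nat).

Definition upd (a : {ffun 'I_n -> A}) i (x : A) : {ffun 'I_n -> A} :=
  [ffun j => if j == i then x else a j].

Definition multilinear (W : lmodType R) (phi : {ffun 'I_n -> A} -> W) :=
  forall a i c x y,
    phi (upd a i (c *: x + y)) = c *: phi (upd a i x) + phi (upd a i y).

Inductive tensor_rel : {malg R[{ffun 'I_n -> A}]} -> Prop :=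
| TensorRel a i c x y :
    tensor_rel (<< upd a i (c *: x + y) >>
                - (c *: << upd a i x >> + << upd a i y >>)).

Definition tpow := modQuot tensor_rel.
HB.instance Definition _ := GRing.Lmodule.on tpow.

Definition tensor (a : {ffun 'I_n -> A}) : tpow := mq tensor_rel << a >>.

Lemma tensor_multilinear : multilinear tensor.
Proof.
move=> a i c x y; rewrite -[RHS]linearP; apply/mq_eqP/lspan_gen.
exact: TensorRel.
Qed.

Section Lift.
Variables (W : lmodType R) (phi : {ffun 'I_n -> A} -> W).

Definition tlift : tpow -> W :=
  locked_with lock_key (mqlift (malg_lift phi)).

Hypothesis phi_lin : multilinear phi.

Fact tlift_rel x : tensor_rel x -> malg_lift phi x = 0.
Proof.
case=> a i c u v; rewrite addrC -scaleN1r malg_lift_is_linear.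
have U := malg_liftU phi.
by rewrite malg_lift_is_linear !{}U phi_lin scaleN1r addNr.
Qed.

Lemma tlift_is_linear : linear tlift.
Proof. by rewrite /tlift unlock; exact: mqlift_is_linear tlift_rel. Qed.

Lemma tlift_tensor a : tlift (tensor a) = phi a.
Proof. by rewrite /tlift unlock (mqliftE tlift_rel); apply: malg_liftU. Qed.
End Lift.

Lemma tensor_lin_ind (P : tpow -> Prop) :
    P 0 -> (forall c x y, P x -> P y -> P (c *: x + y)) ->
  (forall a, P (tensor a)) -> forall x, P x.
Proof.
move=> P0 PL PT x; have [v ->] := mq_surj x.
apply: (malg_lin_ind (P := fun w => P (mq tensor_rel w))) => [|c a w IH].
  by rewrite linear0.
rewrite linearP; apply: PL => //; exact: PT.
Qed.

Lemma multilinear0 (W : lmodType R) (phi : {ffun 'I_n -> A} -> W)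
    (a : {ffun 'I_n -> A}) i :
  multilinear phi -> a i = 0 -> phi a = 0.
Proof.
move=> /(_ a i (-1) 0 0); rewrite scaler0 add0r scaleN1r addNr => + ai0.
by congr (phi _ = 0); apply/ffunP => j; rewrite ffunE; case: eqP => // ->.
Qed.

(* It suffices to check multilinear identities on homogeneous tensors. *)
Lemma tensor_homog_ind (P : tpow -> Prop) :
    P 0 -> (forall c x y, P x -> P y -> P (c *: x + y)) ->
    (forall (a : {ffun 'I_n -> A}) (e : {ffun 'I_n -> bool}),
      (forall i, homog (e i) (a i)) -> P (tensor a)) ->
  forall x, P x.
Proof.
move=> P0 PL PT; apply: tensor_lin_ind => // a.
suff H m : (m <= n)%N -> forall b : {ffun 'I_n -> A},
    (forall i : 'I_n, (m <= i)%N -> homogeneous (b i)) -> P (tensor b).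
  by apply: (H n) => // i; rewrite leqNgt ltn_ord.
elim: m => [_ b hb|m IH ltmn b hb].
  pose e := [ffun i => hproj true (b i) == b i].
  apply: (PT b e) => i; rewrite ffunE.
  have [[] hbi] := hb i isT; rewrite (hproj_homog true hbi) /= ?eqxx //.
  by case: eqP => // <-; exact: linear0.
pose i := Ordinal ltmn.
have -> : b = upd b i (1 *: hproj false (b i) + hproj true (b i)).
  apply/ffunP => j; rewrite ffunE scale1r hprojD.
  by case: eqP => // ->.
have hu e : P (tensor (upd b i (hproj e (b i)))).
  apply: IH => [|j mj]; first exact: ltnW.
  rewrite ffunE; case: eqP => [_|/eqP ji]; first by exists e; apply: homog_hproj.
  apply: hb; rewrite ltn_neqAle mj andbT; apply: contra ji => /eqP mj'.
  exact/eqP/val_inj.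
by rewrite tensor_multilinear; apply: PL.
Qed.

Lemma multilinear_perm (W : lmodType R) (phi : {ffun 'I_n -> A} -> W)
    (s : 'S_n) (g : 'I_n -> A -> A) :
    (forall i, linear (g i)) -> multilinear phi ->
  multilinear (fun a => phi [ffun i => g i (a (s i))]).
Proof.
move=> g_lin phi_lin a i c x y; pose b := [ffun j => g j (a (s j))].
have upd_s u :
    [ffun j => g j (upd a i u (s j))] = upd b (s^-1%g i) (g (s^-1%g i) u).
  apply/ffunP => j; rewrite !ffunE.
  have [->|ne] := eqVneq j (s^-1%g i); first by rewrite permKV eqxx.
  by rewrite ifN //; apply: contra ne => /eqP <-; rewrite permK.
by rewrite !upd_s g_lin phi_lin.
Qed.

Lemma multilinear_sum (W : lmodType R) (J : finType) (c : J -> R)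
    (phi : J -> {ffun 'I_n -> A} -> W) :
    (forall j, multilinear (phi j)) ->
  multilinear (fun a => \sum_j c j *: phi j a).
Proof.
move=> phi_lin a i d x y; rewrite scaler_sumr -big_split /=.
apply: eq_bigr => j _; rewrite phi_lin scalerDr !scalerA.
by rewrite [c j * d]mulrC.
Qed.

End TensorPower.

Section TensorAlgebra.
Variables (R : comNzRingType) (A : superAlgType R) (n : nat).
Implicit Types (a b : {ffun 'I_n -> A}) (e d : {ffun 'I_n -> bool}).
Local Notation T := (tpow A n).

(* The sign of the product of homogeneous pure tensors of parities e and d:
   the factor d_j passes e_i for all j < i. *)
Definition koszul e d : R :=
  \prod_(i < n) \prod_(j < n | (j < i)%N) (-1) ^+ (e i && d j).

Definition addp e d : {ffun 'I_n -> bool} := [ffun i => e i (+) d i].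

Lemma koszulDl e1 e2 d : koszul (addp e1 e2) d = koszul e1 d * koszul e2 d.
Proof.
rewrite /koszul -big_split; apply: eq_bigr => i _ /=.
rewrite -big_split; apply: eq_bigr => j _ /=.
by rewrite ffunE andb_addl signr_addb.
Qed.

Lemma koszulDr e d1 d2 : koszul e (addp d1 d2) = koszul e d1 * koszul e d2.
Proof.
rewrite /koszul -big_split; apply: eq_bigr => i _ /=.
rewrite -big_split; apply: eq_bigr => j _ /=.
by rewrite ffunE andb_addr signr_addb.
Qed.

Definition evenp : {ffun 'I_n -> bool} := [ffun=> false].

Lemma koszul0l d : koszul evenp d = 1.
Proof. by rewrite /koszul big1 // => i _; rewrite big1 // => j _; rewrite ffunE. Qed.

Lemma koszul0r e : koszul e evenp = 1.
Proof.
by rewrite /koszul big1 // => i _; rewrite big1 // => j _; rewrite ffunE andbF.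
Qed.

Definition ptmul : {ffun 'I_n -> A} -> {ffun 'I_n -> A} -> T :=
  locked_with lock_key (fun a b =>
    \sum_(ed : {ffun 'I_n -> bool} * {ffun 'I_n -> bool}) koszul ed.1 ed.2 *:
      tensor [ffun i => hproj (ed.1 i) (a i) * hproj (ed.2 i) (b i)]).

Lemma ptmul_multilinear_l b : multilinear (ptmul^~ b).
Proof.
rewrite /ptmul unlock; apply: multilinear_sum => -[e d] /=.
have := @multilinear_perm R A n T (@tensor R A n) 1%g
  (fun i x => hproj (e i) x * hproj (d i) (b i)).
rewrite /multilinear => H a i c x y.
have E (u : {ffun 'I_n -> A}) : [ffun j => hproj (e j) (u j) * hproj (d j) (b j)] =
           [ffun j => hproj (e j) (u ((1%g : 'S_n) j)) * hproj (d j) (b j)].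
  by apply/ffunP => j; rewrite !ffunE perm1.
rewrite !{}E; apply: H => [j c' u v|]; last exact: tensor_multilinear.
by rewrite hproj_linear mulrDl pzalg_scalerAl.
Qed.

Lemma ptmul_multilinear_r a : multilinear (ptmul a).
Proof.
rewrite /ptmul unlock; apply: multilinear_sum => -[e d] /=.
have := @multilinear_perm R A n T (@tensor R A n) 1%g
  (fun i x => hproj (e i) (a i) * hproj (d i) x).
rewrite /multilinear => H b i c x y.
have E (u : {ffun 'I_n -> A}) : [ffun j => hproj (e j) (a j) * hproj (d j) (u j)] =
           [ffun j => hproj (e j) (a j) * hproj (d j) (u ((1%g : 'S_n) j))].
  by apply/ffunP => j; rewrite !ffunE perm1.
rewrite !{}E; apply: H => [j c' u v|]; last exact: tensor_multilinear.
by rewrite hproj_linear mulrDr pzalg_scalerAr.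
Qed.


Lemma ptmul_homog a b e d :
    (forall i, homog (e i) (a i)) -> (forall i, homog (d i) (b i)) ->
  ptmul a b = koszul e d *: tensor [ffun i => a i * b i].
Proof.
move=> ha hb; rewrite /ptmul unlock (bigD1 (e, d)) //= [X in _ + X]big1.
  rewrite addr0; congr (_ *: tensor _).
  by apply/ffunP => i; rewrite !ffunE ha hb.
move=> [e' d'] /=; rewrite xpair_eqE negb_and => /orP ned.
have [i nei] : exists i, (e' i != e i) || (d' i != d i).
  case: ned => /eqP/ffunP ne; apply/existsP; apply: contra_notT ne.
    by move/existsPn => E i; have := E i; rewrite negb_or !negbK => /andP[/eqP].
  by move/existsPn => E i; have := E i; rewrite negb_or !negbK => /andP[_ /eqP].
rewrite [tensor _](multilinear0 (i := i) (@tensor_multilinear R A n)) ?scaler0 //.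
rewrite ffunE (hproj_homog _ (ha i)) (hproj_homog _ (hb i)).
by case/orP: nei => /negPf ->; rewrite ?mul0r ?mulr0.
Qed.

Lemma tlift_ptmul_linear a : linear (tlift (ptmul a)).
Proof. exact/tlift_is_linear/ptmul_multilinear_r. Qed.

Lemma tlift_ptmulE a b : tlift (ptmul a) (tensor b) = ptmul a b.
Proof. exact/tlift_tensor/ptmul_multilinear_r. Qed.

Let lin0 (f : T -> T) : linear f -> f 0 = 0.
Proof. by move/(_ (-1) 0 0); rewrite scaler0 add0r scaleN1r addNr. Qed.

Lemma ptmul_multilinear y : multilinear (fun a => tlift (ptmul a) y).
Proof.
move: y; apply: tensor_lin_ind => [|d u v Mu Mv|b] a i c x y.
- by rewrite !(lin0 (tlift_ptmul_linear _)) scaler0 addr0.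
- by rewrite !tlift_ptmul_linear Mu Mv !scalerDr !scalerA [d * c]mulrC addrACA.
- by rewrite !tlift_ptmulE; apply: ptmul_multilinear_l.
Qed.

(* The multiplication of the tensor power, extending
   (a_1 (x) .. (x) a_n) (b_1 (x) .. (x) b_n)
     = koszul e d (a_1 b_1 (x) .. (x) a_n b_n)
   bilinearly; see [tmul_homog]. *)
Definition tmul : T -> T -> T :=
  locked_with lock_key (fun x y => tlift (fun a => tlift (ptmul a) y) x).

Lemma tmulE x y : tmul x y = tlift (fun a => tlift (ptmul a) y) x.
Proof. by rewrite /tmul unlock. Qed.

Lemma tmul_linear_l y : linear (tmul^~ y).
Proof. by rewrite /tmul unlock; apply/tlift_is_linear/ptmul_multilinear. Qed.

Lemma tmul_tensor a b : tmul (tensor a) (tensor b) = ptmul a b.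
Proof. by rewrite tmulE tlift_tensor ?tlift_ptmulE //; apply: ptmul_multilinear. Qed.

Lemma tmul_linear_r x : linear (tmul x).
Proof.
move=> c y z; move: x; apply: tensor_lin_ind => [|d u v IHu IHv|a].
- by rewrite !(lin0 (tmul_linear_l _)) scaler0 addr0.
- rewrite !(tmul_linear_l _ d) IHu IHv !scalerDr !scalerA [d * c]mulrC.
  by rewrite addrACA.
- have tE y' : tmul (tensor a) y' = tlift (ptmul a) y'.
    by rewrite tmulE tlift_tensor //; apply: ptmul_multilinear.
  by rewrite !tE tlift_ptmul_linear.
Qed.

Lemma tmul_homog a b e d :
    (forall i, homog (e i) (a i)) -> (forall i, homog (d i) (b i)) ->
  tmul (tensor a) (tensor b) = koszul e d *: tensor [ffun i => a i * b i].
Proof. by move=> ha hb; rewrite tmul_tensor; apply: ptmul_homog. Qed.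

Definition tone : T := tensor [ffun=> 1].

Fact tmulA : associative tmul.
Proof.
move=> x y z; have tZl c u v : tmul (c *: u) v = c *: tmul u v.
  have := tmul_linear_l v c u 0; rewrite /= (lin0 (tmul_linear_l _)).
  by rewrite !addr0.
have tZr c u v : tmul v (c *: u) = c *: tmul v u.
  have := tmul_linear_r v c u 0; rewrite /= (lin0 (tmul_linear_r _)).
  by rewrite !addr0.
move: x; apply: tensor_homog_ind => [|c u v IHu IHv|a e ha].
- by rewrite !(lin0 (tmul_linear_l _)).
- by rewrite !(tmul_linear_l _ c) IHu IHv.
move: y; apply: tensor_homog_ind => [|c u v IHu IHv|b d hb].
- by rewrite !(lin0 (tmul_linear_l _)) !(lin0 (tmul_linear_r _))
       (lin0 (tmul_linear_l _)).
- by rewrite !(tmul_linear_l _ c) !(tmul_linear_r _ c) (tmul_linear_l _ c)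
       IHu IHv.
move: z; apply: tensor_homog_ind => [|c u v IHu IHv|w g hw].
- by rewrite !(lin0 (tmul_linear_r _)).
- by rewrite !(tmul_linear_r _ c) IHu IHv.
rewrite (tmul_homog ha hb) (tmul_homog hb hw) tZl tZr.
rewrite (tmul_homog (e := e) (d := addp d g)) //; last first.
  by move=> i; rewrite !ffunE; apply: homogM.
rewrite (tmul_homog (e := addp e d) (d := g)) //; last first.
  by move=> i; rewrite !ffunE; apply: homogM.
rewrite !scalerA koszulDl koszulDr mulrC mulrA.
congr (_ *: tensor _); by apply/ffunP => i; rewrite !ffunE mulrA.
Qed.

Fact tmul1 : left_id tone tmul.
Proof.
apply: tensor_homog_ind => [|c u v IHu IHv|b d hb].
- exact: lin0 (tmul_linear_r _).
- by rewrite tmul_linear_r IHu IHv.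
rewrite (tmul_homog (e := evenp) (d := d)) // => [|i]; last first.
  by rewrite !ffunE; apply: homog1.
rewrite koszul0l scale1r; congr tensor.
by apply/ffunP => i; rewrite !ffunE mul1r.
Qed.

Fact tmulr1 : right_id tone tmul.
Proof.
apply: tensor_homog_ind => [|c u v IHu IHv|b d hb].
- exact: lin0 (tmul_linear_l _).
- by rewrite tmul_linear_l IHu IHv.
rewrite (tmul_homog (e := d) (d := evenp)) // => [|i]; last first.
  by rewrite !ffunE; apply: homog1.
rewrite koszul0r scale1r; congr tensor.
by apply/ffunP => i; rewrite !ffunE mulr1.
Qed.

Fact tmulDl : left_distributive tmul +%R.
Proof. by move=> x y z; have := tmul_linear_l z 1 x y; rewrite !scale1r. Qed.

Fact tmulDr : right_distributive tmul +%R.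
Proof. by move=> z x y; have := tmul_linear_r z 1 x y; rewrite !scale1r. Qed.

HB.instance Definition _ := GRing.Zmodule_isPzRing.Build T
  tmulA tmul1 tmulr1 tmulDl tmulDr.

Fact tpow_scalerAl c (x y : T) : c *: (x * y) = (c *: x) * y.
Proof.
have := tmul_linear_l y c x 0; rewrite /= (lin0 (tmul_linear_l _)).
by rewrite !addr0.
Qed.

Fact tpow_scalerAr c (x y : T) : c *: (x * y) = x * (c *: y).
Proof.
have := tmul_linear_r x c y 0; rewrite /= (lin0 (tmul_linear_r _)).
by rewrite !addr0.
Qed.

HB.instance Definition _ :=
  PzRing_isPzAlgebra.Build R T (@scalerA R _) (@scale1r R _)
    (@scalerDr R _) (@scalerDl R _) tpow_scalerAl tpow_scalerAr.

Definition at_pos (i : 'I_n) (a : A) : T :=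
  tensor [ffun j => if j == i then a else 1].

(* The sign of the superpermutation by w of a homogeneous pure tensor of
   parity e, one factor for each inversion of w. *)
Definition superperm_sign (w : 'S_n) e : R :=
  \prod_(i < n) \prod_(j < n | (i < j)%N && (w j < w i)%N) (-1) ^+ (e i && e j).

Definition superperm_pure (w : 'S_n) : {ffun 'I_n -> A} -> T :=
  locked_with lock_key (fun a =>
    \sum_(e : {ffun 'I_n -> bool}) superperm_sign w e *:
      tensor [ffun l => hproj (e (w^-1%g l)) (a (w^-1%g l))]).

(* The action of w on the tensor power, moving the factor in position i to
   position w i. *)
Definition superperm (w : 'S_n) (x : T) : T := tlift (superperm_pure w) x.

Lemma superperm_multilinear w : multilinear (superperm_pure w).
Proof.
rewrite /superperm_pure unlock; apply: multilinear_sum => e.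
apply: (@multilinear_perm R A n T (@tensor R A n) w^-1%g
          (fun l x => hproj (e (w^-1%g l)) x)) => [l|]; first exact: hproj_linear.
exact: tensor_multilinear.
Qed.

Lemma superperm_linear w : linear (superperm w).
Proof. exact/tlift_is_linear/superperm_multilinear. Qed.

Lemma superperm_homog w a e : (forall i, homog (e i) (a i)) ->
  superperm w (tensor a) =
    superperm_sign w e *: tensor [ffun l => a (w^-1%g l)].
Proof.
move=> ha; rewrite /superperm tlift_tensor; last exact: superperm_multilinear.
rewrite /superperm_pure unlock (bigD1 e) //= [X in _ + X]big1 => [|e' ne].
  rewrite addr0; congr (_ *: tensor _).
  by apply/ffunP => i; rewrite !ffunE ha.
have [i nei] : exists i, e' i != e i.
  move/eqP/ffunP: ne => ne; apply/existsP; apply: contra_notT ne.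
  by move/existsPn => E i; have := E i; rewrite negbK => /eqP.
rewrite [tensor _](multilinear0 (i := w i) (@tensor_multilinear R A n)) ?scaler0 //.
by rewrite ffunE permK (hproj_homog _ (ha i)) (negPf nei).
Qed.

End TensorAlgebra.

Section Symmetric.
Variables (R : comNzRingType) (A : superAlgType R).

Record trace_form (tr : {scalar A}) : Prop := {
  tr_even : forall a, homog true a -> tr a = 0;
  tr_sym : forall e e' a b, homog e a -> homog e' b ->
    tr (a * b) = (-1) ^+ (e && e') * tr (b * a);
  tr_bij : forall phi : {scalar A}, exists! a, forall b, phi b = tr (a * b);
  (* a linear form on A has parity e when it vanishes on A_(1 - e) *)
  tr_parity : forall e a,
    homog e a <-> (forall b, homog (~~ e) b -> tr (a * b) = 0)
}.

(* [supercentral e] is the parity e part of the supercenter of A. *)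
Definition supercentral e (a : A) :=
  homog e a /\
  forall e' b, homog e' b -> a * b = (-1) ^+ (e && e') *: (b * a).

Definition invertible (a : A) := exists u, a * u = 1 /\ u * a = 1.

End Symmetric.

Section Presentation.
Variable R : comNzRingType.

Section Def.
Variables (G : choiceType) (rel : freeAlg R G -> freeAlg R G -> Prop).

Definition presAlg := algQuot (fun u => exists x y, rel x y /\ u = x - y).
HB.instance Definition _ := PzAlgebra.on presAlg.
HB.instance Definition _ := GRing.Lmodule.on presAlg.

Definition pgen (g : G) : presAlg := aq _ (fgen R g).

Lemma presP x y : rel x y -> aq _ x = aq _ y :> presAlg.
Proof.
move=> xy; apply/aq_eqP/lspan_gen; rewrite -[x - y]mul1r -[1 * _]mulr1.
by apply: IdealGen; exists x, y.
Qed.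

Lemma pres_universal (E : pzAlgType R) (h : G -> E) :
    (forall x y, rel x y -> free_lift h x = free_lift h y) ->
  exists phi : presAlg -> E,
    [/\ linear phi, monoid_morphism phi & forall g, phi (pgen g) = h g].
Proof.
move=> h_rel; pose f : {linear freeAlg R G -> E} := free_lift h.
have f0 u : ideal_gen (fun u => exists x y, rel x y /\ u = x - y) u -> f u = 0.
  have fM x y : f (x * y) = f x * f y by exact: rmorphM (free_lift h) x y.
  case=> x s y [v [w [vw ->]]]; rewrite !fM.
  by rewrite linearB /f /= (h_rel _ _ vw) subrr mulr0 mul0r.
exists (mqlift f); split=> [||g].
- exact: mqlift_is_linear f0.
- split=> [|x y]; first by rewrite [LHS](mqliftE f0) [LHS](rmorph1 (free_lift h)).
  have [v ->] := aq_surj x; have [w ->] := aq_surj y.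
  by rewrite -aqM !(mqliftE f0) [LHS](rmorphM (free_lift h)).
- by rewrite [LHS](mqliftE f0) [LHS]free_lift_gen.
Qed.
End Def.

Inductive morph_rel (P E : pzAlgType R) (j : P -> E) : E -> E -> Prop :=
| MorphLin c x y : morph_rel j (j (c *: x + y)) (c *: j x + j y)
| Morph1 : morph_rel j (j 1) 1
| MorphM x y : morph_rel j (j (x * y)) (j x * j y).

End Presentation.

Section SimpleReflections.
Variable n : nat.

(* The positions i and i + 1 exchanged by the i-th simple reflection. *)
Definition lo (i : 'I_n.-1) : 'I_n := widen_ord (leq_pred n) i.

Fact hi_subproof (i : 'I_n.-1) : (i.+1 < n)%N.
Proof. by rewrite -ltn_predRL. Qed.
Definition hi (i : 'I_n.-1) : 'I_n := Ordinal (hi_subproof i).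

Definition simple (i : 'I_n.-1) : 'S_n := tperm (lo i) (hi i).

(* w = s_(i_1) o ... o s_(i_k); [rev] because the product of 'S_n composes
   from left to right. *)
Definition expression (w : 'S_n) (s : seq 'I_n.-1) :=
  w = (\prod_(i <- rev s) simple i)%g.

Definition reduced_expression w s :=
  expression w s /\ forall s', expression w s' -> (size s <= size s')%N.

End SimpleReflections.

Section FrobeniusHecke.
Variables (R : comNzRingType) (A : superAlgType R) (n : nat) (z : R).
Variables (I : finType) (B Bd : I -> A).

Definition teleporter (i j : 'I_n) : tpow A n :=
  \sum_b at_pos i (B b) * at_pos j (Bd b).

Definition hecke_gen := (tpow A n + 'I_n.-1)%type.

Definition free_tensor (a : tpow A n) : freeAlg R hecke_gen :=
  fgen R (inl a : hecke_gen).
Definition free_T (i : 'I_n.-1) : freeAlg R hecke_gen :=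
  fgen R (inr i : hecke_gen).

Section HeckeRel.
Local Notation t := free_tensor.
Local Notation T := free_T.

(* H_n(A, z): [HeckeTensor] makes the n-th tensor power of A map to it as an
   algebra. *)
Inductive hecke_rel : freeAlg R hecke_gen -> freeAlg R hecke_gen -> Prop :=
| HeckeTensor x y of morph_rel t x y : hecke_rel x y
| HeckeComm (i j : 'I_n.-1) of (i.+1 < j)%N || (j.+1 < i)%N :
    hecke_rel (T i * T j) (T j * T i)
| HeckeBraid (i j : 'I_n.-1) of j = i.+1 :> nat :
    hecke_rel (T i * T j * T i) (T j * T i * T j)
| HeckeQuadratic i :
    hecke_rel (T i ^+ 2) (z *: (t (teleporter (lo i) (hi i)) * T i) + 1)
| HeckeSlide i a :
    hecke_rel (T i * t a) (t (superperm (simple i) a) * T i).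
End HeckeRel.

Definition hecke := presAlg hecke_rel.
HB.instance Definition _ := PzAlgebra.on hecke.
HB.instance Definition _ := GRing.Lmodule.on hecke.

Definition hecke_tensor (a : tpow A n) : hecke :=
  pgen hecke_rel (inl a : hecke_gen).
Definition hecke_T (i : 'I_n.-1) : hecke := pgen hecke_rel (inr i : hecke_gen).

Definition aff_gen := (hecke + ('I_n + 'I_n))%type.

Definition free_hecke (x : hecke) : freeAlg R aff_gen :=
  fgen R (inl x : aff_gen).
Definition free_X (i : 'I_n) : freeAlg R aff_gen :=
  fgen R (inr (inl i) : aff_gen).
Definition free_Xinv (i : 'I_n) : freeAlg R aff_gen :=
  fgen R (inr (inr i) : aff_gen).

Section AffRel.
Local Notation h := free_hecke.
Local Notation X := free_X.
Local Notation Xinv := free_Xinv.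

(* H_n^aff(A, z): [AffHecke] makes H_n(A, z) map to it as an algebra, and the
   next three constructors do the same for k[X_1^(+-1), ..., X_n^(+-1)]. *)
Inductive aff_rel : freeAlg R aff_gen -> freeAlg R aff_gen -> Prop :=
| AffHecke x y of morph_rel h x y : aff_rel x y
| AffComm i j : aff_rel (X i * X j) (X j * X i)
| AffInvr i : aff_rel (X i * Xinv i) 1
| AffInvl i : aff_rel (Xinv i * X i) 1
| AffTX (i : 'I_n.-1) (j : 'I_n) of j != lo i & j != hi i :
    aff_rel (h (hecke_T i) * X j) (X j * h (hecke_T i))
| AffTXT i : aff_rel (h (hecke_T i) * X (lo i) * h (hecke_T i)) (X (hi i))
| AffTensor i a :
    aff_rel (X i * h (hecke_tensor a)) (h (hecke_tensor a) * X i).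
End AffRel.

Definition haff := presAlg aff_rel.
HB.instance Definition _ := PzAlgebra.on haff.
HB.instance Definition _ := GRing.Lmodule.on haff.

Definition haff_hecke (x : hecke) : haff := pgen aff_rel (inl x : aff_gen).
Definition haff_X (i : 'I_n) : haff := pgen aff_rel (inr (inl i) : aff_gen).
Definition haff_Xinv (i : 'I_n) : haff := pgen aff_rel (inr (inr i) : aff_gen).

Inductive haffp_gen : haff -> Prop :=
| HaffpHecke x : haffp_gen (haff_hecke x)
| HaffpX i : haffp_gen (haff_X i).

Definition haffp := subalg haffp_gen.
HB.instance Definition _ := PzAlgebra.on haffp.
HB.instance Definition _ := GRing.Lmodule.on haffp.

Definition haffp_hecke (x : hecke) : haffp := insubalg (HaffpHecke x).
Definition haffp_X (i : 'I_n) : haffp := insubalg (HaffpX i).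

(* Elements of H_n^aff(A, z) and of H_(n,+)^aff(A, z) defined by the same
   formulas: E is either algebra, h and X are the maps above. *)
Section Elements.
Variables (E : pzAlgType R) (h : hecke -> E) (X : 'I_n -> E).

(* The polynomial f, with X_1 being [X i1]. *)
Definition cyc_poly (i1 : 'I_n) d (a : 'I_d -> A) : E :=
  X i1 ^+ d + \sum_(i < d) h (hecke_tensor (at_pos i1 (a i))) * X i1 ^+ i.

(* X^lam b T_w, where s is a reduced expression of w. *)
Definition monomial (lam : 'I_n -> nat) (b : tpow A n) (s : seq 'I_n.-1) : E :=
  (\prod_(i < n) X i ^+ lam i) * h (hecke_tensor b) *
    h (\prod_(i <- s) hecke_T i).
End Elements.

Lemma val_cyc_poly (i1 : 'I_n) d (a : 'I_d -> A) :
  val (cyc_poly haffp_hecke haffp_X i1 a) = cyc_poly haff_hecke haff_X i1 a.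
Proof.
rewrite /cyc_poly rmorphD rmorphXn rmorph_sum; congr (_ + _).
by apply: eq_bigr => i _; rewrite rmorphM rmorphXn.
Qed.

(* H_n^f(A, z) and H_(n,+)^f(A, z) *)
Section Cyclotomic.
Variables (i1 : 'I_n) (d : nat) (a : 'I_d -> A).

Definition cyc := algQuot (fun x => x = cyc_poly haff_hecke haff_X i1 a).
HB.instance Definition _ := PzAlgebra.on cyc.
HB.instance Definition _ := GRing.Lmodule.on cyc.

Definition cycp := algQuot (fun x => x = cyc_poly haffp_hecke haffp_X i1 a).
HB.instance Definition _ := PzAlgebra.on cycp.
HB.instance Definition _ := GRing.Lmodule.on cycp.

Definition to_cyc (x : haff) : cyc := aq _ x.
Definition to_cycp (x : haffp) : cycp := aq _ x.
End Cyclotomic.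

End FrobeniusHecke.

Arguments hecke_tensor {R A n} z {I} B Bd a.
Arguments hecke_T {R A n} z {I} B Bd i.
Arguments haff_hecke {R A n} z {I} B Bd x.
Arguments haff_X {R A n} z {I} B Bd i.
Arguments haff_Xinv {R A n} z {I} B Bd i.
Arguments haffp_hecke {R A n} z {I} B Bd x.
Arguments haffp_X {R A n} z {I} B Bd i.

(* Main.v *)
(* The affine algebra acts on the polynomials in X_1, ..., X_n with coefficients
   in H = H_n(A, z): the X_i act by multiplication, and the action of T_i is
   forced by the relations and by its restriction to H.  The defect D of a
   relation among the T_i intertwines multiplications by the variables, as in
   D X_1 = X_3 D for the braid relation, so it vanishes as soon as it vanishes on
   constants.  The same propagation of defects, along descents, gives an action
   on maps from S_n to the tensor power, whence a basis of H.

   Put F_1 = f and F_(i+1) = T_i F_i T_i.  Up to lower terms F_i is X_i^d, and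
   the submodule generated by the image of f is the span L of the P F_i h with P a
   monomial and h in H.  Dividing successively by F_n, ..., F_1, in the variables
   X_n, ..., X_1, shows that the polynomials of degree less than d in each
   variable form a complement of L.  As a_(0) is invertible, X_1, and hence every
   X_i, is invertible modulo L, so both cyclotomic quotients act on the quotient
   by L; this gives linear independence.  Conversely, evaluating polynomials in a
   cyclotomic quotient kills L, and the image is stable under multiplication by
   the generators, inverses of the X_i included; this gives the spanning. *)

Require Import Defs.
From HB Require Import structures.
From mathcomp Require Import all_boot all_order all_algebra all_fingroup.
From mathcomp Require Import finmap boolp monalg zify.

Set Implicit Arguments.
Unset Strict Implicit.
Unset Printing Implicit Defensive.

Import GRing.Theory.
Local Open Scope ring_scope.

(** * Linear endomorphisms *)

(** The divisions can be composed only if the one by F_p sends the multiples of F_1, ..., F_p into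
    those of F_1, ..., F_(p-1). This is the delicate point: F_p has noncommuting coefficients, and
    the operator [overflow] that subtracts multiples of F_p does not commute with X_p, while X_p is
    among the variables by which multiples of F_1, ..., F_(p-1) are formed. That operator does
    commute with the other variables, with f (for p > 1), and with the T_j exchanging variables
    before X_p. The way out is to generate the smaller submodule from the image of f by these
    operators alone, without X_p. The polynomial representation and the division use only the
    relations of H, so they are carried out over an abstract algebra H. The basis of H enters at the
    end, to expand the coefficients of reduced polynomials. Coefficients stand to the right of the
    monomials: the variables then act by shifting exponents and tensors act coefficientwise, and
    only the action of T_i has to be constructed. *)

Section LinearMaps.
Variables (R : pzRingType) (U V : lmodType R) (f : U -> V).
Hypothesis f_linear : linear f.

Lemma linear_map0 : f 0 = 0.
Proof. by have := f_linear (-1) 0 0; rewrite scaler0 add0r scaleN1r addNr. Qed.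

Lemma linear_mapD x y : f (x + y) = f x + f y.
Proof. by have := f_linear 1 x y; rewrite !scale1r. Qed.

Lemma linear_mapZ c x : f (c *: x) = c *: f x.
Proof. by have := f_linear c x 0; rewrite linear_map0 !addr0. Qed.

End LinearMaps.

Section LinearEndomorphisms.
Variables (R : comNzRingType) (V : lmodType R).

(** The endomorphism algebra of V, the target of all representations below. It is made a [pzAlgType]
    since V will be a quotient or a function space that is not known to be nonzero. *)
Record lend := Lend { lend_fun :> V -> V; lend_linear : linear lend_fun }.

HB.instance Definition _ := gen_eqMixin lend.
HB.instance Definition _ := gen_choiceMixin lend.
HB.instance Definition _ (f : lend) :=
  GRing.isLinear.Build R V V *:%R (lend_fun f) (lend_linear f).

Implicit Types f g h : lend.

Lemma lendP f g : (forall x, f x = g x) -> f = g.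
Proof.
case: f g => [f fl] [g gl] /= fg; have E : f = g by apply: funext.
by case: _ / E gl => gl; congr Lend; apply: Prop_irrelevance.
Qed.

Fact lend0_subproof : linear (fun _ : V => 0 : V).
Proof. by move=> c x y; rewrite scaler0 addr0. Qed.
Fact lendN_subproof f : linear (fun x => - f x).
Proof. by move=> c x y; rewrite linearP opprD scalerN. Qed.
Fact lendD_subproof f g : linear (fun x => f x + g x).
Proof. by move=> c x y; rewrite !linearP scalerDr addrACA. Qed.
Fact lend1_subproof : linear (fun x : V => x). Proof. by []. Qed.
Fact lendM_subproof f g : linear (fun x => f (g x)).
Proof. by move=> c x y; rewrite !linearP. Qed.
Fact lendZ_subproof c f : linear (fun x => c *: f x).
Proof. by move=> d x y; rewrite linearP scalerDr !scalerA mulrC. Qed.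

Definition lend0 := Lend lend0_subproof.
Definition lendN f := Lend (lendN_subproof f).
Definition lendD f g := Lend (lendD_subproof f g).
Definition lend1 := Lend lend1_subproof.
Definition lendM f g := Lend (lendM_subproof f g).
Definition lendZ c f := Lend (lendZ_subproof c f).

Fact lendDA : associative lendD.
Proof. by move=> f g h; apply: lendP => x /=; rewrite addrA. Qed.
Fact lendDC : commutative lendD.
Proof. by move=> f g; apply: lendP => x /=; rewrite addrC. Qed.
Fact lend0D : left_id lend0 lendD.
Proof. by move=> f; apply: lendP => x /=; rewrite add0r. Qed.
Fact lendND : left_inverse lend0 lendN lendD.
Proof. by move=> f; apply: lendP => x /=; rewrite addNr. Qed.
HB.instance Definition _ := GRing.isZmodule.Build lend lendDA lendDC lend0D
  lendND.

Fact lendMA : associative lendM. Proof. by move=> f g h; apply: lendP. Qed.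
Fact lend1M : left_id lend1 lendM. Proof. by move=> f; apply: lendP. Qed.
Fact lendM1 : right_id lend1 lendM. Proof. by move=> f; apply: lendP. Qed.
Fact lendMDl : left_distributive lendM +%R.
Proof. by move=> f g h; apply: lendP. Qed.
Fact lendMDr : right_distributive lendM +%R.
Proof. by move=> f g h; apply: lendP => x /=; rewrite linearD. Qed.
HB.instance Definition _ :=
  GRing.Zmodule_isPzRing.Build lend lendMA lend1M lendM1 lendMDl lendMDr.

Fact lendZA c d f : lendZ c (lendZ d f) = lendZ (c * d) f.
Proof. by apply: lendP => x /=; rewrite scalerA. Qed.
Fact lend1Z : left_id 1 lendZ.
Proof. by move=> f; apply: lendP => x /=; rewrite scale1r. Qed.
Fact lendZDr : right_distributive lendZ +%R.
Proof. by move=> c f g; apply: lendP => x /=; rewrite scalerDr. Qed.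
Fact lendZDl f : {morph lendZ^~ f : c d / c + d}.
Proof. by move=> c d; apply: lendP => x /=; rewrite scalerDl. Qed.
HB.instance Definition _ :=
  GRing.Zmodule_isLmodule.Build R lend lendZA lend1Z lendZDr lendZDl.

Fact lendZAl c f g : c *: (f * g) = (c *: f) * g.
Proof. exact: lendP. Qed.
Fact lendZAr c f g : c *: (f * g) = f * (c *: g).
Proof. by apply: lendP => x /=; rewrite linearZ. Qed.
HB.instance Definition _ := PzRing_isPzAlgebra.Build R lend
  (@scalerA R _) (@scale1r R _) (@scalerDr R _) (@scalerDl R _) lendZAl lendZAr.

Lemma lend0E x : (0 : lend) x = 0. Proof. by []. Qed.
Lemma lend1E x : (1 : lend) x = x. Proof. by []. Qed.
Lemma lendDE f g x : (f + g) x = f x + g x. Proof. by []. Qed.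
Lemma lendNE f x : (- f) x = - f x. Proof. by []. Qed.
Lemma lendBE f g x : (f - g) x = f x - g x. Proof. by []. Qed.
Lemma lendME f g x : (f * g) x = f (g x). Proof. by []. Qed.
Lemma lendZE c f x : (c *: f) x = c *: f x. Proof. by []. Qed.
Lemma lend_add f x y : f (x + y) = f x + f y. Proof. exact: linearD. Qed.
Lemma lend_opp f x : f (- x) = - f x. Proof. exact: linearN. Qed.
Lemma lend_sub f x y : f (x - y) = f x - f y. Proof. exact: linearB. Qed.
Lemma lend_zero f : f 0 = 0. Proof. exact: linear0. Qed.
Lemma lend_scale f c x : f (c *: x) = c *: f x. Proof. exact: linearZ. Qed.
Lemma lend_eq0 f : (forall x, f x = 0) -> f = 0.
Proof. by move=> f0; apply: lendP. Qed.
Lemma lend_sumE (I : Type) (r : seq I) (P : pred I) (F : I -> lend) x :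
  (\sum_(i <- r | P i) F i) x = \sum_(i <- r | P i) F i x.
Proof. by elim/big_rec2: _ => // i y g _ <-. Qed.

End LinearEndomorphisms.

Section PresentedAlgebra.
Variables (R : comNzRingType) (G : choiceType).
Variable (rel : freeAlg R G -> freeAlg R G -> Prop).

(** Words grow from 1 by left multiplication by a letter. The one-sided form is the useful one: the
    spans and images considered later are visibly stable under left multiplication only. *)
Lemma presAlg_ind (P : presAlg rel -> Prop) :
    P 0 -> P 1 -> (forall c x y, P x -> P y -> P (c *: x + y)) ->
    (forall g x, P x -> P (pgen rel g * x)) -> forall x, P x.
Proof.
move=> P0 P1 PL PM x; have [v ->] := aq_surj x.
pose q : freeAlg R G -> presAlg rel := aq _.
have Q w : P (q << w : word G >>).
  elim: w => [|g w IHw]; first exact: P1.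
  have -> : << (g :: w : word G) >> = fgen R g * (<< w >> : freeAlg R G).
    by rewrite /fgen unlock [RHS]malgM_def fgmulUU mul1r.
  by rewrite /q aqM; apply: PM.
apply: (@malg_lin_ind R (word G) (fun u => P (q u))) => [|c w y IH].
  by rewrite /q linear0.
by rewrite /q linearP; apply: PL => //; apply: Q.
Qed.

End PresentedAlgebra.

(** * Superpermutations of tensor powers *)

Section SimpleReflectionTheory.
Variable n : nat.

Lemma lo_neq_hi (i : 'I_n.-1) : lo i != hi i.
Proof. by rewrite -val_eqE /= ltn_eqF. Qed.

Lemma simple_lo (i : 'I_n.-1) : simple i (lo i) = hi i.
Proof. exact: tpermL. Qed.
Lemma simple_hi (i : 'I_n.-1) : simple i (hi i) = lo i.
Proof. exact: tpermR. Qed.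
Lemma simple_other (i : 'I_n.-1) l : l != lo i -> l != hi i -> simple i l = l.
Proof. by move=> h1 h2; rewrite /simple tpermD // eq_sym. Qed.
Lemma simpleK (i : 'I_n.-1) : involutive (simple i).
Proof. exact: tpermK. Qed.

End SimpleReflectionTheory.

Section TensorPowerTheory.
Variables (R : comNzRingType) (A : superAlgType R) (n : nat).
Implicit Types (a b : {ffun 'I_n -> A}) (e d : {ffun 'I_n -> bool}).
Local Notation T := (tpow A n).

HB.instance Definition _ w :=
  GRing.isLinear.Build R T T *:%R (@superperm R A n w)
    (@superperm_linear R A n w).

Fact at_pos_linear (i : 'I_n) : linear (@at_pos R A n i).
Proof.
move=> c x y; have E u : at_pos i u = tensor (upd [ffun=> 1] i u).
  by congr tensor; apply/ffunP => j; rewrite !ffunE.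
by rewrite !E tensor_multilinear.
Qed.
HB.instance Definition _ i :=
  GRing.isLinear.Build R A T *:%R (@at_pos R A n i) (at_pos_linear i).

Lemma tensorM a b e d :
    (forall i, homog (e i) (a i)) -> (forall i, homog (d i) (b i)) ->
  tensor a * tensor b = koszul R e d *: tensor [ffun i => a i * b i].
Proof. exact: tmul_homog. Qed.

(** The sign identity behind the multiplicativity of [superperm]. On an inverted pair the sign of a
    product splits into the e-e part, the d-d part and two mixed parts; the mixed parts turn the
    Koszul sign taken over the pairs with j < i into the one over the pairs with w j < w i. *)
Lemma superperm_signD (w : 'S_n) e d :
  superperm_sign R w (addp e d) * koszul R e d =
  superperm_sign R w e * superperm_sign R w d *
    koszul R [ffun i => e (w^-1%g i)] [ffun i => d (w^-1%g i)].
Proof.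
have cond (P : bool) (b : bool) :
  (if P then (-1) ^+ b else 1) = (-1) ^+ (P && b) :> R by case: P.
have -> : koszul R [ffun i => e (w^-1%g i)] [ffun i => d (w^-1%g i)] =
    \prod_i \prod_j (-1) ^+ ((w j < w i)%N && (e i && d j)).
  rewrite /koszul (reindex_inj (@perm_inj _ w)) /=; apply: eq_bigr => i _.
  rewrite big_mkcond (reindex_inj (@perm_inj _ w)) /=.
  by apply: eq_bigr => j _; rewrite !ffunE !permK cond.
rewrite /superperm_sign /koszul.
under [X in X * _]eq_bigr => i _ do
  (rewrite big_mkcond; under eq_bigr => j _ do rewrite cond).
under [X in _ * X = _]eq_bigr => i _ do
  (rewrite big_mkcond; under eq_bigr => j _ do rewrite cond).
under [X in _ = X * _ * _]eq_bigr => i _ do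
  (rewrite big_mkcond; under eq_bigr => j _ do rewrite cond).
under [X in _ = _ * X * _]eq_bigr => i _ do
  (rewrite big_mkcond; under eq_bigr => j _ do rewrite cond).
(* In the mixed part d_i e_j the two indices are exchanged, so that every mixed sign reads e_i d_j
   and the rest can be compared pair by pair. *)
have split4 : \prod_(i < n) \prod_(j < n)
    (-1) ^+ ((i < j)%N && (w j < w i)%N && (addp e d i && addp e d j)) =
    (\prod_(i < n) \prod_(j < n)
      (-1) ^+ ((i < j)%N && (w j < w i)%N && (e i && e j))) *
    (\prod_(i < n) \prod_(j < n)
      (-1) ^+ ((i < j)%N && (w j < w i)%N && (d i && d j))) *
    ((\prod_(i < n) \prod_(j < n)
      (-1) ^+ ((i < j)%N && (w j < w i)%N && (e i && d j))) *
    (\prod_(i < n) \prod_(j < n)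
      (-1) ^+ ((j < i)%N && (w i < w j)%N && (e i && d j)))) :> R.
  rewrite [X in _ = _ * (_ * X)]exchange_big /= -!big_split /=.
  apply: eq_bigr => i _; rewrite -!big_split /=; apply: eq_bigr => j _.
  rewrite -!signr_addb !ffunE; congr (_ ^+ _).
  case: ((i < j)%N && (w j < w i)%N) => //=.
  by case: (e i); case: (e j); case: (d i); case: (d j).
rewrite split4 -!mulrA; congr (_ * (_ * _)).
rewrite -!big_split /=; apply: eq_bigr => i _.
rewrite -!big_split /=; apply: eq_bigr => j _.
rewrite -!signr_addb; congr (_ ^+ _); case: (e i && d j);
  rewrite ?andbF ?andbT //.
have [ij|ji|/val_inj ->] := ltngtP i j; rewrite ?ltnn //.
  by rewrite !addbF.
have: w i != w j by rewrite (inj_eq perm_inj) neq_ltn ji orbT.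
by rewrite -val_eqE /=; case: (ltngtP (w i) (w j)).
Qed.

Lemma superpermM w : {morph superperm w : x y / x * y :> T}.
Proof.
move=> x y; move: x; apply: tensor_homog_ind => [|c u v IHu IHv|a e ha].
- by rewrite linear0 !mul0r linear0.
- by rewrite mulrDl -pzalg_scalerAl !linearP /= IHu IHv mulrDl -pzalg_scalerAl.
move: y; apply: tensor_homog_ind => [|c u v IHu IHv|b d hb].
- by rewrite linear0 !mulr0 linear0.
- by rewrite mulrDr -pzalg_scalerAr !linearP /= IHu IHv mulrDr -pzalg_scalerAr.
rewrite (tensorM ha hb) linearZ /= (superperm_homog _ ha)
  (superperm_homog _ hb).
rewrite (superperm_homog _ (e := addp e d)); last first.
  by move=> i; rewrite !ffunE; apply: homogM.
rewrite -pzalg_scalerAl -pzalg_scalerAr.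
rewrite (tensorM (e := [ffun i => e (w^-1%g i)])
  (d := [ffun i => d (w^-1%g i)]));
  try by move=> i; rewrite !ffunE.
rewrite !scalerA mulrC superperm_signD; congr (_ *: tensor _).
by apply/ffunP => i; rewrite !ffunE.
Qed.

Lemma superperm1 w : superperm w 1 = 1 :> T.
Proof.
rewrite [X in superperm _ X]/GRing.one /= /tone.
rewrite (superperm_homog _ (e := @evenp n)) => [|i]; last first.
  by rewrite !ffunE; apply: homog1.
rewrite /superperm_sign big1 ?scale1r => [|i _]; last first.
  by rewrite big1 // => j _; rewrite !ffunE.
by congr tensor; apply/ffunP => i; rewrite !ffunE.
Qed.

Definition deltap (i : 'I_n) (p : bool) : {ffun 'I_n -> bool} :=
  [ffun j => (j == i) && p].

Lemma homog_at_pos i p (x : A) : homog p x ->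
  forall j, homog (deltap i p j) ([ffun j => if j == i then x else 1] j).
Proof. by move=> hx j; rewrite !ffunE; case: eqP => // _; apply: homog1. Qed.

Lemma koszul_delta i p d :
  koszul R (deltap i p) d = \prod_(j < n | (j < i)%N) (-1) ^+ (p && d j).
Proof.
rewrite /koszul (bigD1 i) //= [X in _ * X]big1 ?mulr1 => [|i' ne].
  by apply: eq_bigr => j _; rewrite ffunE eqxx.
by rewrite big1 // => j _; rewrite ffunE (negPf ne).
Qed.

Lemma homog_lin_ind (P : A -> Prop) :
    (forall x y, P x -> P y -> P (x + y)) -> (forall p x, homog p x -> P x) ->
  forall x, P x.
Proof.
by move=> PD PH x; rewrite -(hprojD x); apply: PD; apply: PH;
  apply: homog_hproj.
Qed.

Lemma superperm_at_pos w i (x : A) :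
  superperm w (at_pos i x) = at_pos (w i) x :> T.
Proof.
elim/homog_lin_ind: x => [x y IHx IHy|p x hx];
  first by rewrite !linearD /= IHx IHy.
rewrite /at_pos (superperm_homog _ (homog_at_pos i hx)).
rewrite /superperm_sign big1 ?scale1r => [|k _]; last first.
  rewrite big1 // => j /andP[kj _]; rewrite !ffunE.
  have [kE|] := eqVneq k i; last by [].
  have -> : (j == i) = false by rewrite -kE -val_eqE gtn_eqF.
  by rewrite /= andbF.
congr tensor; apply/ffunP => j; rewrite !ffunE; congr (if _ then _ else _).
by apply/eqP/eqP => [<-|->]; rewrite ?permKV ?permK.
Qed.

Lemma at_posM i (x y : A) : at_pos i x * at_pos i y = at_pos i (x * y) :> T.
Proof.
elim/homog_lin_ind: x => [x x' IHx IHx'|p x hx].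
  by rewrite mulrDl !linearD /= mulrDl IHx IHx'.
elim/homog_lin_ind: y => [y y' IHy IHy'|q y hy].
  by rewrite mulrDr !linearD /= mulrDr IHy IHy'.
rewrite [LHS](tensorM (homog_at_pos i hx) (homog_at_pos i hy)) koszul_delta.
rewrite big1 ?scale1r => [|j ji].
  by congr tensor; apply/ffunP => j; rewrite !ffunE; case: eqP; rewrite ?mulr1.
by rewrite ffunE -val_eqE (ltn_eqF ji) andbF.
Qed.

Lemma at_pos1 i : at_pos i 1 = 1 :> T.
Proof. by congr tensor; apply/ffunP => j; rewrite !ffunE if_same. Qed.

Lemma at_posC i j p q (x y : A) : i != j -> homog p x -> homog q y ->
  at_pos i x * at_pos j y = (-1) ^+ (p && q) *: (at_pos j y * at_pos i x) :> T.
Proof.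
move=> ne hx hy.
rewrite (tensorM (homog_at_pos i hx) (homog_at_pos j hy)).
rewrite (tensorM (homog_at_pos j hy) (homog_at_pos i hx)) scalerA.
have kd i' j' p' q' : koszul R (deltap i' p') (deltap j' q') =
    (-1) ^+ [&& (j' < i')%N, p' & q'].
  rewrite koszul_delta; case: ltnP => [ji|ij].
    rewrite (bigD1 j') //= big1 ?mulr1 => [|k /andP[_ kj]]; last first.
      by rewrite ffunE (negPf kj) andbF.
    by rewrite ffunE eqxx.
  rewrite big1 // => k ki.
  by rewrite ffunE -val_eqE (ltn_eqF (leq_trans ki ij)) andbF.
rewrite !kd -signr_addb.
have -> : [&& (j < i)%N, p & q] = (p && q) (+) [&& (i < j)%N, q & p].
  by case: ltngtP ne => [||/val_inj ->]; rewrite ?eqxx //; case: p hx;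
    case: q hy.
congr (_ *: tensor _); apply/ffunP => k; rewrite !ffunE.
have [->|_] := eqVneq k i; last by rewrite mulr1 mul1r.
by rewrite (negPf ne) mulr1 mul1r.
Qed.

(** A pure tensor is built by prepending its factors from the last position to the first. No sign
    arises: the new factor is passed only by entries at smaller positions, and these are still 1. *)
Lemma at_pos_ind (P : T -> Prop) :
    P 0 -> P 1 -> (forall c x y, P x -> P y -> P (c *: x + y)) ->
    (forall i p u x, homog p u -> P x -> P (at_pos i u * x)) ->
  forall x, P x.
Proof.
move=> P0 P1 PL PM; apply: tensor_homog_ind => // a e ha.
have key m : (m <= n)%N ->
    P (tensor [ffun i : 'I_n => if (m <= i)%N then a i else 1]).
  move=> lemn; rewrite -(subKn lemn).
  elim: (n - m)%N (leq_subr m n) => [|k IH] lekn.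
    have -> : [ffun i : 'I_n => if (n - 0 <= i)%N then a i else 1] =
      [ffun=> 1] by apply/ffunP => i; rewrite !ffunE subn0 leqNgt ltn_ord.
    exact: P1.
  have lt : (n - k.+1 < n)%N by rewrite ltn_subrL (leq_trans _ lekn).
  pose i0 := Ordinal lt.
  have := PM i0 (e i0) (a i0) _ (ha i0) (IH (ltnW lekn)).
  pose e' := [ffun i : 'I_n => (n - k <= i)%N && e i].
  rewrite (tensorM (homog_at_pos i0 (ha i0)) (d := e')); last first.
    by move=> i; rewrite !ffunE; case: (_ <= _)%N; [apply: ha | apply: homog1].
  have E : (n - k)%N = (n - k.+1).+1 by rewrite -subSn // subSS.
  rewrite koszul_delta big1 ?scale1r => [|j ji]; last first.
    by rewrite ffunE E leqNgt ltnS (ltnW ji) andbF.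
  congr (P (tensor _)); apply/ffunP => i; rewrite !ffunE E.
  have [->|ne] := eqVneq i i0; first by rewrite ltnn leqnn mulr1.
  by rewrite mul1r [in RHS]leq_eqVlt eq_sym
    (negPf ne : (i == i0 :> nat) = false).
have := key 0 (leq0n n); congr (P (tensor _)).
by apply/ffunP => i; rewrite ffunE.
Qed.

Lemma superperm_mul (u w : 'S_n) (x : T) :
  superperm w (superperm u x) = superperm (u * w)%g x.
Proof.
elim/at_pos_ind: x => [||c x y IHx IHy|i p a x ha IHx].
- by rewrite !linear0.
- by rewrite !superperm1.
- by rewrite !linearP /= IHx IHy.
- by rewrite !superpermM !superperm_at_pos permM IHx.
Qed.

Lemma superperm_invol (w : 'S_n) : involutive w ->
  involutive (@superperm R A n w).
Proof.
move=> wK; apply: at_pos_ind => [||c x y IHx IHy|i p u x hu IHx].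
- by rewrite !linear0.
- by rewrite !superperm1.
- by rewrite !linearP /= IHx IHy.
- by rewrite !superpermM !superperm_at_pos wK IHx.
Qed.

End TensorPowerTheory.

(** * Teleporters *)

Section TraceForm.
Variables (R : comNzRingType) (A : superAlgType R).
Variables (tr : {scalar A}) (tr_symm : trace_form tr).
Variables (I : finType) (B Bd : I -> A).
Hypothesis B_homog : forall b, homogeneous (B b).
Hypothesis B_basis : is_basis B.
Hypothesis B_dual : forall a b, tr (Bd a * B b) = (a == b)%:R.

Lemma basis_expand x : x = \sum_b tr (Bd b * x) *: B b.
Proof.
have [c [Ex _]] := B_basis x; rewrite {1}Ex; apply: eq_bigr => b _.
congr (_ *: _); rewrite Ex mulr_sumr linear_sum (bigD1 b) //= big1 ?addr0.
  by rewrite -pzalg_scalerAr linearZ /= B_dual eqxx mulr1.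
by move=> j jb; rewrite -pzalg_scalerAr linearZ /= B_dual eq_sym (negPf jb)
  mulr0.
Qed.

Lemma trace_nondegenerate x : (forall b, tr (x * B b) = 0) -> x = 0.
Proof.
(* Both 1 and 1 + x represent the linear form [tr], so uniqueness of the representing element gives
   x = 0. *)
move=> x0; have [u [_ u_uniq]] := tr_bij tr_symm tr.
have x0' v : tr (x * v) = 0.
  rewrite [v]basis_expand mulr_sumr linear_sum big1 // => b _.
  by rewrite -pzalg_scalerAr linearZ /= x0 mulr0.
have u1 : u = 1 by apply: u_uniq => v; rewrite mul1r.
have : u = 1 + x by apply: u_uniq => v; rewrite mulrDl mul1r linearD x0' addr0.
by rewrite u1 -{1}[1]addr0 => /addrI.
Qed.

Lemma dual_basis_expand x : x = \sum_b tr (x * B b) *: Bd b.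
Proof.
apply/eqP; rewrite -subr_eq0; apply/eqP/trace_nondegenerate => b.
rewrite mulrBl linearB mulr_suml linear_sum (bigD1 b) //= big1 ?addr0.
  by rewrite -pzalg_scalerAl linearZ /= B_dual eqxx mulr1 subrr.
by move=> j jb; rewrite -pzalg_scalerAl linearZ /= B_dual (negPf jb) mulr0.
Qed.

(** By [tr_parity] it suffices that [Bd b] pairs to 0 with elements of the opposite parity. Expanded
    in the basis, such an element involves only basis elements of that parity; if [B b] were one of
    them, it would have both parities and be 0. *)
Lemma dual_homog p b : homog p (B b) -> homog p (Bd b).
Proof.
move=> hb; apply/(tr_parity tr_symm) => x hx.
have [c [Ex _]] := B_basis x.
rewrite -hx Ex linear_sum mulr_sumr linear_sum big1 // => j _.
rewrite linearZ /= -pzalg_scalerAr linearZ /=.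
have [q hq] := B_homog j; rewrite (hproj_homog _ hq).
have [E|] := eqVneq; last by rewrite mulr0 linear0 mulr0.
have [jb|jb] := eqVneq b j; last by rewrite B_dual (negPf jb) mulr0.
rewrite -jb in hq *; suff -> : B b = 0 by rewrite mulr0 linear0 mulr0.
by rewrite -hb (hproj_homog _ hq) -E; case: (p).
Qed.

Section Teleporter.
Variable n : nat.
Local Notation T := (tpow A n).
Local Notation t := (@teleporter R A n I B Bd).

(** Expanding x b in the basis on one side, and the product of a dual basis element with x in the
    dual basis on the other, gives the same double sum, with coefficients
    [tr (Bd c * (x * B b))]. *)
Lemma teleporter_left (i j : 'I_n) x : at_pos i x * t i j = t i j * at_pos j x.
Proof.
rewrite mulr_sumr mulr_suml.
transitivity (\sum_b \sum_c tr (Bd c * (x * B b)) *: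
  (at_pos i (B c) * at_pos j (Bd b)) : T).
  apply: eq_bigr => b _; rewrite mulrA at_posM {1}[x * B b]basis_expand.
  rewrite linear_sum mulr_suml; apply: eq_bigr => c _.
  by rewrite linearZ /= pzalg_scalerAl.
rewrite exchange_big; apply: eq_bigr => c _ /=.
rewrite -mulrA at_posM [Bd c * x]dual_basis_expand linear_sum mulr_sumr.
by apply: eq_bigr => b _; rewrite linearZ /= pzalg_scalerAr mulrA.
Qed.

(** Exchanging the two factors of a term costs the sign of the parity of b. The same sign comes from
    the supersymmetry of the trace, whose relevant values vanish unless b and c have equal
    parities. *)
Lemma teleporter_sym (i j : 'I_n) : i != j -> t j i = t i j.
Proof.
move=> ne; pose p b := `[< homog true (B b) >].
have hB b : homog (p b) (B b).
  by rewrite /p; case: asboolP => // nt; have [[] // /nt] := B_homog b.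
have hBd b := dual_homog (hB b).
transitivity (\sum_b \sum_c ((-1) ^+ p b * tr (Bd c * Bd b)) *:
    (at_pos i (B c) * at_pos j (B b)) : T).
  apply: eq_bigr => b _.
  rewrite (at_posC _ (hB b) (hBd b)) 1?eq_sym // andbb.
  rewrite {1}[Bd b]basis_expand linear_sum mulr_suml scaler_sumr.
  by apply: eq_bigr => c _; rewrite linearZ /= -pzalg_scalerAl scalerA.
rewrite exchange_big; apply: eq_bigr => c _ /=.
rewrite [in RHS](basis_expand (Bd c)) linear_sum mulr_sumr;
  apply: eq_bigr => b _.
rewrite linearZ /= -pzalg_scalerAr; congr (_ *: _).
rewrite (tr_sym tr_symm (hBd c) (hBd b)).
have [pb|] := eqVneq (p b) (p c).
  by rewrite -pb andbb mulrA -signr_addb addbb mul1r.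
move=> pbc; rewrite [tr _](tr_even tr_symm) ?mulr0 //.
have := homogM (hBd b) (hBd c); congr homog.
by case: (p b) (p c) pbc => [] [].
Qed.

Lemma teleporter_right (i j : 'I_n) x : i != j ->
  at_pos j x * t i j = t i j * at_pos i x.
Proof. by move=> ne; rewrite -teleporter_sym // teleporter_left. Qed.

Lemma teleporter_far (i j l : 'I_n) x : l != i -> l != j ->
  at_pos l x * t i j = t i j * at_pos l x.
Proof.
move=> li lj; elim/homog_lin_ind: x => [x y IHx IHy|p x hx].
  by rewrite linearD /= mulrDl mulrDr IHx IHy.
rewrite mulr_sumr mulr_suml; apply: eq_bigr => b _.
have [q hq] := B_homog b; have hq' := dual_homog hq.
rewrite mulrA (at_posC li hx hq) -pzalg_scalerAl -[in LHS]mulrA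
  (at_posC lj hx hq').
by rewrite -pzalg_scalerAr scalerA -signr_addb addbb scale1r mulrA.
Qed.

Lemma superperm_teleporter w (i j : 'I_n) :
  superperm w (t i j) = t (w i) (w j).
Proof.
rewrite linear_sum /=; apply: eq_bigr => b _.
by rewrite superpermM !superperm_at_pos.
Qed.

Definition simple_tp (i : 'I_n.-1) : T := t (lo i) (hi i).

Lemma superperm_simpleK (i : 'I_n.-1) : involutive
  (@superperm R A n (simple i)).
Proof. exact: superperm_invol (simpleK i). Qed.

(** This makes the quadratic relation compatible with sliding: T_i^2 commutes with tensors, so z t
    T_i has to commute with them as well. *)
Lemma simple_tp_slide i (x : T) :
  superperm (simple i) x * simple_tp i = simple_tp i * x.
Proof.
elim/at_pos_ind: x => [||c x y IHx IHy|l p u x hu IHx].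
- by rewrite linear0 mul0r mulr0.
- by rewrite superperm1 mul1r mulr1.
- by rewrite linearP /= mulrDl mulrDr -pzalg_scalerAl -pzalg_scalerAr IHx IHy.
rewrite superpermM superperm_at_pos -mulrA IHx !mulrA; congr (_ * _).
rewrite /simple_tp; have [->|hl] := eqVneq l (lo i).
  by rewrite simple_lo teleporter_right ?lo_neq_hi.
have [->|hh] := eqVneq l (hi i); first by rewrite simple_hi teleporter_left.
by rewrite simple_other // teleporter_far.
Qed.

Lemma simple_tp_fixed i : superperm (simple i) (simple_tp i) = simple_tp i.
Proof.
by rewrite superperm_teleporter simple_lo simple_hi teleporter_sym ?lo_neq_hi.
Qed.

Lemma simple_tp_far (i j : 'I_n.-1) : (i.+1 < j)%N || (j.+1 < i)%N ->
  superperm (simple i) (simple_tp j) = simple_tp j.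
Proof.
by move=> ij; rewrite superperm_teleporter !simple_other // -val_eqE /=; lia.
Qed.

(** Both sides are the teleporter between the positions i and i + 2. *)
Lemma simple_tp_braid (i j : 'I_n.-1) : j = i.+1 :> nat ->
  superperm (simple i) (simple_tp j) = superperm (simple j) (simple_tp i).
Proof.
move=> ij; rewrite !superperm_teleporter.
have E : lo j = hi i by apply: val_inj; rewrite /= ij.
rewrite {1}E simple_hi -{1}E simple_lo (@simple_other n j (lo i)).
- by rewrite simple_other // -val_eqE /= ij ?gtn_eqF.
- by rewrite -val_eqE /= ij ltn_eqF.
- by rewrite -val_eqE /= ij ltn_eqF // ltnS leqnSn.
Qed.

Definition pure_basis (b : {ffun 'I_n -> I}) : T := tensor [ffun i => B (b i)].

(** The coordinate forms of [pure_basis], once extended by multilinearity; [R^o] is R seen as a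
    module over itself. *)
Definition pure_coord (b : {ffun 'I_n -> I}) (a : {ffun 'I_n -> A}) : R^o :=
  \prod_i tr (Bd (b i) * a i).

Lemma pure_coord_multilinear b : multilinear (pure_coord b).
Proof.
move=> a i c x y; rewrite /pure_coord !(bigD1 i (P := xpredT)) //=.
have E u : \prod_(j < n | j != i) tr (Bd (b j) * upd a i u j) =
    \prod_(j < n | j != i) tr (Bd (b j) * a j).
  by apply: eq_bigr => j ji; rewrite ffunE (negPf ji).
rewrite !E !ffunE eqxx mulrDr linearD /= -pzalg_scalerAr linearZ /= mulrDl.
by rewrite -[c *: _]/(c * _) mulrA.
Qed.

Lemma pure_basis_coord b b' :
  tlift (pure_coord b) (pure_basis b') = (b == b')%:R.
Proof.
rewrite tlift_tensor; last exact: pure_coord_multilinear.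
have [->|/eqP ne] := eqVneq b b'.
  by rewrite /pure_coord big1 // => i _; rewrite ffunE B_dual eqxx.
have [i nei] : exists i, b i != b' i.
  apply/existsP; apply: contra_notT ne => /existsPn E; apply/ffunP => i.
  by apply/eqP; have := E i; rewrite negbK.
by rewrite /pure_coord (bigD1 i) //= ffunE B_dual (negPf nei) mul0r.
Qed.

Lemma pure_basis_span x : exists c : {ffun {ffun 'I_n -> I} -> R},
  x = \sum_b c b *: pure_basis b.
Proof.
pose P x := exists c : {ffun {ffun 'I_n -> I} -> R}, x =
  \sum_b c b *: pure_basis b.
have P0 : P 0.
  by exists [ffun=> 0]; rewrite big1 // => b _; rewrite ffunE scale0r.
have PL c u v : P u -> P v -> P (c *: u + v).
  move=> [cu ->] [cv ->]; exists [ffun b => c * cu b + cv b].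
  rewrite scaler_sumr -big_split; apply: eq_bigr => b _ /=.
  by rewrite ffunE scalerA scalerDl.
have PZ (J : finType) (F : J -> R) (G : J -> T) : (forall j, P (G j)) ->
    P (\sum_j F j *: G j).
  by move=> PG; elim/big_rec: _ => // j y _; apply: PL.
apply: (tensor_lin_ind (P := P)) => // a.
(* The entries are expanded one position at a time: those at positions at least m are already basis
   elements. *)
suff H m : (m <= n)%N -> forall a : {ffun 'I_n -> A},
    (forall i : 'I_n, (m <= i)%N -> exists b, a i = B b) -> P (tensor a).
  by apply: (H n) => // i; rewrite leqNgt ltn_ord.
elim: m => [_ {}a ha|m IH ltmn {}a ha].
  have [b hb] : exists b : {ffun 'I_n -> I}, forall i, a i = B (b i).
    have [b hb] := choice (fun i => ha i isT).
    by exists [ffun i => b i] => i; rewrite ffunE.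
  exists [ffun b' => (b' == b)%:R]; rewrite (bigD1 b) //= big1 ?addr0.
    rewrite ffunE eqxx scale1r; congr tensor.
    by apply/ffunP => i; rewrite ffunE hb.
  by move=> b' /negPf nb; rewrite ffunE nb scale0r.
pose i0 := Ordinal ltmn.
have E : tensor a = \sum_b tr (Bd b * a i0) *: tensor (upd a i0 (B b)) :> T.
  have -> : a = upd a i0 (a i0).
    by apply/ffunP => j; rewrite ffunE; case: eqP => // ->.
  pose f u := tensor (upd a i0 u) : T.
  have fl : linear f by move=> c u v; apply: tensor_multilinear.
  pose F := GRing.isLinear.Build R A T *:%R f fl.
  pose g : {linear A -> T} := HB.pack f F.
  rewrite {1}[a i0]basis_expand -[LHS]/(g _) linear_sum.
  apply: eq_bigr => b _; rewrite linearZ /= /f; congr (_ *: tensor _).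
    by rewrite ffunE eqxx.
  by apply/ffunP => j; rewrite !ffunE; case: eqP.
rewrite E; apply: PZ => b; apply: IH; first exact: ltnW.
move=> i mi; rewrite ffunE; case: eqP => [_|/eqP ne]; first by exists b.
apply: ha; rewrite ltn_neqAle mi andbT; apply: contra ne => /eqP E'.
by rewrite -val_eqE /= E'.
Qed.

Lemma pure_basis_free (c : {ffun 'I_n -> I} -> R) :
  \sum_b c b *: pure_basis b = 0 -> forall b, c b = 0.
Proof.
move=> c0 b; have lin := tlift_is_linear (@pure_coord_multilinear b).
pose F := GRing.isLinear.Build R T R^o *:%R _ lin.
pose g : {linear T -> R^o} := HB.pack (tlift (pure_coord b)) F.
have : g (\sum_b c b *: pure_basis b) = 0 by rewrite c0 linear0.
rewrite linear_sum (bigD1 b) // big1 ?addr0 => [|b' ne].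
  by rewrite linearZ /= pure_basis_coord eqxx addr0 => cb0; rewrite -[c b]mulr1;
    exact: cb0.
by rewrite linearZ /= pure_basis_coord eq_sym (negPf ne) scaler0.
Qed.

End Teleporter.
End TraceForm.

(** * Reduced words *)

Section Coxeter.
Variable n : nat.
Implicit Types (w u : 'S_n) (i j : 'I_n.-1) (s : seq 'I_n.-1).
Local Open Scope group_scope.

Lemma simple_val i (l : 'I_n) : simple i l =
  (if l == i :> nat then i.+1 else if l == i.+1 :> nat then i : nat else l) :>
    nat.
Proof.
have [->|nl] := eqVneq l (lo i); first by rewrite simple_lo /= eqxx.
have [->|nh] := eqVneq l (hi i).
  by rewrite simple_hi /= eqxx gtn_eqF.
rewrite simple_other //; move: nl nh; rewrite -!val_eqE /=.
by do 2![case: eqP => //].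
Qed.

(** A left descent. Products in 'S_n compose from left to right, so [w * simple i] is s_i o w, and a
    descent means that T_w = T_i T_(s_i w) with s_i w shorter. *)
Definition desc i w := (w^-1 (hi i) < w^-1 (lo i))%N.

Definition inversions w : {set 'I_n * 'I_n} :=
  [set pq : 'I_n * 'I_n | (pq.1 < pq.2)%N && (w^-1 pq.2 < w^-1 pq.1)%N].
Definition len w := #|inversions w|.

Lemma mul_simpleV w i l : (w * simple i)^-1 l = w^-1 (simple i l).
Proof. by rewrite invMg permM /simple tpermV. Qed.

Lemma mul_simpleK w i : w * simple i * simple i = w.
Proof. by rewrite -mulgA /simple tperm2 mulg1. Qed.

Lemma desc_mul i j w :
  desc j (w * simple i) = (w^-1 (simple i (hi j)) < w^-1 (simple i (lo j)))%N.
Proof. by rewrite /desc !mul_simpleV. Qed.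

Lemma desc_simple i w : desc i (w * simple i) = ~~ desc i w.
Proof.
rewrite desc_mul simple_lo simple_hi /desc -leqNgt [in RHS]leq_eqVlt.
suff -> : (w^-1 (lo i) == w^-1 (hi i) :> nat) = false by [].
by apply/eqP => /val_inj /perm_inj/eqP; rewrite (negPf (lo_neq_hi i)).
Qed.

(** Applying s_i to both entries maps the inversions of w bijectively onto those of s_i w other than
    the pair (i, i + 1): s_i reverses the order of no other pair. *)
Lemma len_up i w : ~~ desc i w -> len (w * simple i) = (len w).+1.
Proof.
move=> nd; pose f (pq : 'I_n * 'I_n) := (simple i pq.1, simple i pq.2).
have f_inj : injective f.
  by move=> [p q] [p' q'] [/perm_inj -> /perm_inj ->].
have lt : (w^-1 (lo i) < w^-1 (hi i))%N.
  move: nd; rewrite /desc -leqNgt leq_eqVlt => /orP[/eqP/val_inj/perm_inj|//].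
  by move/eqP; rewrite (negPf (lo_neq_hi i)).
rewrite /len -[in RHS](card_preimset _ f_inj).
have -> : inversions (w * simple i) = (lo i, hi i) |: f @^-1: inversions w.
  apply/setP => -[p q]; rewrite !inE /f /= !mul_simpleV xpair_eqE.
  have [->|np] := eqVneq p (lo i); have [->|nq] := eqVneq q (hi i).
  - by rewrite simple_lo simple_hi /= ltnSn lt.
  - rewrite simple_lo /=.
    have [->|nq'] := eqVneq q (lo i); first by rewrite simple_lo !ltnn.
    rewrite (simple_other nq' nq); congr (_ && _).
    by move: nq nq'; rewrite -!val_eqE /=; lia.
  - rewrite simple_hi /=.
    have [->|np'] := eqVneq p (hi i); first by rewrite simple_hi !ltnn.
    rewrite (simple_other np np'); congr (_ && _).
    by move: np np'; rewrite -!val_eqE /=; lia.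
  have [Ep|np'] := eqVneq p (hi i); have [Eq|nq'] := eqVneq q (lo i).
  - rewrite Ep Eq simple_lo simple_hi /= [(i.+1 < i)%N]ltnNge leqnSn /=.
    by move: nd; rewrite /desc => /negPf ->; rewrite andbF.
  - rewrite Ep simple_hi (simple_other nq' nq) /=; congr (_ && _).
    by move: nq nq'; rewrite -!val_eqE /=; lia.
  - rewrite Eq simple_lo (simple_other np np') /=; congr (_ && _).
    by move: np np'; rewrite -!val_eqE /=; lia.
  by rewrite (simple_other np np') (simple_other nq' nq).
by rewrite cardsU1 !inE /f /= simple_lo simple_hi /= ltnNge leqnSn.
Qed.

Lemma len_down i w : desc i w -> len w = (len (w * simple i)).+1.
Proof. by move=> d; rewrite -(@len_up i) ?mul_simpleK // desc_simple d. Qed.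

(** Without descents the inverse v of w is increasing, whence v p >= p for all p. As the values of v
    are a permutation of the positions, the sums of both sides agree and equality holds
    everywhere. *)
Lemma no_desc w : (forall i, ~~ desc i w) -> w = 1.
Proof.
move=> nd; pose v := w^-1.
have ge m : forall p : 'I_n, p = m :> nat -> (m <= v p)%N.
  elim: m => // m IH p pm.
  have ltm : (m < n.-1)%N by have := ltn_ord p; lia.
  pose i := Ordinal ltm; have := nd i; rewrite /desc -leqNgt leq_eqVlt.
  have hp : hi i = p by apply: val_inj.
  case/orP => [/eqP/val_inj/perm_inj/eqP|];
    first by rewrite (negPf (lo_neq_hi i)).
  by rewrite hp; apply: leq_ltn_trans; apply: IH.
have E : (\sum_(p < n) p = \sum_(p < n) v p)%N.
  by rewrite [RHS](reindex_inj (@perm_inj _ w)); apply: eq_bigr => p _;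
    rewrite permK.
have := leqif_sum (fun (p : 'I_n) (_ : xpredT p) => leqif_geq (ge p p erefl)).
move=> [_]; rewrite E eqxx => /esym/forallP h.
apply: invg_inj; apply/permP => p; rewrite invg1 perm1; apply: val_inj.
by apply/eqP; rewrite eqn_leq (implyP (h p)) //= ge.
Qed.

Definition word_perm s : 'S_n := \prod_(i <- rev s) simple i.

Lemma word_perm_cons i s : word_perm (i :: s) = word_perm s * simple i.
Proof. by rewrite /word_perm rev_cons -cats1 big_cat big_seq1. Qed.

Lemma len1 : len 1 = 0%N.
Proof.
apply/eqP; rewrite cards_eq0; apply/eqP/setP => -[p q].
by rewrite !inE invg1 !perm1 /= ltnNge andbC -ltnNge; case: ltngtP.
Qed.

Lemma len_mul_simple w i : (len (w * simple i) <= (len w).+1)%N.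
Proof.
have [d|d] := boolP (desc i w); last by rewrite len_up.
by rewrite (len_down d); lia.
Qed.

Lemma len_word s : (len (word_perm s) <= size s)%N.
Proof.
elim: s => [|i s IH]; first by rewrite /word_perm big_nil len1.
by rewrite word_perm_cons (leq_trans (len_mul_simple _ _)).
Qed.

(** Reducedness measured by inversions rather than by minimality among words, which lets it pass to
    tails and to extensions along a descent. [reduced_len_expression] provides the link with
    [reduced_expression]. *)
Definition len_expression w s := w = word_perm s /\ size s = len w.

Lemma len_expression_cons i w s :
  desc i w -> len_expression (w * simple i) s -> len_expression w (i :: s).
Proof.
move=> d [E S]; split; first by rewrite word_perm_cons -E mul_simpleK.
by rewrite /= S -len_down.
Qed.

Lemma len_expression_behead i w s : len_expression w (i :: s) ->
  desc i w /\ len_expression (w * simple i) s.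
Proof.
move=> [E /= S]; have Es : w * simple i = word_perm s.
  by rewrite E word_perm_cons mul_simpleK.
have le := len_word s; rewrite -Es in le.
have d : desc i w.
  by rewrite -[desc i w]negbK; apply/negP => nd; have := len_up nd; lia.
by split=> //; split=> //; have := len_down d; lia.
Qed.

Lemma exists_len_expression w : exists s, len_expression w s.
Proof.
have [m] := ubnP (len w); elim: m w => // m IH w lt.
have [/existsP[i d]|/existsPn nd] := boolP [exists i, desc i w].
  have [|s rs] := IH (w * simple i); first by have := len_down d; lia.
  by exists (i :: s); apply: len_expression_cons.
rewrite (no_desc nd); exists [::]; split; last by rewrite len1.
by rewrite /word_perm big_nil.
Qed.

Lemma reduced_len_expression w s : reduced_expression w s -> len_expression w s.
Proof.
move=> [E min]; split=> //; have [s' [E' S']] := exists_len_expression w.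
have := min _ E'; have := len_word s; rewrite -[word_perm s]E; lia.
Qed.

Lemma simple_comm i j : (i.+1 < j)%N || (j.+1 < i)%N ->
  simple i * simple j = simple j * simple i.
Proof.
move=> ij; apply/permP => l; apply: val_inj; rewrite /= !permM !simple_val.
by repeat case: eqP => //=; lia.
Qed.

Lemma simple_braid i j : j = i.+1 :> nat ->
  simple i * simple j * simple i = simple j * simple i * simple j.
Proof.
move=> ij; apply/permP => l; apply: val_inj; rewrite /= !permM !simple_val ij.
by repeat case: eqP => //=; lia.
Qed.

Lemma desc_far i j w : (i.+1 < j)%N || (j.+1 < i)%N ->
  desc j (w * simple i) = desc j w.
Proof.
by move=> ij; rewrite desc_mul !simple_other // -val_eqE /=; lia.
Qed.

Lemma hi_lo i j : j = i.+1 :> nat -> lo j = hi i.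
Proof. by move=> ij; apply: val_inj; rewrite /= ij. Qed.

Lemma simple_lo_next i j : j = i.+1 :> nat -> simple j (lo i) = lo i.
Proof. by move=> ij; rewrite simple_other // -val_eqE /=; lia. Qed.

Lemma simple_hi_next i j : j = i.+1 :> nat -> simple i (hi j) = hi j.
Proof. by move=> ij; rewrite simple_other // -val_eqE /=; lia. Qed.

Lemma desc_next i j w : j = i.+1 :> nat ->
  desc j (w * simple i) = (w^-1 (hi j) < w^-1 (lo i))%N.
Proof.
by move=> ij; rewrite desc_mul simple_hi_next // (hi_lo ij) simple_hi.
Qed.

Lemma desc_prev i j w : j = i.+1 :> nat ->
  desc i (w * simple j) = (w^-1 (hi j) < w^-1 (lo i))%N.
Proof.
by move=> ij; rewrite desc_mul simple_lo_next // -(hi_lo ij) simple_lo.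
Qed.

Lemma desc_prev_next i j w : j = i.+1 :> nat ->
  desc i (w * simple i * simple j) = desc j w.
Proof.
move=> ij; rewrite desc_mul !mul_simpleV simple_lo_next // simple_lo
  -(hi_lo ij).
by rewrite simple_lo simple_hi_next.
Qed.

Lemma desc_next_prev i j w : j = i.+1 :> nat ->
  desc j (w * simple j * simple i) = desc i w.
Proof.
move=> ij; rewrite desc_mul !mul_simpleV simple_hi_next // simple_hi (hi_lo ij).
by rewrite simple_hi simple_lo_next.
Qed.

Lemma desc_ends i j w : j = i.+1 :> nat -> desc i w -> desc j w ->
  (w^-1 (hi j) < w^-1 (lo i))%N.
Proof.
by move=> ij di; rewrite /desc (hi_lo ij) => dj; apply: ltn_trans dj di.
Qed.

Lemma ndesc_ends i j w : j = i.+1 :> nat -> ~~ desc i w -> ~~ desc j w ->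
  (w^-1 (hi j) < w^-1 (lo i))%N = false.
Proof.
move=> ij; rewrite /desc (hi_lo ij) -!leqNgt => di dj.
by rewrite ltnNge (leq_trans di dj).
Qed.

Section Words.
Variables (E : pzRingType) (T : 'I_n.-1 -> E).
Hypothesis T_comm :
  forall i j, (i.+1 < j)%N || (j.+1 < i)%N -> (T i * T j = T j * T i)%R.
Hypothesis T_braid :
  forall i j, j = i.+1 :> nat -> (T i * T j * T i = T j * T i * T j)%R.

(* Two reduced words of w starting with i and j can both be compared with words
   that continue with a common reduced word of the shortest element of the
   coset of w by the subgroup generated by s_i and s_j. *)
Lemma reduced_words_eq w s s' : len_expression w s -> len_expression w s' ->
  (\prod_(i <- s) T i = \prod_(i <- s') T i)%R.
Proof.
have [m] := ubnP (len w); elim: m w s s' => // m IH w [|i s] [|j s'] lt.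
- by [].
- by move=> [_ /= S] [_ /= S']; lia.
- by move=> [_ /= S] [_ /= S']; lia.
move=> /len_expression_behead[di rs] /len_expression_behead[dj rs'].
have li := len_down di; have lj := len_down dj.
rewrite !big_cons; have [ij|ne] := eqVneq i j.
  by subst j; rewrite (IH _ _ _ _ rs rs') //; lia.
have [far|near] := boolP ((i.+1 < j)%N || (j.+1 < i)%N).
  have dji : desc j (w * simple i) by rewrite desc_far.
  have dij : desc i (w * simple j) by rewrite desc_far // orbC.
  have [s3 r3] := exists_len_expression (w * simple i * simple j).
  have ri := len_expression_cons dji r3.
  have rj : len_expression (w * simple j) (i :: s3).
    by apply: (len_expression_cons dij); rewrite -mulgA -simple_comm // mulgA.
  rewrite (IH _ _ _ _ rs ri) ?(IH _ _ _ _ rs' rj); try lia.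
  by rewrite !big_cons !mulrA T_comm.
wlog ij : i j s s' rs rs' di dj li lj ne near / j = i.+1 :> nat.
  move=> W; have [ij|ji] : j = i.+1 :> nat \/ i = j.+1 :> nat.
  - by move: ne near; rewrite -val_eqE /=; lia.
  - exact: W ij.
  by symmetry; apply: (W j i) => //; rewrite 1?eq_sym // orbC.
have dji : desc j (w * simple i) by rewrite desc_next // desc_ends.
have dij : desc i (w * simple j) by rewrite desc_prev // desc_ends.
have diji : desc i (w * simple i * simple j) by rewrite desc_prev_next.
have djij : desc j (w * simple j * simple i) by rewrite desc_next_prev.
have [s3 r3] := exists_len_expression (w * simple i * simple j * simple i).
have ri : len_expression (w * simple i) [:: j, i & s3].
  by apply: (len_expression_cons dji); apply: (len_expression_cons diji).
have rj : len_expression (w * simple j) [:: i, j & s3].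
  apply: (len_expression_cons dij); apply: (len_expression_cons djij).
  by move: r3; rewrite -!mulgA !(mulgA (simple _)) simple_braid.
rewrite (IH _ _ _ _ rs ri) ?(IH _ _ _ _ rs' rj); try lia.
by rewrite !big_cons !mulrA T_braid.
Qed.
End Words.

End Coxeter.

(** * The regular wreath module *)

Section RelationDefects.
Variable E : pzRingType.
Implicit Types T q X : E.

(** Here q stands for z times a teleporter. The two equations make T - q a two-sided inverse of T;
    the calculations below treat T - q as a single letter u. *)
Definition quad T q := T * T = q * T + 1 /\ T * q = q * T.

Lemma quadVl T q : quad T q -> (T - q) * T = 1.
Proof. by case=> TT _; rewrite mulrBl TT addrAC subrr add0r. Qed.

Lemma quadVr T q : quad T q -> T * (T - q) = 1.
Proof. by case=> TT Tq; rewrite mulrBr TT Tq addrAC subrr add0r. Qed.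

Definition quad_defect T q := T * T - (q * T + 1).

(** T is not known to be invertible here: only the two rules for moving T past the variables are
    given. The terms in which q meets a variable cancel, and what remains is the defect on the other
    side of the variable. *)
Lemma quad_defect_X T q Xa Xb : T * q = q * T ->
  T * Xa = Xb * (T - q) -> T * Xb = Xa * T + q * Xb ->
  quad_defect T q * Xa = Xa * quad_defect T q.
Proof.
move=> Tq TXa TXb.
have Tu : T * (T - q) = T * T - q * T by rewrite mulrBr Tq.
rewrite /quad_defect [RHS]mulrBr mulrDr mulr1.
rewrite [LHS]mulrBl mulrDl mul1r -!mulrA TXa.
move: (T - q) Tu => u Tu; rewrite !mulrA TXb mulrDl opprD addrA addrK.
by rewrite -!mulrA Tu [Xa * (T * T - _)]mulrBr opprD addrA.
Qed.

Lemma quad_defect_Y T q Xa Xb : T * q = q * T ->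
  T * Xa = Xb * (T - q) -> T * Xb = Xa * T + q * Xb ->
  quad_defect T q * Xb = Xb * quad_defect T q.
Proof.
move=> Tq TXa TXb.
have uT : (T - q) * T = T * T - q * T by rewrite mulrBl.
rewrite /quad_defect [RHS]mulrBr mulrDr mulr1.
rewrite [LHS]mulrBl mulrDl mul1r -!mulrA {1}TXb mulrDr !mulrA TXa Tq.
move: (T - q) uT => u uT; rewrite -!mulrA opprD addrA addrK uT.
by rewrite [Xb * (T * T - _)]mulrBr opprD addrA.
Qed.

Definition braid_defect T1 T2 := T1 * T2 * T1 - T2 * T1 * T2.
Definition comm_defect T1 T2 := T1 * T2 - T2 * T1.

Lemma braid_defectN T1 T2 : braid_defect T2 T1 = - braid_defect T1 T2.
Proof. by rewrite /braid_defect opprB. Qed.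

Lemma comm_defectN T1 T2 : comm_defect T2 T1 = - comm_defect T1 T2.
Proof. by rewrite /comm_defect opprB. Qed.

Lemma comm_defectE T1 T2 q1 : T2 * q1 = q1 * T2 ->
  comm_defect T1 T2 = (T1 - q1) * T2 - T2 * (T1 - q1).
Proof.
by move=> T2q1; rewrite mulrBl mulrBr T2q1 opprB addrA addrNK.
Qed.

(** Since q1 commutes with T2, the commutator is unchanged when T1 is replaced by its inverse u.
    Then [u, T2] T1 = u T2 T1 - T2 = - u [T1, T2]. *)
Lemma comm_defect_mul T1 T2 q1 : quad T1 q1 -> T2 * q1 = q1 * T2 ->
  comm_defect T1 T2 * T1 = - ((T1 - q1) * comm_defect T1 T2).
Proof.
move=> Q1 T2q1; rewrite {1}(comm_defectE T1 T2q1) /comm_defect.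
have uT := quadVl Q1; move: (T1 - q1) uT => u uT.
by rewrite mulrBl mulrBr opprB -(mulrA T2) [u * (T1 * T2)]mulrA uT mul1r mulr1
  mulrA.
Qed.

Lemma comm_defect_X T1 T2 q1 Xa Xb : quad T1 q1 -> T2 * q1 = q1 * T2 ->
  T1 * Xa = Xb * (T1 - q1) -> T2 * Xa = Xa * T2 -> T2 * Xb = Xb * T2 ->
  comm_defect T1 T2 * Xa = Xb * comm_defect T1 T2.
Proof.
move=> Q1 T2q1 T1X T2Xa T2Xb; rewrite [in RHS](comm_defectE T1 T2q1)
  /comm_defect.
move: (T1 - q1) T1X => u T1X; rewrite mulrBl mulrBr -!mulrA T2Xa T1X.
by rewrite (mulrA T1) T1X (mulrA T2 Xb) T2Xb -!mulrA.
Qed.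

Lemma comm_defect_Y T1 T2 q1 Xa Xb : quad T1 q1 -> T2 * q1 = q1 * T2 ->
  T1 * Xa = Xb * (T1 - q1) -> T2 * Xa = Xa * T2 -> T2 * Xb = Xb * T2 ->
  comm_defect T1 T2 * Xb = Xa * comm_defect T1 T2.
Proof.
move=> Q1 T2q1 T1X T2Xa T2Xb.
have CT := comm_defect_mul Q1 T2q1.
have CX := comm_defect_X Q1 T2q1 T1X T2Xa T2Xb.
have uT := quadVl Q1; move: (T1 - q1) uT T1X CT => u uT T1X CT.
have Xb_E : Xb = T1 * Xa * T1 by rewrite T1X -mulrA uT mulr1.
have Xa_E : Xa = u * Xb * u by rewrite -mulrA -T1X mulrA uT mul1r.
set C := comm_defect _ _ in CT CX *.
rewrite {1}Xb_E !mulrA CT !mulNr -(mulrA u) CX.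
by rewrite -!mulrA CT !mulrN opprK Xa_E !mulrA.
Qed.

(** The last factor of the first product and the first factor of the second may be replaced by their
    inverses: the two correction terms in q are equal. From this form [braid_defect_mul] follows by
    multiplying out. *)
Lemma braid_defectE T1 T2 q1 q2 : T1 * T2 * q1 = q2 * T1 * T2 ->
  braid_defect T1 T2 = T1 * T2 * (T1 - q1) - (T2 - q2) * T1 * T2.
Proof.
by move=> s12; rewrite mulrBr s12 -(mulrA (_ - _)) mulrBl !mulrA opprB addrA
  addrNK.
Qed.

Lemma braid_defect_mul T1 T2 q1 q2 : quad T1 q1 -> quad T2 q2 ->
  T1 * T2 * q1 = q2 * T1 * T2 ->
  braid_defect T1 T2 * T1 = - ((T2 - q2) * braid_defect T1 T2).
Proof.
move=> Q1 Q2 s12; rewrite {1}(braid_defectE s12) /braid_defect.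
have uT1 := quadVl Q1; have uT2 := quadVl Q2.
move: (T1 - q1) (T2 - q2) uT1 uT2 => u1 u2 uT1 uT2.
rewrite mulrBl mulrBr opprB -(mulrA (T1 * T2)) uT1 mulr1.
by rewrite -!(mulrA T2) [u2 * (T2 * _)]mulrA uT2 mul1r !mulrA.
Qed.

Section Braid.
Variables (T1 T2 q1 q2 q13 X1 X2 X3 : E).
Hypotheses (Q1 : quad T1 q1) (Q2 : quad T2 q2).
Hypotheses (s1q2 : T1 * q2 = q13 * T1) (s1q13 : T1 * q13 = q2 * T1).
Hypotheses (s2q1 : T2 * q1 = q13 * T2) (s2q13 : T2 * q13 = q1 * T2).
Hypotheses (TX1 : T1 * X1 = X2 * (T1 - q1)) (TX2 : T2 * X2 = X3 * (T2 - q2)).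
Hypotheses (TX3 : T1 * X3 = X3 * T1) (T2X1 : T2 * X1 = X1 * T2).
Local Notation D := (braid_defect T1 T2).

Lemma braid_slide12 : T1 * T2 * q1 = q2 * T1 * T2.
Proof. by rewrite -mulrA s2q1 mulrA s1q13. Qed.

Lemma braid_slide21 : T2 * T1 * q2 = q1 * T2 * T1.
Proof. by rewrite -mulrA s1q2 mulrA s2q13. Qed.

Lemma braid_defect_T1 : D * T1 = - ((T2 - q2) * D).
Proof. exact: braid_defect_mul Q1 Q2 braid_slide12. Qed.

Lemma braid_defect_T2 : D * T2 = - ((T1 - q1) * D).
Proof.
have := braid_defect_mul Q2 Q1 braid_slide21.
by rewrite braid_defectN mulNr mulrN => /oppr_inj.
Qed.

(** Moving X1 to the left inverts two of the three letters in each product, leaving X3 (T1 u2 u1 -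
    u2 u1 T2), where u1 and u2 are the inverses. The bracket is again the defect: restoring one
    letter adds the same term [q13] to both products. *)
Lemma braid_defect_X1 : D * X1 = X3 * D.
Proof.
have T1q2 : T1 * q2 * (T1 - q1) = q13.
  by rewrite s1q2 -mulrA (quadVr Q1) mulr1.
have T2q1 : (T2 - q2) * q1 * T2 = q13.
  by rewrite -mulrA -s2q13 mulrA (quadVl Q2) mul1r.
have E1 : T1 * T2 * (T1 - q1) = T1 * (T2 - q2) * (T1 - q1) + q13.
  by rewrite -T1q2 [T1 * (T2 - q2)]mulrBr [(_ - _) * (T1 - q1)]mulrBl subrK.
have E2 : (T2 - q2) * T1 * T2 = (T2 - q2) * (T1 - q1) * T2 + q13.
  by rewrite -T2q1 [(T2 - q2) * (T1 - q1)]mulrBr [(_ - _) * T2]mulrBl subrK.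
rewrite [in RHS](braid_defectE braid_slide12) E1 E2 /braid_defect.
rewrite opprD addrACA subrr addr0.
move: (T1 - q1) (T2 - q2) TX1 TX2 => u1 u2 HX1 HX2.
rewrite mulrBl mulrBr; congr (_ - _).
  rewrite -!mulrA HX1 (mulrA T2 X2) HX2 -mulrA.
  by rewrite (mulrA T1 X3) TX3 -!mulrA.
by rewrite -!mulrA T2X1 (mulrA T1 X1) HX1 -mulrA (mulrA T2 X2) HX2 -!mulrA.
Qed.

(** X2 is T1 X1 T1 and also u2 X3 u2 with u2 the inverse of T2. Passing T1 through the defect twice
    produces u2 twice, and the signs cancel. *)
Lemma braid_defect_X2 : D * X2 = X2 * D.
Proof.
have DT := braid_defect_T1; have DX := braid_defect_X1.
have uT1 := quadVl Q1; have uT2 := quadVl Q2; have Tu2 := quadVr Q2.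
have X2E : X2 = T1 * X1 * T1 by rewrite TX1 -mulrA uT1 mulr1.
have X2E' : X2 = (T2 - q2) * X3 * (T2 - q2)
  by rewrite -mulrA -TX2 mulrA uT2 mul1r.
move: (T2 - q2) DT X2E' => u2 DT X2E'; set C := braid_defect _ _ in DT DX *.
rewrite {1}X2E !mulrA DT !mulNr -(mulrA u2) DX.
by rewrite -!mulrA DT !mulrN opprK X2E' !mulrA.
Qed.

Lemma braid_defect_X3 : D * X3 = X1 * D.
Proof.
have DT := braid_defect_T2; have DX := braid_defect_X2.
have uT1 := quadVl Q1; have uT2 := quadVl Q2.
have X3E : X3 = T2 * X2 * T2 by rewrite TX2 -mulrA uT2 mulr1.
have X1E : X1 = (T1 - q1) * X2 * (T1 - q1)
  by rewrite -mulrA -TX1 mulrA uT1 mul1r.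
move: (T1 - q1) DT X1E => u1 DT X1E; set C := braid_defect _ _ in DT DX *.
rewrite {1}X3E !mulrA DT !mulNr -(mulrA u1) DX.
by rewrite -!mulrA DT !mulrN opprK X1E !mulrA.
Qed.
End Braid.

End RelationDefects.

(** * The action of the generators on maps from S_n to the coefficients *)

Section WreathModule.
Variables (R : comNzRingType) (S : pzAlgType R) (n : nat) (z : R).
Variables (sw : 'I_n.-1 -> S -> S) (tt : 'I_n.-1 -> S).
Implicit Types (i j : 'I_n.-1) (a : S) (w : 'S_n).
Hypothesis sw_linear : forall i, linear (sw i).
Hypothesis swM : forall i, {morph sw i : x y / x * y}.
Hypothesis sw1 : forall i, sw i 1 = 1.
Hypothesis swK : forall i, involutive (sw i).
Hypothesis sw_far : forall i j a, (i.+1 < j)%N || (j.+1 < i)%N ->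
  sw i (sw j a) = sw j (sw i a).
Hypothesis sw_braid : forall i j a, j = i.+1 :> nat ->
  sw i (sw j (sw i a)) = sw j (sw i (sw j a)).
Hypothesis tt_slide : forall i a, sw i a * tt i = tt i * a.
Hypothesis tt_fixed : forall i, sw i (tt i) = tt i.
Hypothesis tt_far : forall i j, (i.+1 < j)%N || (j.+1 < i)%N ->
  sw i (tt j) = tt j.
Hypothesis tt_braid : forall i j, j = i.+1 :> nat ->
  sw i (tt j) = sw j (tt i).

(* The function x stands for the element \sum_w (x w) T_w. *)
Local Notation K := {ffun 'S_n -> S}.

Let sw0 i : sw i 0 = 0. Proof. exact: linear_map0. Qed.

Fact wreathA_linear a : linear (fun x : K => [ffun w => a * x w] : K).
Proof.
move=> c x y; apply/ffunP => w.
by rewrite !ffunE mulrDr -pzalg_scalerAr.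
Qed.
Definition wreathA a : lend K := Lend (wreathA_linear a).

(** The coefficient of T_w in T_i \sum_u (x u) T_u. The term u = s_i w always contributes; the term
    u = w contributes only along a descent, through the quadratic relation, and s_i(x w) t is
    rewritten there as t (x w). *)
Fact wreathT_linear i : linear (fun x : K => [ffun w =>
  sw i (x (w * simple i)%g) + (if desc i w then z *: (tt i * x w) else 0)] : K).
Proof.
move=> c x y; apply/ffunP => w; rewrite !ffunE sw_linear.
case: ifP => _; last by rewrite !addr0.
rewrite mulrDr -pzalg_scalerAr !scalerDr !scalerA [z * c]mulrC.
by rewrite addrACA.
Qed.
Definition wreathT i : lend K := Lend (wreathT_linear i).

Definition wreath_unit w a : K := [ffun u => if u == w then a else 0].

Lemma wreathA_unit a b w : wreathA a (wreath_unit w b) = wreath_unit w (a * b).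
Proof. by apply/ffunP => u; rewrite !ffunE; case: eqP; rewrite ?mulr0. Qed.

Lemma wreathT_unit i w a : ~~ desc i w ->
  wreathT i (wreath_unit w a) = wreath_unit (w * simple i)%g (sw i a).
Proof.
move=> nd; apply/ffunP => u; rewrite !ffunE.
have -> : (u * simple i == w)%g = (u == w * simple i)%g.
  by apply/eqP/eqP => [<-|->]; rewrite mul_simpleK.
have [->|_] := eqVneq u w.
  by rewrite (negPf nd) addr0; case: eqP => // _; rewrite sw0.
by rewrite mulr0 scaler0 if_same addr0; case: eqP => // _; rewrite sw0.
Qed.

Lemma wreathA_linear_l : linear wreathA.
Proof.
move=> c a b; apply: lendP => x; apply/ffunP => w.
by rewrite !ffunE mulrDl -pzalg_scalerAl.
Qed.

Lemma wreathA_monoid : monoid_morphism wreathA.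
Proof.
split=> [|a b]; apply: lendP => x; apply/ffunP => w.
  by rewrite !ffunE mul1r.
by rewrite !ffunE mulrA.
Qed.

Lemma wreath_slide i a : wreathT i * wreathA a = wreathA (sw i a) * wreathT i.
Proof.
apply: lendP => x; apply/ffunP => w; rewrite !ffunE swM mulrDr; congr (_ + _).
case: ifP => _; last by rewrite mulr0.
by rewrite -pzalg_scalerAr !mulrA tt_slide.
Qed.

Definition wreathq i : lend K := z *: wreathA (tt i).

Lemma wreath_quad i : quad (wreathT i) (wreathq i).
Proof.
split; last first.
  by rewrite /wreathq -pzalg_scalerAr wreath_slide tt_fixed pzalg_scalerAl.
apply: lendP => x; apply/ffunP => w.
rewrite !ffunE mul_simpleK (linear_mapD (sw_linear i)) swK desc_simple.
case: (desc i w) => /=; first by rewrite sw0 addr0 addrC.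
by rewrite !addr0 (linear_mapZ (sw_linear i)) swM tt_fixed addrC.
Qed.

Lemma wreath_slide_q i j a : sw i (tt j) = a ->
  wreathT i * wreathq j = z *: wreathA a * wreathT i.
Proof. by move=> <-; rewrite -pzalg_scalerAr wreath_slide pzalg_scalerAl. Qed.

Lemma wreath_ind (P : K -> Prop) :
    (forall x y, P x -> P y -> P (x + y)) -> P 0 ->
  (forall w a, P (wreath_unit w a)) -> forall x, P x.
Proof.
move=> PD P0 PU x; suff -> : x = \sum_w wreath_unit w (x w).
  by elim/big_rec: _ => // w y _; apply: PD.
apply/ffunP => u; rewrite sum_ffunE (bigD1 u) //= big1 ?addr0 => [|w ne].
  by rewrite ffunE eqxx.
by rewrite ffunE eq_sym (negPf ne).
Qed.

Lemma wreath_unit_desc i w a : desc i w ->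
  wreath_unit w a = wreathT i (wreath_unit (w * simple i)%g (sw i a)).
Proof.
by move=> d; rewrite wreathT_unit ?desc_simple ?d // mul_simpleK swK.
Qed.

(** By [comm_defect_mul] the defect C satisfies C T_i = - u C for some u, and similarly for j, so a
    descent i or j of w is stripped off by induction on the length. If neither is a descent, all the
    products involved go up and the claim is commutation in S_n. *)
Lemma wreath_comm i j : (i.+1 < j)%N || (j.+1 < i)%N ->
  comm_defect (wreathT i) (wreathT j) = 0.
Proof.
move=> ij; have ji : (j.+1 < i)%N || (i.+1 < j)%N by rewrite orbC.
have Ti := comm_defect_mul (wreath_quad i) (wreath_slide_q (tt_far ji)).
have Tj := comm_defect_mul (wreath_quad j) (wreath_slide_q (tt_far ij)).
rewrite comm_defectN mulNr mulrN in Tj; move/oppr_inj: Tj => Tj.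
set C := comm_defect _ _ in Ti Tj *; apply: lend_eq0.
apply: (@wreath_ind (fun x => C x = 0)) => [x y Cx Cy||w a].
- by rewrite lend_add Cx Cy addr0.
- exact: lend_zero.
have [m] := ubnP (len w); elim: m w a => // m IH w a lt.
have [di|di] := boolP (desc i w).
  rewrite (wreath_unit_desc _ di) -[C _]/((C * wreathT i) _) Ti lendNE lendME.
  by rewrite IH ?lend_zero ?oppr0 //; have := len_down di; lia.
have [dj|dj] := boolP (desc j w).
  rewrite (wreath_unit_desc _ dj) -[C _]/((C * wreathT j) _) Tj lendNE lendME.
  by rewrite IH ?lend_zero ?oppr0 //; have := len_down dj; lia.
rewrite lendBE !lendME !wreathT_unit // ?desc_far //.
by rewrite sw_far // -!mulgA simple_comm // subrr.
Qed.

Lemma wreath_braid i j : j = i.+1 :> nat ->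
  braid_defect (wreathT i) (wreathT j) = 0.
Proof.
move=> ij; pose q13 : lend K := z *: wreathA (sw i (tt j)).
have s1 : wreathT i * wreathq j = q13 * wreathT i by apply: wreath_slide_q.
have s2 : wreathT i * q13 = wreathq j * wreathT i.
  by rewrite -pzalg_scalerAr wreath_slide swK pzalg_scalerAl.
have s3 : wreathT j * wreathq i = q13 * wreathT j.
  by apply: wreath_slide_q; rewrite (tt_braid ij).
have s4 : wreathT j * q13 = wreathq i * wreathT j.
  by rewrite -pzalg_scalerAr wreath_slide (tt_braid ij) swK pzalg_scalerAl.
have Ti := braid_defect_T1 (wreath_quad i) (wreath_quad j) s2 s3.
have Tj := braid_defect_T2 (wreath_quad i) (wreath_quad j) s1 s4.
set C := braid_defect _ _ in Ti Tj *; apply: lend_eq0.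
apply: (@wreath_ind (fun x => C x = 0)) => [x y Cx Cy||w a].
- by rewrite lend_add Cx Cy addr0.
- exact: lend_zero.
have [m] := ubnP (len w); elim: m w a => // m IH w a lt.
have [di|di] := boolP (desc i w).
  rewrite (wreath_unit_desc _ di) -[C _]/((C * wreathT i) _) Ti lendNE lendME.
  by rewrite IH ?lend_zero ?oppr0 //; have := len_down di; lia.
have [dj|dj] := boolP (desc j w).
  rewrite (wreath_unit_desc _ dj) -[C _]/((C * wreathT j) _) Tj lendNE lendME.
  by rewrite IH ?lend_zero ?oppr0 //; have := len_down dj; lia.
(* As neither i nor j is a descent of w, w is shortest in its coset and each of the three successive
   factors in both words goes up. *)
have h1 : ~~ desc j (w * simple i)%g by rewrite desc_next // ndesc_ends.
have h2 : ~~ desc i (w * simple j)%g by rewrite desc_prev // ndesc_ends.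
have h3 : ~~ desc i (w * simple i * simple j)%g by rewrite desc_prev_next.
have h4 : ~~ desc j (w * simple j * simple i)%g by rewrite desc_next_prev.
rewrite lendBE !lendME !wreathT_unit // (sw_braid _ ij).
by rewrite -!mulgA !(mulgA (simple _)) simple_braid // subrr.
Qed.

Lemma wreath_word w s : len_expression w s ->
  (\prod_(i <- s) wreathT i) (wreath_unit 1%g 1) = wreath_unit w 1.
Proof.
elim: s w => [|i s IH] w ws.
  by case: ws => [-> _]; rewrite /word_perm !big_nil.
have [d ws'] := len_expression_behead ws.
by rewrite big_cons lendME (IH _ ws') (wreath_unit_desc _ d) sw1.
Qed.

End WreathModule.

Definition wreathEnd (R : comNzRingType) (S : pzAlgType R) (n : nat) :
    pzAlgType R :=
  lend {ffun 'S_n -> S}.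

(** * Presentations *)

Section Presentations.
Variables (R : comNzRingType) (A : superAlgType R) (n : nat) (z : R).
Variables (I : finType) (B Bd : I -> A).
Local Notation S := (tpow A n).
Local Notation H := (hecke n z B Bd).
Local Notation hA := (@hecke_tensor R A n z I B Bd).
Local Notation hT := (@hecke_T R A n z I B Bd).
Local Notation tt := (@simple_tp R A I B Bd n).

Section Hecke.

Let q : freeAlg R (hecke_gen A n) -> H := aq _.
Let qM x y : q (x * y) = q x * q y. Proof. exact: aqM. Qed.
Let qL c x y : q (c *: x + y) = c *: q x + q y. Proof. exact: linearP. Qed.
Let qT i : q (free_T A i) = hT i. Proof. by []. Qed.
Let qA a : q (free_tensor a) = hA a. Proof. by []. Qed.
Let qE x y : hecke_rel z B Bd x y -> q x = q y. Proof. exact: presP. Qed.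

Fact hecke_tensor_linear : linear (hA : S -> H).
Proof. by move=> c x y; rewrite -!qA -qL; apply: qE; do 2!constructor. Qed.
HB.instance Definition _ :=
  GRing.isLinear.Build R S H *:%R hA hecke_tensor_linear.

Lemma hecke_tensorM : {morph (hA : S -> H) : x y / x * y}.
Proof. by move=> x y; rewrite -!qA -qM; apply: qE; do 2!constructor. Qed.

Lemma hecke_tensor1 : hA 1 = 1 :> H.
Proof. by rewrite -qA; apply: (@qE _ 1); do 2!constructor. Qed.

Lemma hecke_T_comm (i j : 'I_n.-1) : (i.+1 < j)%N || (j.+1 < i)%N ->
  hT i * hT j = hT j * hT i.
Proof. by move=> /(@HeckeComm R A n z I B Bd)/qE; rewrite !qM. Qed.

Lemma hecke_T_braid (i j : 'I_n.-1) : j = i.+1 :> nat ->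
  hT i * hT j * hT i = hT j * hT i * hT j.
Proof. by move=> /(@HeckeBraid R A n z I B Bd)/qE; rewrite !qM. Qed.

Lemma hecke_slide i a : hT i * hA a = hA (superperm (simple i) a) * hT i.
Proof. by have := qE (@HeckeSlide R A n z I B Bd i a); rewrite !qM. Qed.

Lemma hecke_quadratic i : hT i * hT i = z *: (hA (tt i) * hT i) + 1.
Proof.
rewrite -!qT -!qA -!qM -[1]/(q 1) -qL -expr2; apply: qE.
exact: HeckeQuadratic.
Qed.

Lemma hecke_universal (E : pzAlgType R) (fA : S -> E) (fT : 'I_n.-1 -> E) :
    linear fA -> monoid_morphism fA ->
    (forall i j : 'I_n.-1, (i.+1 < j)%N || (j.+1 < i)%N ->
      fT i * fT j = fT j * fT i) ->
    (forall i j : 'I_n.-1, j = i.+1 :> nat ->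
      fT i * fT j * fT i = fT j * fT i * fT j) ->
    (forall i, fT i * fT i = z *: (fA (tt i) * fT i) + 1) ->
    (forall i a, fT i * fA a = fA (superperm (simple i) a) * fT i) ->
  exists phi : H -> E, [/\ linear phi, monoid_morphism phi,
    forall a, phi (hA a) = fA a & forall i, phi (hT i) = fT i].
Proof.
move=> fL [f1 fM] fC fB fQ fS.
pose h (g : hecke_gen A n) := match g with inl a => fA a | inr i => fT i end.
have [|phi [pL pM pg]] := @pres_universal R _ (@hecke_rel R A n z I B Bd) E h.
  pose F : freeAlg R (hecke_gen A n) -> E := free_lift h.
  have FM x y : F (x * y) = F x * F y by exact: rmorphM (free_lift h) x y.
  have FL c x y : F (c *: x + y) = c *: F x + F y
    by exact: linearP (free_lift h) c x y.
  have F1 : F 1 = 1 by exact: rmorph1 (free_lift h).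
  have lt a : F (free_tensor a) = fA a by exact: free_lift_gen.
  have lT i : F (free_T A i) = fT i by exact: free_lift_gen.
  move=> x y; rewrite -/(F x) -/(F y); case=> [{}x {}y|i j ij|i j ij|i|i a].
  - case=> [c u v||u v]; first by rewrite FL !lt fL.
      by rewrite lt F1.
    by rewrite FM !lt fM.
  - by rewrite !FM !lT fC.
  - by rewrite !FM !lT fB.
  - by rewrite FL expr2 !FM !lT lt F1 fQ.
  - by rewrite !FM !lT !lt fS.
by exists phi; split=> // [a|i]; [exact: (pg (inl a)) | exact: (pg (inr i))].
Qed.

Lemma hecke_ind (P : H -> Prop) :
    P 0 -> P 1 -> (forall c x y, P x -> P y -> P (c *: x + y)) ->
    (forall a x, P x -> P (hA a * x)) -> (forall i x, P x -> P (hT i * x)) ->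
  forall x, P x.
Proof.
by move=> P0 P1 PL PA PT; apply: presAlg_ind => // -[a|i] x Px;
  [exact: PA | exact: PT].
Qed.

End Hecke.

Section Affine.
Local Notation G := (aff_gen n z B Bd).
Local Notation HA := (haff n z B Bd).
Local Notation h := (@haff_hecke R A n z I B Bd).
Local Notation X := (@haff_X R A n z I B Bd).
Local Notation Xinv := (@haff_Xinv R A n z I B Bd).

Let q : freeAlg R G -> HA := aq _.
Let qM x y : q (x * y) = q x * q y. Proof. exact: aqM. Qed.
Let qL c x y : q (c *: x + y) = c *: q x + q y. Proof. exact: linearP. Qed.
Let qh x : q (free_hecke x) = h x. Proof. by []. Qed.
Let qE x y : aff_rel x y -> q x = q y. Proof. exact: presP. Qed.

Fact haff_hecke_linear : linear h.
Proof. by move=> c x y; rewrite -!qh -qL; apply: qE; do 2!constructor. Qed.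
HB.instance Definition _ :=
  GRing.isLinear.Build R H HA *:%R h haff_hecke_linear.

Lemma haff_heckeM : {morph h : x y / x * y}.
Proof. by move=> x y; rewrite -!qh -qM; apply: qE; do 2!constructor. Qed.

Lemma haff_hecke1 : h 1 = 1.
Proof. by rewrite -qh; apply: (@qE _ 1); do 2!constructor. Qed.

Lemma haff_XC i j : X i * X j = X j * X i.
Proof. by have := qE (@AffComm R A n z I B Bd i j); rewrite !qM. Qed.

Lemma haff_XV i : X i * Xinv i = 1.
Proof. by have := qE (@AffInvr R A n z I B Bd i); rewrite qM. Qed.

Lemma haff_VX i : Xinv i * X i = 1.
Proof. by have := qE (@AffInvl R A n z I B Bd i); rewrite qM. Qed.

Lemma haff_TX i j : j != lo i -> j != hi i -> h (hT i) * X j = X j * h (hT i).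
Proof.
by move=> jl jh; have := qE (@AffTX R A n z I B Bd i j jl jh); rewrite !qM.
Qed.

Lemma haff_TXT i : h (hT i) * X (lo i) * h (hT i) = X (hi i).
Proof. by have := qE (@AffTXT R A n z I B Bd i); rewrite !qM. Qed.

Lemma haff_XA i a : X i * h (hA a) = h (hA a) * X i.
Proof. by have := qE (@AffTensor R A n z I B Bd i a); rewrite !qM. Qed.

Lemma haff_universal (E : pzAlgType R) (fh : H -> E) (fX fV : 'I_n -> E) :
    linear fh -> monoid_morphism fh ->
    (forall i j, fX i * fX j = fX j * fX i) ->
    (forall i, fX i * fV i = 1) -> (forall i, fV i * fX i = 1) ->
    (forall (i : 'I_n.-1) (j : 'I_n), j != lo i -> j != hi i ->
      fh (hT i) * fX j = fX j * fh (hT i)) ->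
    (forall i, fh (hT i) * fX (lo i) * fh (hT i) = fX (hi i)) ->
    (forall i a, fX i * fh (hA a) = fh (hA a) * fX i) ->
  exists phi : HA -> E, [/\ linear phi, monoid_morphism phi,
    forall x, phi (h x) = fh x & forall i, phi (X i) = fX i].
Proof.
move=> fL [f1 fM] fC fXV fVX fTX fTXT fXA.
pose e (g : G) := match g with
  inl a => fh a | inr (inl i) => fX i | inr (inr i) => fV i end.
have [|phi [pL pM pg]] := @pres_universal R _ (@aff_rel R A n z I B Bd) E e.
  pose F : freeAlg R G -> E := free_lift e.
  have FM x y : F (x * y) = F x * F y by exact: rmorphM (free_lift e) x y.
  have FL c x y : F (c *: x + y) = c *: F x + F y
    by exact: linearP (free_lift e) c x y.
  have F1 : F 1 = 1 by exact: rmorph1 (free_lift e).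
  have eh x : F (free_hecke x) = fh x by exact: free_lift_gen.
  have eX i : F (free_X z B Bd i) = fX i by exact: free_lift_gen.
  have eV i : F (free_Xinv z B Bd i) = fV i by exact: free_lift_gen.
  move=> x y; rewrite -/(F x) -/(F y).
  case=> [{}x {}y|i j|i|i|i j jl jh|i|i a].
  - case=> [c u v||u v]; first by rewrite FL !eh fL.
      by rewrite eh F1.
    by rewrite FM !eh fM.
  - by rewrite !FM !eX.
  - by rewrite !FM eX eV F1.
  - by rewrite !FM eX eV F1.
  - by rewrite !FM eX !eh fTX.
  - by rewrite !FM !eX !eh.
  - by rewrite !FM !eX !eh.
by exists phi; split=> // [a|i]; [exact: (pg (inl a)) |
  exact: (pg (inr (inl i)))].
Qed.

Lemma haff_ind (P : HA -> Prop) :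
    P 0 -> P 1 -> (forall c x y, P x -> P y -> P (c *: x + y)) ->
    (forall a x, P x -> P (h a * x)) -> (forall i x, P x -> P (X i * x)) ->
    (forall i x, P x -> P (Xinv i * x)) ->
  forall x, P x.
Proof.
by move=> P0 P1 PL Ph PX PV; apply: presAlg_ind => // -[a|[i|i]] x Px;
  [exact: Ph | exact: PX | exact: PV].
Qed.

End Affine.
End Presentations.

(** * The basis of the Frobenius Hecke algebra *)

Section HeckeBasis.
Variables (R : comNzRingType) (A : superAlgType R).
Variables (tr : {scalar A}) (tr_symm : trace_form tr).
Variables (I : finType) (B Bd : I -> A).
Hypothesis B_homog : forall b, homogeneous (B b).
Hypothesis B_basis : is_basis B.
Hypothesis B_dual : forall a b, tr (Bd a * B b) = (a == b)%:R.
Variables (n : nat) (z : R).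
Variable red : 'S_n -> seq 'I_n.-1.
Hypothesis redP : forall w, len_expression w (red w).

Local Notation S := (tpow A n).
Local Notation H := (hecke n z B Bd).
Local Notation hA := (@hecke_tensor R A n z I B Bd).
Local Notation hT := (@hecke_T R A n z I B Bd).
Local Notation tt := (@simple_tp R A I B Bd n).

Definition tensorAlg : pzAlgType R := tpow A n.
Definition simple_superperm (i : 'I_n.-1) : tensorAlg -> tensorAlg :=
  superperm (simple i).

Definition tele (i : 'I_n.-1) : tensorAlg := @simple_tp R A I B Bd n i.
Local Notation sw := simple_superperm.

Let sw_linear i : linear (sw i). Proof. exact: superperm_linear. Qed.
Let swM i : {morph sw i : x y / x * y}. Proof. exact: superpermM. Qed.
Let sw1 i : sw i 1 = 1. Proof. exact: superperm1. Qed.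
Let swK i : involutive (sw i). Proof. exact: superperm_simpleK. Qed.
Let sw_far (i j : 'I_n.-1) a : (i.+1 < j)%N || (j.+1 < i)%N ->
  sw i (sw j a) = sw j (sw i a).
Proof.
by move=> ij; rewrite /simple_superperm !superperm_mul (simple_comm ij).
Qed.
Let sw_braid (i j : 'I_n.-1) a : j = i.+1 :> nat ->
  sw i (sw j (sw i a)) = sw j (sw i (sw j a)).
Proof.
by move=> ij; rewrite /simple_superperm !superperm_mul !mulgA (simple_braid ij).
Qed.
Let tele_slide i a : sw i a * tele i = tele i * a.
Proof. exact: (simple_tp_slide tr_symm B_homog B_basis B_dual). Qed.
Let tele_fixed i : sw i (tele i) = tele i.
Proof. exact: (simple_tp_fixed tr_symm B_homog B_basis B_dual). Qed.
Let tele_far (i j : 'I_n.-1) : (i.+1 < j)%N || (j.+1 < i)%N ->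
  sw i (tele j) = tele j.
Proof. exact: simple_tp_far. Qed.
Let tele_braid (i j : 'I_n.-1) : j = i.+1 :> nat ->
  sw i (tele j) = sw j (tele i).
Proof. exact: simple_tp_braid. Qed.

Local Notation E := (wreathEnd tensorAlg n).
Local Notation wA := (@wreathA R tensorAlg n : S -> E).
Local Notation wT :=
  (@wreathT R tensorAlg n z sw tele sw_linear : 'I_n.-1 -> E).

Lemma hecke_wreath : exists phi : H -> E,
  [/\ linear phi, monoid_morphism phi, forall a, phi (hA a) = wA a
    & forall i, phi (hT i) = wT i].
Proof.
apply: (@hecke_universal R A n z I B Bd E wA wT).
- exact: (@wreathA_linear_l R tensorAlg n).
- exact: (@wreathA_monoid R tensorAlg n).
- move=> i j ij; apply/eqP; rewrite -subr_eq0; apply/eqP.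
  exact: (@wreath_comm R tensorAlg n z sw tele sw_linear swM swK sw_far
    tele_slide tele_fixed tele_far i j ij).
- move=> i j ij; apply/eqP; rewrite -subr_eq0; apply/eqP.
  exact: (@wreath_braid R tensorAlg n z sw tele sw_linear swM swK sw_braid
    tele_slide tele_fixed tele_braid i j ij).
- move=> i; have [-> _] := @wreath_quad R tensorAlg n z sw tele sw_linear swM
    swK tele_slide tele_fixed i.
  by rewrite -pzalg_scalerAl.
- by move=> i a; apply: (@wreath_slide R tensorAlg n z sw tele sw_linear swM
    tele_slide).
Qed.

Definition hecke_word (w : 'S_n) : H := \prod_(i <- red w) hT i.

Lemma hecke_word_up (i : 'I_n.-1) w : ~~ desc i w ->
  hT i * hecke_word w = hecke_word (w * simple i)%g.
Proof.
move=> nd; transitivity (\prod_(j <- i :: red w) hT j);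
  first by rewrite big_cons.
apply: (reduced_words_eq (@hecke_T_comm R A n z I B Bd)
          (@hecke_T_braid R A n z I B Bd)) (redP _).
by apply: len_expression_cons; rewrite ?desc_simple // mul_simpleK.
Qed.

Lemma hecke_word1 : hecke_word 1%g = 1.
Proof.
have [_] := redP 1%g; rewrite len1 /hecke_word.
by case: (red _) => // _; rewrite big_nil.
Qed.

(** The span is stable on the left: T_i slides past the tensor, then lengthens the word or, at a
    descent, is absorbed by the quadratic relation. *)
Lemma hecke_span_words x :
  exists g : 'S_n -> S, x = \sum_w hA (g w) * hecke_word w.
Proof.
pose P x := exists g : 'S_n -> S, x = \sum_w hA (g w) * hecke_word w.
have h0 : hA 0 = 0 by exact: linear0.
have hL := @hecke_tensor_linear R A n z I B Bd.
have hM := @hecke_tensorM R A n z I B Bd.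
have P0 : P 0 by exists (fun=> 0); rewrite big1 // => w _; rewrite h0 mul0r.
have PL c u v : P u -> P v -> P (c *: u + v).
  move=> [g ->] [g' ->]; exists (fun w => c *: g w + g' w).
  rewrite scaler_sumr -big_split; apply: eq_bigr => w _ /=.
  by rewrite hL mulrDl pzalg_scalerAl.
have PD u v : P u -> P v -> P (u + v).
  by move=> Pu Pv; rewrite -[u]scale1r; apply: PL.
have PW w : P (hecke_word w).
  exists (fun u => if u == w then 1 else 0); rewrite (bigD1 w) //= big1 ?addr0.
    by rewrite eqxx hecke_tensor1 mul1r.
  by move=> u /negPf ->; rewrite h0 mul0r.
have PA a u : P u -> P (hA a * u).
  move=> [g ->]; exists (fun w => a * g w).
  by rewrite mulr_sumr; apply: eq_bigr => w _; rewrite hM mulrA.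
apply: (hecke_ind (P := P)) => //; first by rewrite -hecke_word1.
move=> i u [g ->]; rewrite mulr_sumr; elim/big_rec: _ => // w v _ Pv.
apply: PD => //; rewrite mulrA hecke_slide -mulrA; apply: (PA).
have [d|nd] := boolP (desc i w); last by rewrite hecke_word_up.
have Ew : hecke_word w = hT i * hecke_word (w * simple i)%g.
  by rewrite hecke_word_up ?desc_simple ?d // mul_simpleK.
rewrite Ew mulrA hecke_quadratic mulrDl mul1r -pzalg_scalerAl -mulrA -Ew.
by apply: PL => //; apply: PA.
Qed.

Local Notation pure := (@pure_basis R A I B n).

Lemma hecke_basis_span x : exists c : {ffun 'I_n -> I} * 'S_n -> R,
  x = \sum_p c p *: (hA (pure p.1) * hecke_word p.2).
Proof.
have [g ->] := hecke_span_words x.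
have [c gE] := choice (fun w => pure_basis_span B_basis B_dual (g w)).
exists (fun p => c p.2 p.1).
rewrite -(pair_bigA _ (fun b w => c w b *: (hA (pure b) * hecke_word w))) /=.
rewrite exchange_big /=; apply: eq_bigr => w _; rewrite {1}gE.
rewrite linear_sum mulr_suml; apply: eq_bigr => b _.
by rewrite linearZ /= pzalg_scalerAl.
Qed.

(** Acting on the unit vector at the identity permutation, b T_w produces the function supported at
    w with value b. Distinct w are thus separated, and independence reduces to that of the pure
    tensors. *)
Lemma hecke_basis_free (c : {ffun 'I_n -> I} * 'S_n -> R) :
  \sum_p c p *: (hA (pure p.1) * hecke_word p.2) = 0 -> forall p, c p = 0.
Proof.
have [phi [pL [p1 pM] pA pT]] := hecke_wreath.
pose K := {ffun 'S_n -> tensorAlg}; pose v0 : K := wreath_unit 1%g 1.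
pose ev (y : E) : K := (y : lend K) v0.
pose g x := ev (phi x).
have gL c' x y : g (c' *: x + y) = c' *: g x + g y by rewrite /g pL.
have g0 : g 0 = 0 by exact: (linear_map0 gL).
have pW w : phi (hecke_word w) = \prod_(i <- red w) wT i.
  rewrite /hecke_word; elim: (red w) => [|i s IH]; first by rewrite !big_nil p1.
  by rewrite !big_cons pM pT IH.
have pE p : g (hA (pure p.1) * hecke_word p.2) = wreath_unit p.2 (pure p.1).
  rewrite /g pM pA pW /ev lendME.
  rewrite (@wreath_word R tensorAlg n z sw tele sw_linear sw1 swK _ _ (redP _)).
  by rewrite wreathA_unit mulr1.
have gS (s : seq ({ffun 'I_n -> I} * 'S_n)) :
    g (\sum_(p <- s) c p *: (hA (pure p.1) * hecke_word p.2)) =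
    \sum_(p <- s) c p *: (wreath_unit p.2 (pure p.1) : K).
  by elim: s => [|p s IH]; rewrite ?big_nil // !big_cons gL pE IH.
move=> /(congr1 g); rewrite gS g0 => E0 [b w].
have Ew : \sum_b c (b, w) *: (pure b : tensorAlg) = 0.
  move/ffunP/(_ w): E0; rewrite [RHS]ffunE sum_ffunE => E1; apply: etrans E1.
  transitivity (\sum_b \sum_u (c (b, u) *: (wreath_unit u (pure b) : K)) w);
    last by rewrite pair_bigA; apply: eq_bigr => -[].
  apply: eq_bigr => b' _; rewrite (bigD1 w) // big1 ?addr0 => [|u uw].
    by rewrite /= !ffunE eqxx addr0.
  by rewrite /= !ffunE eq_sym (negPf uw) scaler0.
exact: (pure_basis_free B_dual Ew b).
Qed.

End HeckeBasis.

(** * Polynomials with coefficients in an algebra *)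

Section Exponents.
Variable n : nat.
Definition expo := {ffun 'I_n -> nat}.
HB.instance Definition _ := Choice.on expo.
Implicit Types (lam mu : expo) (l : 'I_n).

Definition expo_add lam mu : expo := [ffun i => (lam i + mu i)%N].
Definition expo0 : expo := [ffun=> 0%N].
Definition expo1 l : expo := [ffun i => (i == l : nat)].
Definition expo_clear l lam : expo := [ffun i => if i == l then 0%N else lam i].

Lemma expo_add0 lam : expo_add lam expo0 = lam.
Proof. by apply/ffunP => i; rewrite !ffunE addn0. Qed.
Lemma expo_addC : commutative expo_add.
Proof. by move=> lam mu; apply/ffunP => i; rewrite !ffunE addnC. Qed.
Lemma expo_addA : associative expo_add.
Proof. by move=> lam mu nu; apply/ffunP => i; rewrite !ffunE addnA. Qed.
Lemma expo_ind (P : expo -> Prop) :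
  P expo0 -> (forall l lam, P lam -> P (expo_add lam (expo1 l))) ->
    forall lam, P lam.
Proof.
move=> P0 PS lam; have [m] := ubnP (\sum_i lam i);
  elim: m lam => // m IH lam lt.
have [/existsP[l l0]|/existsPn lam0] := boolP [exists l, lam l != 0%N];
  last first.
  have -> : lam = expo0; last exact: P0.
  by apply/ffunP => i; rewrite ffunE; apply/eqP; have := lam0 i; rewrite negbK.
pose mu : expo := [ffun i => if i == l then (lam i).-1 else lam i].
have E : lam = expo_add mu (expo1 l).
  apply/ffunP => i; rewrite !ffunE; case: eqP => [->|_]; last by rewrite addn0.
  by rewrite addn1 prednK // lt0n.
rewrite E; apply: PS; apply: IH.
rewrite -ltnS; apply: leq_trans lt.
rewrite ltnS [X in (_ < X)%N](bigD1 l) //= (bigD1 l) //=.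
rewrite ffunE eqxx -[(_ + _).+1]addSn prednK ?lt0n // leq_add2l.
by apply: leq_sum => i /negPf il; rewrite ffunE il.
Qed.
End Exponents.
Arguments expo0 {n}.
Arguments expo1 {n} l.

Section PolynomialModule.
Variables (R : comNzRingType) (n : nat) (H : pzAlgType R).
Local Notation expo := (expo n).
Implicit Types (lam mu : expo) (l : 'I_n) (h : H).

(** [mon lam h] stands for X^lam h. The coefficient algebra H is noncommutative and not known to be
    nonzero, so [{malg _}] supplies the additive group and the R-module structure is put on
    coefficientwise. *)
Definition pmod := {malg H[expo]}.
HB.instance Definition _ := GRing.Zmodule.on pmod.
Implicit Types x y : pmod.

Definition mon lam h : pmod := << h *g lam >>.
Definition pcoef lam x : H := mcoeff lam x.

Lemma pmodP x y : (forall lam, pcoef lam x = pcoef lam y) -> x = y.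
Proof. by move=> E; apply/malgP. Qed.
Lemma pcoefD lam x y : pcoef lam (x + y) = pcoef lam x + pcoef lam y.
Proof. exact: mcoeffD. Qed.
Lemma pcoef0 lam : pcoef lam 0 = 0. Proof. exact: mcoeff0. Qed.
Lemma pcoef_mon lam mu h : pcoef mu (mon lam h) = if lam == mu then h else 0.
Proof. by rewrite /pcoef mcoeffU; case: eqP. Qed.

Definition pscale (c : R) x : pmod := [malg lam in msupp x => c *: x@_lam].
Lemma pcoef_pscale c lam x : pcoef lam (pscale c x) = c *: pcoef lam x.
Proof.
rewrite /pcoef mcoeffE; case: ifP => // /negbT /mcoeff_outdom ->.
by rewrite scaler0.
Qed.
Fact pscaleA c d x : pscale c (pscale d x) = pscale (c * d) x.
Proof. by apply: pmodP => lam; rewrite !pcoef_pscale scalerA. Qed.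
Fact pscale1 : left_id 1 pscale.
Proof. by move=> x; apply: pmodP => lam; rewrite pcoef_pscale scale1r. Qed.
Fact pscaleDr : right_distributive pscale +%R.
Proof.
by move=> c x y; apply: pmodP => lam; rewrite !(pcoef_pscale, pcoefD) scalerDr.
Qed.
Fact pscaleDl x : {morph pscale^~ x : c d / c + d}.
Proof.
by move=> c d; apply: pmodP => lam; rewrite !(pcoef_pscale, pcoefD) scalerDl.
Qed.
HB.instance Definition _ :=
  GRing.Zmodule_isLmodule.Build R pmod pscaleA pscale1 pscaleDr pscaleDl.
Lemma pcoefZ c lam x : pcoef lam (c *: x) = c *: pcoef lam x.
Proof. exact: pcoef_pscale. Qed.

Fact mon_linear lam : linear (mon lam).
Proof.
move=> c h h'; apply: pmodP => mu; rewrite pcoefD pcoefZ !pcoef_mon.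
by case: eqP; rewrite // scaler0 addr0.
Qed.
HB.instance Definition _ lam :=
  GRing.isLinear.Build R H pmod *:%R (mon lam) (mon_linear lam).

Lemma pmodE x : x = \sum_(lam <- msupp x) mon lam (pcoef lam x).
Proof. by rewrite {1}[x]monalgE. Qed.

Lemma pmod_ind (P : pmod -> Prop) :
    P 0 -> (forall x y, P x -> P y -> P (x + y)) ->
  (forall lam h, P (mon lam h)) -> forall x, P x.
Proof.
move=> P0 PD PM x; rewrite [x]pmodE; elim/big_rec: _ => // lam y _ Py.
exact: PD.
Qed.

Definition supported (p : expo -> Prop) x := forall lam, ~ p lam ->
  pcoef lam x = 0.

Lemma supported_ind (p : expo -> Prop) (P : pmod -> Prop) :
    P 0 -> (forall x y, P x -> P y -> P (x + y)) ->
  (forall lam h, p lam -> P (mon lam h)) -> forall x, supported p x -> P x.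
Proof.
move=> P0 PD PM x sx; rewrite [x]pmodE; elim/big_rec: _ => // lam y _ Py.
apply: PD => //; have [pl|npl] := EM (p lam); first exact: PM.
by rewrite sx // linear0.
Qed.

Lemma supported_mon (p : expo -> Prop) lam h : p lam -> supported p (mon lam h).
Proof.
by move=> pl mu npm; rewrite pcoef_mon; case: eqP => // E; case: npm;
  rewrite -E.
Qed.
Lemma supportedD p x y : supported p x -> supported p y -> supported p (x + y).
Proof. by move=> sx sy lam np; rewrite pcoefD sx // sy // addr0. Qed.
Lemma supported0 p : supported p 0.
Proof. by move=> lam _; rewrite pcoef0. Qed.
Lemma supportedZ p c x : supported p x -> supported p (c *: x).
Proof. by move=> sx lam np; rewrite pcoefZ sx // scaler0. Qed.
Lemma supportedW (p p' : expo -> Prop) x :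
  (forall lam, p lam -> p' lam) -> supported p x -> supported p' x.
Proof. by move=> pp' sx lam np'; apply: sx => /pp'. Qed.

Lemma supportedN p x : supported p x -> supported p (- x).
Proof. by rewrite -scaleN1r; apply: supportedZ. Qed.
Lemma supportedB p x y : supported p x -> supported p y -> supported p (x - y).
Proof. by move=> sx sy; apply: supportedD => //; apply: supportedN. Qed.

Section Lift.
Variables (W : lmodType R) (phi : expo -> H -> W).
Hypothesis phi_lin : forall lam, linear (phi lam).

Definition plift x : W := \sum_(lam <- msupp x) phi lam (pcoef lam x).

Let phi0 lam : phi lam 0 = 0.
Proof. exact: linear_map0. Qed.

Lemma pliftEw (d : {fset expo}) x : (msupp x `<=` d)%fset ->
  plift x = \sum_(lam <- d) phi lam (pcoef lam x).
Proof.
move=> le; rewrite [LHS](big_fset_incl _ le) //= => lam _ /mcoeff_outdom E.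
by rewrite /pcoef E phi0.
Qed.

Lemma plift_linear : linear plift.
Proof.
move=> c x y; pose d := (msupp x `|` msupp y `|` msupp (c *: x + y))%fset.
have [dx dy dxy] : [/\ msupp x `<=` d, msupp y `<=` d
                     & msupp (c *: x + y) `<=` d]%fset.
  by split; apply/fsubsetP => w wd; rewrite !in_fsetU wd ?orbT.
rewrite !(pliftEw (d := d)) // scaler_sumr -big_split /=.
by apply: eq_bigr => lam _; rewrite pcoefD pcoefZ phi_lin.
Qed.

Lemma plift_mon lam h : plift (mon lam h) = phi lam h.
Proof. by rewrite (pliftEw msuppU_le) big_seq_fset1 pcoef_mon eqxx. Qed.
End Lift.

Local Notation E := (lend pmod).

Definition plend (phi : expo -> H -> pmod)
  (phi_lin : forall lam, linear (phi lam)) : E :=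
  locked (Lend (plift_linear phi_lin)).

Lemma plend_mon phi phi_lin lam h : @plend phi phi_lin (mon lam h) = phi lam h.
Proof. by rewrite /plend -lock; apply: plift_mon. Qed.

Lemma plendP (f g : E) : (forall lam h, f (mon lam h) = g (mon lam h)) -> f = g.
Proof.
move=> fg; apply: lendP; apply: pmod_ind => [|x y fx fy|//].
  by rewrite !lend_zero.
by rewrite !lend_add fx fy.
Qed.

Definition shift mu : E := @plend (fun lam h => mon (expo_add lam mu) h)
  (fun lam => mon_linear (expo_add lam mu)).
Definition pvar l : E := locked (shift (expo1 l)).
Lemma pvarE l : pvar l = shift (expo1 l). Proof. by rewrite /pvar -lock. Qed.

Lemma shift_mon mu lam h : shift mu (mon lam h) = mon (expo_add lam mu) h.
Proof. exact: plend_mon. Qed.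

Lemma shiftM mu nu : shift mu * shift nu = shift (expo_add mu nu).
Proof.
by apply: plendP => lam h; rewrite lendME !shift_mon (expo_addC mu) expo_addA.
Qed.

Lemma shift0 : shift expo0 = 1.
Proof. by apply: plendP => lam h; rewrite shift_mon expo_add0. Qed.

Lemma shiftC mu nu : shift mu * shift nu = shift nu * shift mu.
Proof. by rewrite !shiftM expo_addC. Qed.

Lemma pvarC l l' : pvar l * pvar l' = pvar l' * pvar l.
Proof. by rewrite !pvarE shiftC. Qed.

Definition pconst h : pmod := mon expo0 h.
HB.instance Definition _ := GRing.isLinear.Build R H pmod *:%R pconst
  (mon_linear expo0).

Lemma shift_pconst lam h : shift lam (pconst h) = mon lam h.
Proof. by rewrite shift_mon expo_addC expo_add0. Qed.

Lemma shiftX l m : pvar l ^+ m = shift [ffun i => ((i == l) * m)%N].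
Proof.
elim: m => [|m IH].
  by rewrite expr0 -shift0; congr shift; apply/ffunP => i; rewrite !ffunE muln0.
rewrite exprS IH pvarE shiftM; congr shift; apply/ffunP => i.
by rewrite !ffunE mulnS.
Qed.

Lemma pvar_mon l lam h : pvar l (mon lam h) = mon (expo_add lam (expo1 l)) h.
Proof. by rewrite pvarE shift_mon. Qed.

Lemma pmodX_ind (P : pmod -> Prop) :
    P 0 -> (forall x y, P x -> P y -> P (x + y)) ->
    (forall h, P (pconst h)) -> (forall l x, P x -> P (pvar l x)) ->
      forall x, P x.
Proof.
move=> P0 PD Pi PX; apply: pmod_ind => // lam h.
elim/expo_ind: lam => [|l lam IH]; first exact: Pi.
by rewrite -pvar_mon; apply: PX.
Qed.

Fact lmul_subproof h lam : linear (fun h' : H => mon lam (h * h')).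
Proof.
by move=> c x y; rewrite mulrDr -pzalg_scalerAr linearP.
Qed.
(** For h coming from the tensor power, which commutes with the variables, this is the action wanted
    in the affine algebra. For h = T_i it is right on constants only, and [aT] takes its place. *)
Definition lmul h : E := @plend (fun lam h' => mon lam (h * h'))
  (lmul_subproof h).

Lemma lmul_mon h lam h' : lmul h (mon lam h') = mon lam (h * h').
Proof. exact: plend_mon. Qed.

Lemma lmul_pconst h h' : lmul h (pconst h') = pconst (h * h').
Proof. exact: lmul_mon. Qed.

Lemma lmul_linear : linear lmul.
Proof.
move=> c h h'; apply: plendP => lam y.
rewrite lendDE lendZE !lmul_mon -linearP; congr mon.
by rewrite mulrDl pzalg_scalerAl.
Qed.

Lemma lmulM : {morph lmul : h h' / h * h'}.
Proof.
by move=> h h'; apply: plendP => lam y; rewrite lendME !lmul_mon mulrA.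
Qed.

Lemma lmul1 : lmul 1 = 1.
Proof. by apply: plendP => lam y; rewrite lmul_mon mul1r. Qed.

Lemma lmul_shift h mu : lmul h * shift mu = shift mu * lmul h.
Proof. by apply: plendP => lam y; rewrite !lendME !(lmul_mon, shift_mon). Qed.

Lemma lmul_shiftE h mu x : lmul h (shift mu x) = shift mu (lmul h x).
Proof. exact: (congr1 (fun f : E => f x) (lmul_shift h mu)). Qed.

Lemma shiftCE mu nu x : shift mu (shift nu x) = shift nu (shift mu x).
Proof. exact: (congr1 (fun f : E => f x) (shiftC mu nu)). Qed.

Lemma lmul_X h l : lmul h * pvar l = pvar l * lmul h.
Proof. by rewrite pvarE lmul_shift. Qed.

Lemma X_shift l mu : pvar l * shift mu = shift mu * pvar l.
Proof. by rewrite pvarE shiftC. Qed.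

Lemma X_shiftE l mu x : pvar l (shift mu x) = shift mu (pvar l x).
Proof. by rewrite pvarE shiftCE. Qed.

Lemma supported_map (f : E) (p p' : expo -> Prop) x :
  (forall lam h, p lam -> supported p' (f (mon lam h))) ->
  supported p x -> supported p' (f x).
Proof.
move=> fp; move: x; apply: (@supported_ind p) => [|y y' sy sy'|//].
  by rewrite lend_zero; apply: supported0.
by rewrite lend_add; apply: supportedD.
Qed.

Lemma supported_shift mu (p p' : expo -> Prop) x :
  (forall lam, p lam -> p' (expo_add lam mu)) ->
  supported p x -> supported p' (shift mu x).
Proof.
move=> pp'; apply: supported_map => lam h pl; rewrite shift_mon.
exact/supported_mon/pp'.
Qed.

Lemma supported_X l (p p' : expo -> Prop) x :
  (forall lam, p lam -> p' (expo_add lam (expo1 l))) ->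
  supported p x -> supported p' (pvar l x).
Proof. by rewrite pvarE; apply: supported_shift. Qed.

Lemma supported_lmul h p x : supported p x -> supported p (lmul h x).
Proof.
by apply: supported_map => lam h' pl; rewrite lmul_mon; apply: supported_mon.
Qed.

Lemma Xn_pconst l e h : (pvar l ^+ e) (pconst h) =
  mon [ffun i => ((i == l) * e)%N] h.
Proof. by rewrite shiftX shift_pconst. Qed.

Lemma mon_split l lam h :
  mon lam h = shift (expo_clear l lam) ((pvar l ^+ lam l) (pconst h)).
Proof.
rewrite -lendME shiftX shiftM shift_pconst; congr mon; apply/ffunP => i.
by rewrite !ffunE; case: eqP => [->|_]; rewrite ?mul1n ?addn0.
Qed.

End PolynomialModule.

(** * The polynomial representation *)

Section AffineAction.
Variables (R : comNzRingType) (n : nat) (H : pzAlgType R) (S : Type).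
Variables (hA : S -> H) (hT : 'I_n.-1 -> H) (sw : 'I_n.-1 -> S -> S).
Variable (qq : 'I_n.-1 -> S).
Local Notation q i := (hA (qq i)).
Implicit Types (i j : 'I_n.-1) (l : 'I_n) (h : H) (lam mu : expo n).
Hypothesis h_quad : forall i, quad (hT i) (q i).
Hypothesis h_comm : forall i j, (i.+1 < j)%N || (j.+1 < i)%N ->
  hT i * hT j = hT j * hT i.
Hypothesis h_braid : forall i j, j = i.+1 :> nat ->
  hT i * hT j * hT i = hT j * hT i * hT j.
Hypothesis h_slide : forall i a, hT i * hA a = hA (sw i a) * hT i.
Hypothesis q_slide : forall i a, hA (sw i a) * q i = q i * hA a.
Hypothesis swK : forall i, involutive (sw i).
Hypothesis qq_far : forall i j, (i.+1 < j)%N || (j.+1 < i)%N ->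
  sw i (qq j) = qq j.
Hypothesis qq_braid : forall i j, j = i.+1 :> nat -> sw i (qq j) = sw j (qq i).

Local Notation M := (pmod n H).
Local Notation E := (lend M).
Local Notation X := (@pvar R n H).
Local Notation lA a := (lmul n (hA a)).
Local Notation lq i := (lmul n (q i)).

(** If u = T_i v, the new components are T_i (X_lo v) and X_lo v, as dictated by T_i X_lo = X_hi
    (T_i - q). [pair_hi] does the same for X_hi. *)
Fact pair_lo_subproof i : linear (fun uv : M * M =>
  (X (hi i) (uv.1 - lq i uv.2), X (lo i) uv.2) : M * M).
Proof.
move=> c [u v] [u' v']; congr (_, _); last first.
  by rewrite -[RHS]/(c *: X (lo i) v + X (lo i) v') -lend_scale -lend_add.
rewrite -[RHS]/(c *: X (hi i) (u - lq i v) + X (hi i) (u' - lq i v')).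
rewrite -lend_scale -lend_add; congr (X _ _).
rewrite -[LHS]/(c *: u + u' - lq i (c *: v + v')).
by rewrite lend_add lend_scale scalerBr opprD addrACA.
Qed.
Definition pair_lo i : lend (M * M)%type := Lend (pair_lo_subproof i).

Fact pair_hi_subproof i : linear (fun uv : M * M =>
  (X (lo i) uv.1 + lq i (X (hi i) uv.2), X (hi i) uv.2) : M * M).
Proof.
move=> c [u v] [u' v']; congr (_, _); last first.
  by rewrite -[RHS]/(c *: X (hi i) v + X (hi i) v') -lend_scale -lend_add.
rewrite -[RHS]/(c *: (X (lo i) u + lq i (X (hi i) v)) +
  (X (lo i) u' + lq i (X (hi i) v'))).
rewrite -[LHS]/(X (lo i) (c *: u + u') + lq i (X (hi i) (c *: v + v'))).
by rewrite !lend_add !lend_scale scalerDr addrACA.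
Qed.
Definition pair_hi i : lend (M * M)%type := Lend (pair_hi_subproof i).

(** The consistency condition that lets T_i be extended from constants to polynomials: in either
    order the q-terms cancel and the first component is X_lo X_hi u. *)
Lemma pair_loC i : pair_lo i * pair_hi i = pair_hi i * pair_lo i.
Proof.
apply: lendP => -[u v]; congr (_, _); last first.
  by rewrite -[LHS]/(X (lo i) (X (hi i) v)) -[RHS]/(X (hi i) (X (lo i) v))
             -!lendME pvarC.
rewrite -[LHS]/(X (hi i) (X (lo i) u + lq i (X (hi i) v) - lq i (X (hi i) v))).
rewrite -[RHS]/(X (lo i) (X (hi i) (u - lq i v)) + lq i
  (X (hi i) (X (lo i) v))).
rewrite addrK !lend_sub -!lendME [X (hi i) * X (lo i)]pvarC lmul_X
  -(mulrA _ (lq i)).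
by rewrite lmul_X mulrA [X (hi i) * X (lo i)]pvarC subrK.
Qed.

Definition expo_rest i lam : expo n :=
  [ffun l => if (l == lo i) || (l == hi i) then 0%N else lam l].

Definition pair_word i lam : lend (M * M)%type :=
  pair_lo i ^+ lam (lo i) * pair_hi i ^+ lam (hi i).

Fact aT_subproof i lam : linear (fun h =>
  shift H (expo_rest i lam)
    (pair_word i lam (pconst n (hT i * h), pconst n h)).1).
Proof.
move=> c h h'; rewrite -lend_scale -lend_add; congr (shift _ _ _).
rewrite mulrDr -pzalg_scalerAr !linearP.
by rewrite -[(_, _)]/(c *: (pconst n (hT i * h), pconst n h) +
     (pconst n (hT i * h'), pconst n h')) lend_add lend_scale.
Qed.

(* The pair (T p h, p h) depends on the polynomial p through commuting
   operators, one for each variable; [aT i] is read off the first component. *)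
Definition aT i : E := plend (aT_subproof i).

Lemma aT_mon i lam h : aT i (mon lam h) = shift H (expo_rest i lam)
    (pair_word i lam (pconst n (hT i * h), pconst n h)).1.
Proof. exact: plend_mon. Qed.

Lemma aT_pconst i h : aT i (pconst n h) = pconst n (hT i * h).
Proof.
rewrite aT_mon /pair_word !ffunE !expr0 mulr1 lend1E.
have -> : expo_rest i expo0 = expo0.
  by apply/ffunP => l; rewrite !ffunE if_same.
by rewrite shift0.
Qed.

Lemma pair_word2 i lam h :
  shift H (expo_rest i lam)
    (pair_word i lam (pconst n (hT i * h), pconst n h)).2 = mon lam h.
Proof.
have lo2 m p : ((pair_lo i ^+ m) p).2 = (X (lo i) ^+ m) p.2.
  by elim: m p => [|m IH] p //; rewrite !exprS /= IH.
have hi2 m p : ((pair_hi i ^+ m) p).2 = (X (hi i) ^+ m) p.2.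
  by elim: m p => [|m IH] p //; rewrite !exprS /= IH.
rewrite /pair_word lendME lo2 hi2 [(_, _).2]/= -!lendME !shiftX !shiftM
  shift_pconst.
congr mon; apply/ffunP => l; rewrite !ffunE; case: eqP => [->|_].
  by rewrite (negPf (lo_neq_hi i)) /= mul1n mul0n addn0.
by case: eqP => [->|_]; rewrite ?mul1n ?mul0n ?addn0.
Qed.

Lemma expo_restD i lam l : l \in [:: lo i; hi i] ->
  expo_rest i (expo_add lam (expo1 l)) = expo_rest i lam.
Proof.
rewrite !inE => il; apply/ffunP => k; rewrite !ffunE.
by case: ifP => // /norP[klo khi]; case/orP: il => /eqP ->;
  rewrite ?(negPf klo) ?(negPf khi) addn0.
Qed.

Lemma pair_word_lo i lam p :
  pair_word i (expo_add lam (expo1 (lo i))) p = pair_lo i (pair_word i lam p).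
Proof.
rewrite -lendME; congr (lend_fun _ _).
rewrite /pair_word !ffunE eqxx [hi i == _]eq_sym (negPf (lo_neq_hi i)).
by rewrite addn0 addn1 exprS mulrA.
Qed.

Lemma pair_word_hi i lam p :
  pair_word i (expo_add lam (expo1 (hi i))) p = pair_hi i (pair_word i lam p).
Proof.
rewrite -lendME; congr (lend_fun _ _).
rewrite /pair_word !ffunE eqxx (negPf (lo_neq_hi i)) addn0 addn1 exprS !mulrA.
by congr (_ * _); apply: esym; apply: commrX; apply: esym; apply: pair_loC.
Qed.

Lemma aT_Xlo i : aT i * X (lo i) = X (hi i) * (aT i - lq i).
Proof.
apply: plendP => lam h; rewrite !lendME lendBE pvar_mon !aT_mon.
rewrite expo_restD ?inE ?eqxx // pair_word_lo -[mon lam h](pair_word2 i).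
case: (pair_word i lam _) => u v.
rewrite lmul_shiftE -lend_sub X_shiftE; congr (shift _ _ _).
Qed.

Lemma aT_Xhi i : aT i * X (hi i) = X (lo i) * aT i + lq i * X (hi i).
Proof.
apply: plendP => lam h; rewrite lendDE !lendME pvar_mon !aT_mon.
rewrite expo_restD ?inE ?eqxx ?orbT // -pvar_mon pair_word_hi
  -[mon lam h](pair_word2 i).
case: (pair_word i lam _) => u v.
rewrite !X_shiftE lmul_shiftE -lend_add; congr (shift _ _ _).
Qed.

Lemma aT_X i l : l != lo i -> l != hi i -> aT i * X l = X l * aT i.
Proof.
move=> ll lh; apply: plendP => lam h; rewrite !lendME pvar_mon !aT_mon.
have -> : pair_word i (expo_add lam (expo1 l)) = pair_word i lam.
  by rewrite /pair_word !ffunE ![_ == l]eq_sym (negPf ll) (negPf lh) !addn0.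
have -> : expo_rest i (expo_add lam (expo1 l)) =
  expo_add (expo_rest i lam) (expo1 l).
  apply/ffunP => k; rewrite !ffunE; case: ifP => // /orP[]/eqP ->.
    by rewrite eq_sym (negPf ll).
  by rewrite eq_sym (negPf lh).
by rewrite -shiftM lendME -pvarE X_shiftE.
Qed.

(** The difference D of the two sides is carried across each variable, exchanging X_lo and X_hi, and
    is 0 on constants. It precedes the quadratic relation, whose defect can be moved past the
    variables only once T_i is known to commute with q. *)
Lemma aT_slide i a : aT i * lA a = lA (sw i a) * aT i.
Proof.
pose D := aT i * lA a - lA (sw i a) * aT i.
have AQ : lA (sw i a) * lq i = lq i * lA a by rewrite -!lmulM q_slide.
suff : D = 0 by move/eqP; rewrite subr_eq0 => /eqP.
have Dlo : D * X (lo i) = X (hi i) * D.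
  rewrite mulrBl -!mulrA lmul_X aT_Xlo !mulrA aT_Xlo lmul_X -!mulrA -mulrBr.
  by congr (_ * _); rewrite mulrBl mulrBr opprB AQ addrA subrK.
have Dhi : D * X (hi i) = X (lo i) * D.
  rewrite mulrBl -!mulrA lmul_X aT_Xhi !mulrA aT_Xhi mulrDl mulrDr opprD.
  rewrite addrACA [X in _ + X](_ : _ = 0) ?addr0.
    by rewrite !mulrA lmul_X -!mulrA -mulrBr.
  by rewrite -mulrA -lmul_X !mulrA -!lmulM q_slide subrr.
have DX l : l != lo i -> l != hi i -> D * X l = X l * D.
  move=> ll lh; rewrite mulrBl -!mulrA lmul_X (aT_X ll lh) !mulrA (aT_X ll lh)
    lmul_X -!mulrA.
  by rewrite -mulrBr.
apply: lend_eq0; apply: pmodX_ind => [|x y Dx Dy|h|l x Dx].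
- exact: lend_zero.
- by rewrite lend_add Dx Dy addr0.
- by rewrite lendBE !lendME lmul_pconst !aT_pconst lmul_pconst !mulrA h_slide
    subrr.
have [->|ll] := eqVneq l (lo i); first by rewrite -lendME Dlo lendME Dx
  lend_zero.
have [->|lh] := eqVneq l (hi i); first by rewrite -lendME Dhi lendME Dx
  lend_zero.
by rewrite -lendME DX // lendME Dx lend_zero.
Qed.

Lemma aT_q i : aT i * lq i = lq i * aT i.
Proof.
rewrite aT_slide; congr (_ * _); apply: plendP => lam h; rewrite !lmul_mon.
suff -> : hA (sw i (qq i)) = q i by [].
have [TT Tq] := h_quad i.
(* T_i q equals both s_i(q) T_i and q T_i, and T_i is invertible in H. *)
have := congr1 (fun x => x * (hT i - q i)) (h_slide i (qq i)).
by rewrite Tq -!mulrA (quadVr (h_quad i)) !mulr1.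
Qed.

Lemma aT_quad i : quad (aT i) (lq i).
Proof.
have Tq := aT_q i; split=> //.
suff : quad_defect (aT i) (lq i) = 0 by move/eqP; rewrite subr_eq0 => /eqP.
have Dlo := quad_defect_X Tq (aT_Xlo i) (aT_Xhi i).
have Dhi := quad_defect_Y Tq (aT_Xlo i) (aT_Xhi i).
have DX l : l != lo i -> l != hi i ->
    quad_defect (aT i) (lq i) * X l = X l * quad_defect (aT i) (lq i).
  move=> ll lh; rewrite /quad_defect [RHS]mulrBr mulrDr mulr1 [LHS]mulrBl
    mulrDl.
  by rewrite mul1r -!mulrA (aT_X ll lh) !mulrA (aT_X ll lh) lmul_X.
have D0 h : quad_defect (aT i) (lq i) (pconst n h) = 0.
  rewrite lendBE lendDE !lendME lend1E !aT_pconst lmul_pconst -linearD -linearB.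
  by rewrite !mulrA (h_quad i).1 mulrDl mul1r subrr linear0.
move: (quad_defect _ _) Dlo Dhi DX D0 => D Dlo Dhi DX D0.
apply: lend_eq0; apply: pmodX_ind => [|x y Dx Dy|//|l x Dx].
- exact: lend_zero.
- by rewrite lend_add Dx Dy addr0.
rewrite -lendME.
have [->|ll] := eqVneq l (lo i); first by rewrite Dlo lendME Dx lend_zero.
have [->|lh] := eqVneq l (hi i); first by rewrite Dhi lendME Dx lend_zero.
by rewrite DX // lendME Dx lend_zero.
Qed.

Lemma aT_comm i j : (i.+1 < j)%N || (j.+1 < i)%N -> aT i * aT j = aT j * aT i.
Proof.
move=> ij; have ji : (j.+1 < i)%N || (i.+1 < j)%N by rewrite orbC.
suff : comm_defect (aT i) (aT j) = 0 by move/eqP; rewrite subr_eq0 => /eqP.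
have Tjq : aT j * lq i = lq i * aT j by rewrite aT_slide qq_far.
have Tiq : aT i * lq j = lq j * aT i by rewrite aT_slide qq_far.
have near (i' j' : 'I_n.-1) : (i'.+1 < j')%N || (j'.+1 < i')%N ->
    [/\ lo i' != lo j', lo i' != hi j', hi i' != lo j' & hi i' != hi j'].
  by move=> ij'; split; rewrite -val_eqE /=; lia.
have [ll lh hl hh] := near i j ij; have [ll' lh' hl' hh'] := near j i ji.
have Dlo := comm_defect_X (aT_quad i) Tjq (aT_Xlo i) (aT_X ll lh) (aT_X hl hh).
have Dhi := comm_defect_Y (aT_quad i) Tjq (aT_Xlo i) (aT_X ll lh) (aT_X hl hh).
have Dlo' := comm_defect_X (aT_quad j) Tiq (aT_Xlo j) (aT_X ll' lh')
  (aT_X hl' hh').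
have Dhi' := comm_defect_Y (aT_quad j) Tiq (aT_Xlo j) (aT_X ll' lh')
  (aT_X hl' hh').
(* The defect is antisymmetric in i and j, so what holds for the variables moved by T_i carries over
   to those moved by T_j. *)
rewrite comm_defectN mulNr mulrN in Dlo'; move/oppr_inj: Dlo' => Dlo'.
rewrite comm_defectN mulNr mulrN in Dhi'; move/oppr_inj: Dhi' => Dhi'.
have DX l : l != lo i -> l != hi i -> l != lo j -> l != hi j ->
    comm_defect (aT i) (aT j) * X l = X l * comm_defect (aT i) (aT j).
  move=> h1 h2 h3 h4; rewrite /comm_defect [RHS]mulrBr [LHS]mulrBl -!mulrA.
  by rewrite (aT_X h1 h2) (aT_X h3 h4) !mulrA (aT_X h1 h2) (aT_X h3 h4).
have D0 h : comm_defect (aT i) (aT j) (pconst n h) = 0.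
  by rewrite lendBE !lendME !aT_pconst -linearB !mulrA h_comm // subrr linear0.
move: (comm_defect _ _) Dlo Dhi Dlo' Dhi' DX D0 => D Dlo Dhi Dlo' Dhi' DX D0.
apply: lend_eq0; apply: pmodX_ind => [|x y Dx Dy|//|l x Dx].
- exact: lend_zero.
- by rewrite lend_add Dx Dy addr0.
rewrite -lendME.
have [->|h1] := eqVneq l (lo i); first by rewrite Dlo lendME Dx lend_zero.
have [->|h2] := eqVneq l (hi i); first by rewrite Dhi lendME Dx lend_zero.
have [->|h3] := eqVneq l (lo j); first by rewrite Dlo' lendME Dx lend_zero.
have [->|h4] := eqVneq l (hi j); first by rewrite Dhi' lendME Dx lend_zero.
by rewrite DX // lendME Dx lend_zero.
Qed.

Lemma aT_braid i j : j = i.+1 :> nat ->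
  aT i * aT j * aT i = aT j * aT i * aT j.
Proof.
move=> ij.
suff : braid_defect (aT i) (aT j) = 0 by move/eqP; rewrite subr_eq0 => /eqP.
pose a := sw i (qq j); have ja : a = sw j (qq i) by rewrite -qq_braid.
have s1 : aT i * lq j = lA a * aT i by apply: aT_slide.
have s2 : aT i * lA a = lq j * aT i by rewrite aT_slide swK.
have s3 : aT j * lq i = lA a * aT j by rewrite ja; apply: aT_slide.
have s4 : aT j * lA a = lq i * aT j by rewrite ja aT_slide swK.
have TX2 : aT j * X (hi i) = X (hi j) * (aT j - lq j)
  by rewrite -(hi_lo ij) aT_Xlo.
have TX3 : aT i * X (hi j) = X (hi j) * aT i.
  by apply: aT_X; rewrite -val_eqE /=; lia.
have T2X1 : aT j * X (lo i) = X (lo i) * aT j.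
  by apply: aT_X; rewrite -val_eqE /=; lia.
have D1 := braid_defect_X1 (aT_quad i) (aT_quad j) s1 s2 s3 s4 (aT_Xlo i) TX2
  TX3 T2X1.
have D2 := braid_defect_X2 (aT_quad i) (aT_quad j) s1 s2 s3 s4 (aT_Xlo i) TX2
  TX3 T2X1.
have D3 := braid_defect_X3 (aT_quad i) (aT_quad j) s1 s2 s3 s4 (aT_Xlo i) TX2
  TX3 T2X1.
have DX l : l != lo i -> l != hi i -> l != hi j ->
    braid_defect (aT i) (aT j) * X l = X l * braid_defect (aT i) (aT j).
  move=> h1 h2 h3; have h4 : l != lo j by rewrite (hi_lo ij).
  have T1 := aT_X h1 h2; have T2 := aT_X h4 h3.
  rewrite /braid_defect [RHS]mulrBr [LHS]mulrBl -!mulrA T1 T2.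
  by rewrite !(mulrA (aT _) (X l)) T1 T2 -!mulrA !(mulrA (aT _) (X l)) T1 T2
    -!mulrA.
have D0 h : braid_defect (aT i) (aT j) (pconst n h) = 0.
  by rewrite lendBE !lendME !aT_pconst -linearB !mulrA h_braid // subrr linear0.
move: (braid_defect _ _) D1 D2 D3 DX D0 => D D1 D2 D3 DX D0.
apply: lend_eq0; apply: pmodX_ind => [|x y Dx Dy|//|l x Dx].
- exact: lend_zero.
- by rewrite lend_add Dx Dy addr0.
rewrite -lendME.
have [->|h1] := eqVneq l (lo i); first by rewrite D1 lendME Dx lend_zero.
have [->|h2] := eqVneq l (hi i); first by rewrite D2 lendME Dx lend_zero.
have [->|h3] := eqVneq l (hi j); first by rewrite D3 lendME Dx lend_zero.
by rewrite DX // lendME Dx lend_zero.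
Qed.

End AffineAction.

(** * The cyclotomic submodule and division by its generators *)

Lemma ltn_ord_ind n (P : nat -> Prop) :
    P 0%N -> (forall i : 'I_n.-1, P i -> P i.+1) ->
  forall m, (m < n)%N -> P m.
Proof.
move=> P0 PS; elim=> // m IH lt; have lt' : (m < n.-1)%N by lia.
exact: (PS (Ordinal lt') (IH (ltnW lt))).
Qed.

Section CyclotomicReduction.
Variables (R : comNzRingType) (n : nat) (H : pzAlgType R) (S : Type).
Variables (hA : S -> H) (hT : 'I_n.-1 -> H) (sw : 'I_n.-1 -> S -> S).
Variables (qq : 'I_n.-1 -> S).
Local Notation M := (pmod n H).
Local Notation E := (lend M).
Local Notation X := (@pvar R n H).
Local Notation lA a := (lmul n (hA a)).
Local Notation lq i := (lmul n (hA (qq i))).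
Local Notation shift := (@shift R n H).
Implicit Types (i j : 'I_n.-1) (l p : 'I_n) (h : H) (lam mu : expo n).
Implicit Types (x y : M) (m : nat).
Variable T : 'I_n.-1 -> E.
Hypothesis swK : forall i, involutive (sw i).
Hypothesis T_pconst : forall i h, T i (pconst n h) = pconst n (hT i * h).
Hypothesis T_Xlo : forall i, T i * X (lo i) = X (hi i) * (T i - lq i).
Hypothesis T_Xhi : forall i, T i * X (hi i) = X (lo i) * T i + lq i * X (hi i).
Hypothesis T_X : forall i l, l != lo i -> l != hi i -> T i * X l = X l * T i.
Hypothesis T_slide : forall i a, T i * lA a = lA (sw i a) * T i.
Hypothesis T_quad : forall i, quad (T i) (lq i).
Hypothesis T_comm : forall i j, (i.+1 < j)%N || (j.+1 < i)%N ->
  T i * T j = T j * T i.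
Hypothesis T_braid : forall i j, j = i.+1 :> nat ->
  T i * T j * T i = T j * T i * T j.

Variables (i1 : 'I_n) (d : nat) (f : E).
Hypothesis i1_0 : i1 = 0%N :> nat.
Hypothesis d_gt0 : (0 < d)%N.
Hypothesis f_A : forall a, f * lA a = lA a * f.
Hypothesis f_T : forall i, (0 < i)%N -> T i * f = f * T i.
(** This encodes that f is a polynomial in X_1 with coefficients from the tensor power, without
    fixing its shape. *)
Hypothesis f_comm : forall g : E, g * X i1 = X i1 * g ->
  (forall a, g * lA a = lA a * g) -> g * f = f * g.

(* The exponents of the lower terms of a polynomial in the variables up to X_p
   that is monic of degree e in X_p. *)
Definition lower_deg p e lam :=
  (lam p < e)%N /\ forall l, (p < l)%N -> lam l = 0%N.
Definition top_expo p : expo n := [ffun l => ((l == p) * d)%N].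
Hypothesis f_lead : forall h,
  supported (lower_deg i1 d) (f (pconst n h) - mon (top_expo i1) h).

Lemma f_X l : f * X l = X l * f.
Proof.
by apply: esym; apply: f_comm => [|a]; [exact: pvarC | rewrite lmul_X].
Qed.

(** Natural number indices allow [conjf] to be a structural recursion; the value 1 is a filler
    outside the range. [conjf m] is the F_(m+1) of the overview, since positions are counted from 0
    here. *)
Definition T_at m : E := if insub m is Some i then T i else 1.

Lemma T_atE i : T_at i = T i.
Proof. by rewrite /T_at valK. Qed.

Fixpoint conjf m : E := if m is m'.+1 then T_at m' * conjf m' * T_at m' else f.

Lemma conjfS m : conjf m.+1 = T_at m * conjf m * T_at m. Proof. by []. Qed.

Lemma conjf_next i : conjf i.+1 = T i * conjf i * T i.
Proof. by rewrite conjfS T_atE. Qed.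

Lemma conjf_A m a : (m < n)%N -> conjf m * lA a = lA a * conjf m.
Proof.
move=> lt; move: m lt a; apply: ltn_ord_ind => [|i IH] a; first exact: f_A.
by rewrite conjf_next -(mulrA (T i * conjf i)) T_slide mulrA -(mulrA (T i)) IH
  mulrA T_slide swK !mulrA.
Qed.

(** As for Jucys-Murphy elements: T_j moves through the outer factors as long as the indices are far
    apart, and when the outermost factor is T_(j+1) two braid relations move T_j across, T_(j+1)
    commuting with [conjf j] by induction. *)
Lemma conjf_T m j : (m < n)%N -> m != j :> nat -> m != j.+1 :> nat ->
  T j * conjf m = conjf m * T j.
Proof.
have [k] := ubnP m; elim: k m j => // k IH [|m] j lt ltn mj mj1.
  by apply: f_T; rewrite lt0n eq_sym.
have lt' : (m < n.-1)%N by lia.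
pose i : 'I_n.-1 := Ordinal lt'; rewrite -[m]/(i : nat) conjf_next.
have [mj2|mj2] := eqVneq m j.+1; last first.
  have ij : (i.+1 < j)%N || (j.+1 < i)%N by rewrite /=; lia.
  have Tij := T_comm ij.
  have TF : T j * conjf i = conjf i * T j by apply: IH => //=; lia.
  by rewrite !mulrA -Tij -(mulrA (T i)) TF mulrA -!(mulrA (T i * conjf i)) -Tij.
have ij : i = j.+1 :> nat by [].
have Fm : conjf i = T j * conjf j * T j by rewrite ij conjf_next.
have ijF : T i * conjf j = conjf j * T i.
  have ltj := ltn_ord j; have E1 : m = j.+1 by [].
  by apply: (IH j i); rewrite ?ij; lia.
have br := T_braid ij.
rewrite Fm; have -> : T j * (T i * (T j * conjf j * T j) * T i) =
    (T j * T i * T j) * (conjf j * (T j * T i)) by rewrite !mulrA.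
have -> : T i * (T j * conjf j * T j) * T i * T j =
    (T i * T j * conjf j) * (T j * T i * T j) by rewrite !mulrA.
by rewrite br -[LHS]mulrA (mulrA (T i) (conjf j)) ijF !mulrA.
Qed.

Lemma T_shift i mu : mu (lo i) = 0%N -> mu (hi i) = 0%N ->
  T i * shift mu = shift mu * T i.
Proof.
elim/expo_ind: mu => [_ _|l mu IH]; first by rewrite shift0 mulr1 mul1r.
rewrite !ffunE; case: eqVneq => [_|ll]; first by rewrite addn1.
case: eqVneq => [_|lh]; first by rewrite addn1.
rewrite !addn0 => m0 m0'; have TX : T i * X l = X l * T i by apply: T_X;
  rewrite eq_sym.
by rewrite -shiftM -pvarE mulrA IH // -[LHS]mulrA TX mulrA.
Qed.

(** Each further X_lo comes out as X_hi and leaves an error q X_lo^(e+1), free of X_hi. The exponent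
    is positive on purpose: at exponent 0 the coefficient is T_i h and not (T_i - q) h. *)
Lemma T_pow i e h : supported (lower_deg (hi i) e.+1)
  (T i ((X (lo i) ^+ e.+1) (pconst n h)) -
   (X (hi i) ^+ e.+1) ((T i - lq i) (pconst n h))).
Proof.
elim: e => [|e IH].
  by rewrite !expr1 -!lendME T_Xlo subrr; apply: supported0.
rewrite ![_ ^+ e.+2]exprS !lendME -(lendME (T i)) T_Xlo lendME -lend_sub.
rewrite lendBE addrAC; apply: (@supported_X _ _ _ _ (lower_deg (hi i) e.+1)).
  move=> lam [le l0]; split=> [|l hl].
    by rewrite !ffunE eqxx addn1.
  rewrite !ffunE l0 // -val_eqE gtn_eqF //.
apply: supportedB; first exact: IH.
apply: supported_lmul; rewrite Xn_pconst; apply: supported_mon; split=> [|l hl].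
  by rewrite ffunE eq_sym (negPf (lo_neq_hi i)).
by rewrite ffunE -val_eqE gtn_eqF // (ltn_trans _ hl).
Qed.

Lemma T_Tq i h : (T i - lq i) (pconst n (hT i * h)) = pconst n h.
Proof. by rewrite -T_pconst -lendME (quadVl (T_quad i)). Qed.

Lemma T_lower i x :
  supported (lower_deg (lo i) d) x -> supported (lower_deg (hi i) d) (T i x).
Proof.
apply: supported_map => lam h [le l0]; rewrite (mon_split (lo i)).
set mu := expo_clear _ _.
have mu0 l : (i <= l)%N -> mu l = 0%N.
  rewrite leq_eqVlt ffunE => /orP[/eqP il|il]; last by rewrite l0 // if_same.
  by rewrite -val_eqE /= il eqxx.
rewrite -(lendME (T i)) T_shift ?mu0 // lendME.
apply: (@supported_shift _ _ _ _ (lower_deg (hi i) d)) => [nu [nd n0]|].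
  split=> [|l hl]; first by rewrite ffunE mu0 // addn0.
  by rewrite ffunE n0 // mu0 // ltnW // ltnW.
case: (lam (lo i)) le => [|e] le.
  rewrite expr0 T_pconst; apply: supported_mon; split=> [|l _];
    rewrite ffunE //.
rewrite -[T i _](subrK ((X (hi i) ^+ e.+1) ((T i - lq i) (pconst n h)))).
apply: supportedD.
  apply: (supportedW _ (@T_pow i e h)) => nu [nd n0]; split=> //.
  exact: ltn_trans nd le.
rewrite lendBE T_pconst lmul_pconst -linearB Xn_pconst; apply: supported_mon.
split=> [|l hl]; first by rewrite ffunE eqxx mul1n.
by rewrite ffunE -val_eqE gtn_eqF.
Qed.

(** The right factor T_i of F turns h into T_i h, and moving the left one past X_lo^d applies its
    inverse to the coefficient, so the leading coefficient is h again. *)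
Lemma conjf_lead p h :
  supported (lower_deg p d) (conjf p (pconst n h) - mon (top_expo p) h).
Proof.
suff HH : forall m, (m < n)%N -> forall p : 'I_n, p = m :> nat -> forall h,
    supported (lower_deg p d) (conjf p (pconst n h) - mon (top_expo p) h).
  exact: (HH p (ltn_ord p)).
apply: ltn_ord_ind => [q q0|i IH q qi] {}h.
  have -> : q = i1 by apply: val_inj; rewrite /= q0 i1_0.
  by rewrite i1_0; apply: f_lead.
have -> : q = hi i by apply: val_inj.
have /(_ (hT i * h)) IHi := IH (lo i) erefl.
have FE : conjf (hi i) (pconst n h) = T i (conjf (lo i) (pconst n (hT i * h))).
  by rewrite [conjf _]conjf_next !lendME T_pconst.
rewrite FE -[conjf (lo i) _](subrK (mon (top_expo (lo i)) (hT i * h))) lend_add.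
rewrite -addrA; apply: supportedD; first exact: T_lower.
have [d' dd] : exists d', d = d'.+1 by exists d.-1; rewrite prednK.
have := @T_pow i d' (hT i * h); rewrite T_Tq !Xn_pconst -dd.
exact.
Qed.

(** The multiples of the first m of the F's: stage n is the L of the overview, stage 0 is zero, and
    each division goes down one stage. Scalars can be absorbed into h. *)
Inductive cycIdeal m : M -> Prop :=
| cycIdeal_conjf (p : 'I_n) h of (p < m)%N : cycIdeal m (conjf p (pconst n h))
| cycIdeal0 : cycIdeal m 0
| cycIdealD x y of cycIdeal m x & cycIdeal m y : cycIdeal m (x + y)
| cycIdealX l x of cycIdeal m x : cycIdeal m (X l x).

Lemma cycIdealW m m' x : (m <= m')%N -> cycIdeal m x -> cycIdeal m' x.
Proof.
move=> le; elim=> {x} [p h lt||x y _ Lx _ Ly|l x _ Lx].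
- by apply: cycIdeal_conjf; apply: leq_trans le.
- exact: cycIdeal0.
- exact: cycIdealD.
- exact: cycIdealX.
Qed.

Lemma cycIdealZ m c x : cycIdeal m x -> cycIdeal m (c *: x).
Proof.
elim=> {x} [p h lt||x y _ Lx _ Ly|l x _ Lx].
- by rewrite -lend_scale -linearZ; apply: cycIdeal_conjf.
- by rewrite scaler0; apply: cycIdeal0.
- by rewrite scalerDr; apply: cycIdealD.
- by rewrite -lend_scale; apply: cycIdealX.
Qed.

Lemma cycIdealN m x : cycIdeal m x -> cycIdeal m (- x).
Proof. by rewrite -scaleN1r; apply: cycIdealZ. Qed.

Lemma cycIdealB m x y : cycIdeal m x -> cycIdeal m y -> cycIdeal m (x - y).
Proof. by move=> Lx Ly; apply: cycIdealD => //; apply: cycIdealN. Qed.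

Lemma cycIdeal_shift m mu x : cycIdeal m x -> cycIdeal m (shift mu x).
Proof.
move=> Lx; elim/expo_ind: mu => [|l mu IH]; first by rewrite shift0.
by rewrite expo_addC -shiftM lendME -pvarE; apply: cycIdealX.
Qed.

Lemma cycIdeal_A m a x : cycIdeal m x -> cycIdeal m (lA a x).
Proof.
elim=> {x} [p h lt||x y _ Lx _ Ly|l x _ Lx].
- by rewrite -lendME -conjf_A // lendME lmul_pconst; apply: cycIdeal_conjf.
- by rewrite lend_zero; apply: cycIdeal0.
- by rewrite lend_add; apply: cycIdealD.
- by rewrite -lendME lmul_X lendME; apply: cycIdealX.
Qed.

(** Write F_j for [conjf j]. Then T_j F_j = F_(j+1) (T_j - q) and T_j F_(j+1) = q F_(j+1) + F_j T_j,
    so T_j mixes only these two generators; the bound on j keeps both inside the stage. *)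
Lemma cycIdeal_T m j x : (j.+1 < m)%N -> cycIdeal m x -> cycIdeal m (T j x).
Proof.
move=> jm; elim=> {x} [p h lt||x y _ Lx _ Ly|l x Lx LTx].
- have [pj1|pj1] := eqVneq (p : nat) j.+1.
    have TF : T j * conjf j.+1 = lq j * conjf j.+1 + conjf j * T j.
      by rewrite conjf_next !mulrA (T_quad j).1 !mulrDl mul1r.
    rewrite pj1 -lendME TF lendDE !lendME T_pconst; apply: cycIdealD.
      by apply: cycIdeal_A; apply: (@cycIdeal_conjf m (hi j)).
    by apply: (@cycIdeal_conjf m (lo j)); apply: ltn_trans jm.
  have [pj|pj] := eqVneq (p : nat) j.
    have -> : T j (conjf p (pconst n h)) =
      conjf (hi j) ((T j - lq j) (pconst n h)).
      rewrite -!lendME conjf_next -!mulrA (quadVr (T_quad j)) mulr1.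
      by rewrite pj.
    by rewrite lendBE T_pconst lmul_pconst -linearB; apply: cycIdeal_conjf.
  by rewrite -lendME conjf_T // lendME T_pconst; apply: cycIdeal_conjf.
- by rewrite lend_zero; apply: cycIdeal0.
- by rewrite lend_add; apply: cycIdealD.
rewrite -lendME; have [->|ll] := eqVneq l (lo j).
  by rewrite T_Xlo lendME lendBE; apply/cycIdealX/cycIdealB => //;
    apply: cycIdeal_A.
have [->|lh] := eqVneq l (hi j); last by rewrite T_X // lendME;
  apply: cycIdealX.
by rewrite T_Xhi lendDE !lendME; apply: cycIdealD; [|apply: cycIdeal_A];
  apply: cycIdealX.
Qed.

Lemma cycIdeal_f m x : (0 < m)%N -> cycIdeal m (f x).
Proof.
move=> m0; elim/pmodX_ind: x => [|x y Lx Ly|h|l x Lx].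
- by rewrite lend_zero; apply: cycIdeal0.
- by rewrite lend_add; apply: cycIdealD.
- have := @cycIdeal_conjf m i1 h; rewrite i1_0; exact.
- by rewrite -lendME f_X lendME; apply: cycIdealX.
Qed.

(* The same submodule, generated without the variable X_p: this presentation is
   visibly stable under operators that do not commute with X_p. *)
Inductive altIdeal (p : 'I_n) : M -> Prop :=
| altIdealf x of (0 < p)%N : altIdeal p (f x)
| altIdeal0 : altIdeal p 0
| altIdealD x y of altIdeal p x & altIdeal p y : altIdeal p (x + y)
| altIdealX l x of l != p & altIdeal p x : altIdeal p (X l x)
| altIdealT j x of (j.+1 < p)%N & altIdeal p x : altIdeal p (T j x).

Lemma altIdeal_conjf p m x : (m < p)%N -> altIdeal p (conjf m x).
Proof.
move=> lt; have ltn := ltn_trans lt (ltn_ord p); move: m ltn lt x.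
apply: (@ltn_ord_ind n (fun m => (m < p)%N ->
  forall x, altIdeal p (conjf m x))).
  by move=> p0 x; apply: altIdealf.
move=> i IH lt x; rewrite conjf_next !lendME; apply: altIdealT => //.
exact: IH (ltnW lt) _.
Qed.

(** X_p commutes with f, with the variables, and with every T_j allowed in [altIdeal], so closure
    under X_p comes for free. *)
Lemma altIdeal_Xp p x : altIdeal p x -> altIdeal p (X p x).
Proof.
elim=> {x} [x p0||x y _ Ux _ Uy|l x lp _ Ux|j x jp _ Ux].
- by rewrite -lendME -f_X lendME; apply: altIdealf.
- by rewrite lend_zero; apply: altIdeal0.
- by rewrite lend_add; apply: altIdealD.
- by rewrite -lendME pvarC lendME; apply: altIdealX.
have TX : T j * X p = X p * T j by apply: T_X; rewrite -val_eqE /=; lia.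
by rewrite -lendME -TX lendME; apply: altIdealT.
Qed.

Lemma cycIdeal_altIdeal p x : cycIdeal p x -> altIdeal p x.
Proof.
elim=> {x} [p' h lt||x y _ Ux _ Uy|l x _ Ux].
- exact: altIdeal_conjf.
- exact: altIdeal0.
- exact: altIdealD.
- by have [->|lp] := eqVneq l p; [apply: altIdeal_Xp | apply: altIdealX].
Qed.

(** * Division by a single F_p *)

Section Position.
Variable p : 'I_n.

(* On polynomials of degree less than d in X_p, [companion] is multiplication by
   X_p followed by reduction modulo F_p, [overflow] being the multiple of F_p
   that is subtracted; [rem_op] substitutes [companion] for X_p, which computes
   the remainder of the division by F_p. *)
Fact overflow_subproof lam : linear (fun h =>
  if (lam p).+1 == d then shift (expo_clear p lam) (conjf p (pconst n h))
  else 0).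
Proof.
move=> c h h'; case: eqP => _; last by rewrite scaler0 addr0.
by rewrite linearP lend_add lend_scale lend_add lend_scale.
Qed.
Definition overflow : E := plend overflow_subproof.
Definition companion : E := X p - overflow.

Lemma overflow_mon lam h : overflow (mon lam h) =
  if (lam p).+1 == d then shift (expo_clear p lam) (conjf p (pconst n h))
  else 0.
Proof. exact: plend_mon. Qed.

Lemma overflow_cycIdeal x : cycIdeal p.+1 (overflow x).
Proof.
elim/pmod_ind: x => [|x y Lx Ly|lam h].
- by rewrite lend_zero; apply: cycIdeal0.
- by rewrite lend_add; apply: cycIdealD.
rewrite overflow_mon; case: eqP => _; last exact: cycIdeal0.
by apply: cycIdeal_shift; apply: cycIdeal_conjf.
Qed.

Lemma overflow_shift mu : mu p = 0%N ->
  overflow * shift mu = shift mu * overflow.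
Proof.
move=> mup; apply: plendP => lam h; rewrite !lendME shift_mon !overflow_mon.
rewrite !ffunE mup addn0; case: eqP => _; last by rewrite lend_zero.
rewrite -[RHS]lendME shiftM; congr (lend_fun (shift _) _); apply/ffunP => l;
  rewrite !ffunE.
by case: eqP => [->|_]; rewrite ?mup // addnC.
Qed.

Lemma overflow_X l : l != p -> overflow * X l = X l * overflow.
Proof.
by move=> lp; rewrite pvarE overflow_shift // ffunE eq_sym (negPf lp).
Qed.

Lemma overflow_A a : overflow * lA a = lA a * overflow.
Proof.
apply: plendP => lam h; rewrite !lendME lmul_mon !overflow_mon.
case: eqP => _; last by rewrite lend_zero.
by rewrite lmul_shiftE -(lendME (lA a)) -conjf_A // lendME lmul_pconst.
Qed.

(** Powers of X_p belong to the base case because [overflow] can be moved past every variable but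
    X_p. *)
Lemma pmodXp_ind (P : M -> Prop) :
    P 0 -> (forall x y, P x -> P y -> P (x + y)) ->
    (forall e h, P ((X p ^+ e) (pconst n h))) ->
    (forall l x, l != p -> P x -> P (X l x)) -> forall x, P x.
Proof.
move=> P0 PD Pe PX; apply: pmod_ind => // lam h.
pose mu := expo_clear p lam.
rewrite (mon_split p) -/mu; have : mu p = 0%N by rewrite ffunE eqxx.
move: mu; elim/expo_ind => [|l mu IH]; first by rewrite shift0 => _; apply: Pe.
rewrite !ffunE; case: eqVneq => [_|lp]; first by rewrite addn1.
rewrite addn0 => mup; rewrite expo_addC -shiftM lendME -pvarE.
by apply: PX; [rewrite eq_sym | apply: IH].
Qed.

(** The commutator propagates along the variables other than X_p, which leaves X_p^e h. There T_j
    commutes with X_p and with F_p, as j and j + 1 are both less than p. *)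
Lemma overflow_T j : (j.+1 < p)%N -> overflow * T j = T j * overflow.
Proof.
move=> jp; pose D := overflow * T j - T j * overflow.
suff : D = 0 by move/eqP; rewrite subr_eq0 => /eqP.
have lop : lo j != p by rewrite -val_eqE /=; lia.
have hip : hi j != p by rewrite -val_eqE /=; lia.
have Dlo : D * X (lo j) = X (hi j) * D.
  rewrite /D mulrBl -!mulrA T_Xlo overflow_X // !mulrA overflow_X // T_Xlo
    -!mulrA -mulrBr.
  by congr (_ * _); rewrite mulrBr mulrBl overflow_A opprB addrA subrK.
have Dhi : D * X (hi j) = X (lo j) * D.
  rewrite /D mulrBl -!mulrA T_Xhi overflow_X // !mulrA T_Xhi mulrDr mulrDl.
  rewrite !mulrA overflow_X // overflow_A -!(mulrA (lq j)) overflow_X // !mulrA.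
  by rewrite opprD addrACA subrr addr0 -!mulrA -mulrBr.
have DX l : l != lo j -> l != hi j -> l != p -> D * X l = X l * D.
  move=> ll lh lp; have TX := T_X ll lh; have eX := overflow_X lp.
  by rewrite /D mulrBl -!mulrA TX eX !mulrA eX TX -!mulrA -mulrBr.
apply: lend_eq0; apply: pmodXp_ind => [|x y Dx Dy|e h|l x lp Dx].
- exact: lend_zero.
- by rewrite lend_add Dx Dy addr0.
- have TX : T j * X p = X p * T j by apply: T_X; rewrite eq_sym.
  have TXe : T j * X p ^+ e = X p ^+ e * T j.
    by apply: commrX; apply: TX.
  rewrite /D lendBE !lendME -(lendME (T j) (X p ^+ e)) TXe lendME T_pconst
    !Xn_pconst.
  rewrite !overflow_mon !ffunE eqxx mul1n; case: eqP => _;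
    last by rewrite lend_zero subrr.
  have -> : expo_clear p [ffun l => ((l == p) * e)%N] = expo0.
    by apply/ffunP => l; rewrite !ffunE; case: eqP.
  rewrite shift0 !lend1E -[T j _]lendME conjf_T ?lendME ?T_pconst ?subrr //;
    lia.
rewrite -lendME; have [E|ll] := eqVneq l (lo j).
  by rewrite E Dlo lendME Dx lend_zero.
have [E|lh] := eqVneq l (hi j); first by rewrite E Dhi lendME Dx lend_zero.
by rewrite DX // lendME Dx lend_zero.
Qed.

Lemma overflow_f : (0 < p)%N -> overflow * f = f * overflow.
Proof.
move=> p0; apply: f_comm; last exact: overflow_A.
by apply: overflow_X; rewrite -val_eqE /= i1_0; lia.
Qed.

(** The purpose of [altIdeal]: [overflow] commutes with every operator generating it, so its action
    can be pushed down to f. *)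
Lemma overflow_cycIdeal_stable x : cycIdeal p x -> cycIdeal p (overflow x).
Proof.
move=> /cycIdeal_altIdeal; elim=> {x} [x p0||x y _ Lx _ Ly|l x lp _ Lx|j x jp _
  Lx].
- by rewrite -lendME overflow_f // lendME; apply: cycIdeal_f.
- by rewrite lend_zero; apply: cycIdeal0.
- by rewrite lend_add; apply: cycIdealD.
- by rewrite -lendME overflow_X // lendME; apply: cycIdealX.
- by rewrite -lendME overflow_T // lendME; apply: cycIdeal_T.
Qed.

Fact rem_op_subproof lam : linear (fun h =>
  shift (expo_clear p lam) ((companion ^+ lam p) (pconst n h))).
Proof.
by move=> c h h'; rewrite linearP !lend_add !lend_scale.
Qed.
Definition rem_op : E := plend rem_op_subproof.

Lemma rem_op_mon lam h :
  rem_op (mon lam h) = shift (expo_clear p lam)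
    ((companion ^+ lam p) (pconst n h)).
Proof. exact: plend_mon. Qed.

Lemma companion_shift mu : mu p = 0%N ->
  companion * shift mu = shift mu * companion.
Proof.
by move=> mup; rewrite /companion mulrBl mulrBr X_shift overflow_shift.
Qed.

Lemma rem_op_X l : l != p -> rem_op * X l = X l * rem_op.
Proof.
move=> lp; apply: plendP => lam h; rewrite !lendME pvar_mon !rem_op_mon.
have -> : expo_add lam (expo1 l) p = lam p.
  by rewrite !ffunE eq_sym (negPf lp) addn0.
rewrite -[RHS]lendME pvarE shiftM; congr (lend_fun (shift _) _).
apply/ffunP => i; rewrite !ffunE; case: eqP => [->|_]; last by rewrite addnC.
by rewrite eq_sym (negPf lp).
Qed.

Lemma rem_op_Xp : rem_op * X p = companion * rem_op.
Proof.
apply: plendP => lam h; rewrite !lendME pvar_mon !rem_op_mon.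
rewrite -[RHS]lendME companion_shift; last by rewrite ffunE eqxx.
rewrite [RHS]lendME -(lendME companion) -exprS.
have -> : expo_add lam (expo1 p) p = (lam p).+1 by rewrite !ffunE eqxx addn1.
congr (lend_fun (shift _) _); apply/ffunP => i; rewrite !ffunE.
by case: eqP => // _; rewrite addn0.
Qed.

Lemma companion_pow e h : (e < d)%N -> (companion ^+ e) (pconst n h) =
  (X p ^+ e) (pconst n h).
Proof.
elim: e => [|e IH] lt; first by rewrite !expr0.
rewrite !exprS !lendME IH ?(ltnW lt) // /companion lendBE Xn_pconst
  overflow_mon.
by rewrite !ffunE eqxx mul1n ltn_eqF // subr0.
Qed.

Lemma rem_op_id x : supported (fun lam => (lam p < d)%N) x -> rem_op x = x.
Proof.
elim/supported_ind=> [|{}x y ex ey|lam h lt].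
- exact: lend_zero.
- by rewrite lend_add ex ey.
by rewrite rem_op_mon companion_pow // -mon_split.
Qed.

(** The lower terms of F_p h are their own remainder. The leading term X_p^d h has remainder
    [companion] of X_p^(d-1) h, namely X_p^d h - F_p h, and the sum is 0. *)
Lemma rem_op_conjf h : rem_op (conjf p (pconst n h)) = 0.
Proof.
rewrite -[conjf p _](subrK (mon (top_expo p) h)) lend_add rem_op_id; last first.
  by apply: (supportedW _ (conjf_lead h)) => lam [].
have -> : rem_op (mon (top_expo p) h) = mon (top_expo p) h - conjf p
  (pconst n h).
  rewrite rem_op_mon !ffunE eqxx mul1n.
  have -> : expo_clear p (top_expo p) = expo0.
    by apply/ffunP => l; rewrite !ffunE; case: eqP.
  have [d' dd] : exists d', d = d'.+1 by exists d.-1; rewrite prednK.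
  rewrite shift0 lend1E {1}dd exprS lendME companion_pow ?dd // /companion
    lendBE.
  rewrite -(lendME (X p)) -exprS -dd !Xn_pconst overflow_mon !ffunE eqxx mul1n
    -dd eqxx.
  congr (_ - _); suff -> : expo_clear p [ffun i => ((i == p) * d')%N] = expo0.
    by rewrite shift0.
  by apply/ffunP => l; rewrite !ffunE; case: eqP.
by rewrite addrA subrK subrr.
Qed.

(** F_p itself has remainder 0, and the earlier generators do not involve X_p, hence are fixed.
    Multiplication by X_p becomes X_p - [overflow], and both terms preserve the smaller stage. *)
Lemma rem_op_cycIdeal x : cycIdeal p.+1 x -> cycIdeal p (rem_op x).
Proof.
elim=> {x} [p' h||x y _ Lx _ Ly|l x _ Lx].
- rewrite ltnS leq_eqVlt => /orP[/eqP/val_inj->|lt];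
    first by rewrite rem_op_conjf; apply: cycIdeal0.
  rewrite rem_op_id; first exact: cycIdeal_conjf.
  rewrite -[conjf p' _](subrK (mon (top_expo p') h)); apply: supportedD.
    by apply: (supportedW _ (conjf_lead h)) => lam [_ -> //].
  by apply: supported_mon; rewrite ffunE -val_eqE gtn_eqF.
- by rewrite lend_zero; apply: cycIdeal0.
- by rewrite lend_add; apply: cycIdealD.
rewrite -lendME; have [->|lp] := eqVneq l p; last first.
  by rewrite rem_op_X // lendME; apply: cycIdealX.
rewrite rem_op_Xp lendME lendBE; apply: cycIdealB; first exact: cycIdealX.
exact: overflow_cycIdeal_stable.
Qed.

Lemma rem_op_sub x : cycIdeal p.+1 (rem_op x - x).
Proof.
elim/pmodX_ind: x => [|x y Lx Ly|h|l x Lx].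
- by rewrite lend_zero subrr; apply: cycIdeal0.
- by rewrite lend_add opprD addrACA; apply: cycIdealD.
- rewrite rem_op_id ?subrr; first exact: cycIdeal0.
  by apply: supported_mon; rewrite ffunE.
rewrite -lendME; have [->|lp] := eqVneq l p; last first.
  by rewrite rem_op_X // lendME -lend_sub; apply: cycIdealX.
rewrite rem_op_Xp lendME lendBE addrAC -lend_sub; apply: cycIdealB;
  first exact: cycIdealX.
exact: overflow_cycIdeal.
Qed.

Definition reduced_from m lam := forall l, (m <= l)%N -> (lam l < d)%N.

Lemma companion_lower x : supported (lower_deg p d) x ->
  supported (lower_deg p d) (companion x).
Proof.
apply: supported_map => lam h [lt l0]; rewrite lendBE pvar_mon overflow_mon.
set nu := expo_add _ _.
have nu0 l : (p < l)%N -> nu l = 0%N.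
  by move=> pl; rewrite !ffunE l0 // -val_eqE gtn_eqF.
have nup : nu p = (lam p).+1 by rewrite !ffunE eqxx addn1.
case: eqP => [E|/eqP ne]; last first.
  rewrite subr0; apply: supported_mon; split; last exact: nu0.
  by rewrite nup ltn_neqAle ne.
have -> : mon nu h = shift (expo_clear p lam) (mon (top_expo p) h).
  rewrite shift_mon; congr mon; apply/ffunP => l; rewrite !ffunE.
  by case: eqP => [->|_]; rewrite ?eqxx ?mul1n ?addn0 ?add0n // addn1 E.
rewrite -lend_sub -opprB lend_opp; apply: supportedN.
apply: (supported_shift _ (conjf_lead h)) => mu [m1 m2]; split=> [|l pl].
  by rewrite !ffunE eqxx addn0.
by rewrite !ffunE m2 // l0 // if_same.
Qed.

(** F_p involves no variable beyond X_p, so dividing by it does not raise the degrees already made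
    small. *)
Lemma rem_op_reduced x :
  supported (reduced_from p.+1) x -> supported (reduced_from p) (rem_op x).
Proof.
apply: supported_map => lam h lt; rewrite rem_op_mon.
apply: (@supported_shift _ _ _ _ (lower_deg p d)) => [mu [m1 m2] l|].
  rewrite leq_eqVlt !ffunE => /orP[/eqP/val_inj<-|pl];
    first by rewrite eqxx addn0.
  by rewrite m2 // -val_eqE gtn_eqF // lt.
elim: (lam p) => [|e IH].
  by rewrite expr0 lend1E; apply: supported_mon; split=> [|l]; rewrite ffunE.
by rewrite exprS lendME; apply: companion_lower.
Qed.

End Position.

(** Products are compositions, so the last variable is divided first. By the lemmas below, at m = n
    this is the projection onto the reduced polynomials with kernel L. *)
Definition full_rem m : E :=
  iteri m (fun k g => if insub k is Some p then g * rem_op p else g) 1.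

Lemma full_remS p : full_rem p.+1 = full_rem p * rem_op p.
Proof. by rewrite /full_rem /= valK. Qed.

Lemma full_rem_ind (P : nat -> Prop) : P 0%N ->
  (forall p : 'I_n, P p -> P p.+1) ->
  forall m, (m <= n)%N -> P m.
Proof.
move=> P0 PS; elim=> // m IH lt; exact: (PS (Ordinal lt) (IH (ltnW lt))).
Qed.

Lemma cycIdeal_0 x : cycIdeal 0 x -> x = 0.
Proof.
by elim=> {x} // [x y _ -> _ ->|l x _ ->]; rewrite ?addr0 ?lend_zero.
Qed.

Lemma full_rem_cycIdeal x : cycIdeal n x -> full_rem n x = 0.
Proof.
suff HH : forall m, (m <= n)%N -> forall x, cycIdeal m x -> full_rem m x = 0
  by apply: HH.
apply: full_rem_ind => [y /cycIdeal_0 ->|p IH y Ly]; first exact: lend_zero.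
by rewrite full_remS lendME IH //; apply: rem_op_cycIdeal.
Qed.

Lemma full_rem_id x : supported (reduced_from 0) x -> full_rem n x = x.
Proof.
move=> sx; suff HH : forall m, (m <= n)%N -> full_rem m x = x by apply: HH.
apply: full_rem_ind => [//|p IH]; rewrite full_remS lendME rem_op_id //.
by apply: (supportedW _ sx) => lam; apply.
Qed.

Lemma full_rem_sub x : cycIdeal n (full_rem n x - x).
Proof.
suff HH : forall m, (m <= n)%N -> forall x, cycIdeal m (full_rem m x - x)
  by apply: HH.
apply: full_rem_ind => [y|p IH y]; first by rewrite lend1E subrr;
  apply: cycIdeal0.
rewrite full_remS lendME -(subrK (rem_op p y) (full_rem p _)) -addrA.
by apply: cycIdealD; [apply: cycIdealW (IH _) | apply: rem_op_sub].
Qed.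

Lemma full_rem_reduced x : supported (reduced_from 0) (full_rem n x).
Proof.
suff HH : forall m, (m <= n)%N -> forall x, supported (reduced_from m) x ->
    supported (reduced_from 0) (full_rem m x).
  by apply: (HH n) => // lam []; move=> l; rewrite leqNgt ltn_ord.
apply: full_rem_ind => [y //|p IH y sy].
by rewrite full_remS lendME; apply/IH/rem_op_reduced.
Qed.

End CyclotomicReduction.

(** * The cyclotomic quotient module *)

Section CyclotomicModule.
Variables (R : comNzRingType) (n : nat) (H : pzAlgType R) (S : Type).
Variables (hA : S -> H) (hT : 'I_n.-1 -> H) (sw : 'I_n.-1 -> S -> S).
Variable (qq : 'I_n.-1 -> S).
Local Notation q i := (hA (qq i)).
Implicit Types (i j : 'I_n.-1) (l p : 'I_n) (h : H) (lam mu : expo n).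
Hypothesis h_quad : forall i, quad (hT i) (q i).
Hypothesis h_comm : forall i j, (i.+1 < j)%N || (j.+1 < i)%N ->
  hT i * hT j = hT j * hT i.
Hypothesis h_braid : forall i j, j = i.+1 :> nat ->
  hT i * hT j * hT i = hT j * hT i * hT j.
Hypothesis h_slide : forall i a, hT i * hA a = hA (sw i a) * hT i.
Hypothesis q_slide : forall i a, hA (sw i a) * q i = q i * hA a.
Hypothesis swK : forall i, involutive (sw i).
Hypothesis qq_far : forall i j, (i.+1 < j)%N || (j.+1 < i)%N ->
  sw i (qq j) = qq j.
Hypothesis qq_braid : forall i j, j = i.+1 :> nat -> sw i (qq j) = sw j (qq i).

Variables (i1 : 'I_n) (d : nat) (coef : 'I_d -> S) (ainv : S).
Hypothesis i1_0 : i1 = 0%N :> nat.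
Hypothesis d_gt0 : (0 < d)%N.
Hypothesis coef_central : forall m a, hA (coef m) * hA a = hA a * hA (coef m).
Hypothesis coef_fixed : forall i m, (0 < i)%N -> sw i (coef m) = coef m.
Hypothesis ainv_coef0 : hA ainv * hA (coef (Ordinal d_gt0)) = 1.

Local Notation M := (pmod n H).
Local Notation E := (lend M).
Local Notation X := (@pvar R n H).
Local Notation lA a := (lmul n (hA a)).
Local Notation T := (aT hA hT qq).

Let T_pconst i h : T i (pconst n h) = pconst n (hT i * h).
Proof. exact: aT_pconst. Qed.
Let T_Xlo i : T i * X (lo i) = X (hi i) * (T i - lA (qq i)).
Proof. exact: aT_Xlo. Qed.
Let T_Xhi i : T i * X (hi i) = X (lo i) * T i + lA (qq i) * X (hi i).
Proof. exact: aT_Xhi. Qed.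
Let T_X i l : l != lo i -> l != hi i -> T i * X l = X l * T i.
Proof. exact: aT_X. Qed.
Let T_slide i a : T i * lA a = lA (sw i a) * T i.
Proof. exact: (aT_slide h_slide q_slide). Qed.
Let T_quad i : quad (T i) (lA (qq i)).
Proof. exact: (aT_quad h_quad h_slide q_slide). Qed.
Let T_comm i j : (i.+1 < j)%N || (j.+1 < i)%N -> T i * T j = T j * T i.
Proof. exact: (aT_comm h_quad h_comm h_slide q_slide qq_far). Qed.
Let T_braid i j : j = i.+1 :> nat -> T i * T j * T i = T j * T i * T j.
Proof. exact: (aT_braid h_quad h_braid h_slide q_slide swK qq_braid). Qed.

Definition cyc_op : E := X i1 ^+ d + \sum_(m < d) lA (coef m) * X i1 ^+ m.
Local Notation f := cyc_op.

Lemma cyc_op_A a : f * lA a = lA a * f.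
Proof.
have XA : X i1 * lA a = lA a * X i1 by rewrite lmul_X.
have XAm m : X i1 ^+ m * lA a = lA a * X i1 ^+ m.
  by apply: esym; apply: commrX; apply: esym.
rewrite mulrDl mulrDr XAm; congr (_ + _).
rewrite mulr_suml mulr_sumr; apply: eq_bigr => m _.
by rewrite -mulrA XAm !mulrA -!lmulM coef_central.
Qed.

Lemma cyc_op_comm (g : E) : g * X i1 = X i1 * g ->
  (forall a, g * lA a = lA a * g) -> g * f = f * g.
Proof.
move=> gX gA; have gXm m : g * X i1 ^+ m = X i1 ^+ m * g by apply: commrX.
rewrite mulrDl mulrDr gXm; congr (_ + _).
rewrite mulr_suml mulr_sumr; apply: eq_bigr => m _.
by rewrite mulrA gA -!mulrA gXm.
Qed.

Lemma cyc_op_T i : (0 < i)%N -> T i * f = f * T i.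
Proof.
move=> i0; have TX : T i * X i1 = X i1 * T i.
  by apply: T_X; rewrite -val_eqE /= i1_0; lia.
have TXm m : T i * X i1 ^+ m = X i1 ^+ m * T i by apply: commrX.
rewrite mulrDl mulrDr TXm; congr (_ + _).
rewrite mulr_suml mulr_sumr; apply: eq_bigr => m _.
by rewrite mulrA T_slide coef_fixed // -!mulrA TXm.
Qed.

Lemma cyc_op_lead h :
  supported (lower_deg i1 d) (f (pconst n h) - mon (top_expo d i1) h).
Proof.
rewrite lendDE Xn_pconst addrAC subrr add0r lend_sumE.
elim/big_rec: _ => [|m x _ sx]; first exact: supported0.
apply: supportedD => //; rewrite lendME; apply: supported_lmul.
rewrite Xn_pconst; apply: supported_mon; split=> [|l lp].
  by rewrite ffunE eqxx mul1n.
by rewrite ffunE -val_eqE gtn_eqF.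
Qed.

Local Notation L := (cycIdeal T f n).

Lemma ideal_T i x : L x -> L (T i x).
Proof.
apply: (cycIdeal_T swK T_pconst T_Xlo T_Xhi T_X T_slide T_quad T_comm T_braid
          i1_0 d_gt0 cyc_op_A cyc_op_T).
by have := ltn_ord i; lia.
Qed.

Lemma ideal_A a x : L x -> L (lA a x).
Proof. exact: (cycIdeal_A swK T_slide cyc_op_A). Qed.

Lemma ideal_X l x : L x -> L (X l x).
Proof. exact: cycIdealX. Qed.

Lemma ideal_cyc_op x : L (f x).
Proof.
apply: (cycIdeal_f T i1_0 cyc_op_comm); exact: leq_ltn_trans (ltn_ord i1).
Qed.

Definition cyc_reduced lam := forall l, (lam l < d)%N.

Lemma ideal_reduced x : L x -> supported cyc_reduced x -> x = 0.
Proof.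
move=> Lx sx; rewrite -(@full_rem_id R n H T d f x).
  exact: (full_rem_cycIdeal swK T_pconst T_Xlo T_Xhi T_X T_slide T_quad T_comm
    T_braid
          i1_0 d_gt0 cyc_op_A cyc_op_T cyc_op_comm cyc_op_lead).
by apply: (supportedW _ sx) => lam rl l _.
Qed.

Lemma ideal_complement x : exists2 y, supported cyc_reduced y & L (y - x).
Proof.
exists (full_rem T d f n x); last exact: full_rem_sub.
have sx := full_rem_reduced T_pconst T_Xlo T_X T_quad i1_0 d_gt0 cyc_op_lead x.
by apply: (supportedW _ sx) => lam rl l; apply: rl.
Qed.

Definition cycMod := modQuot (V := M) L.
HB.instance Definition _ := GRing.Lmodule.on cycMod.
Definition cyc_class : M -> cycMod := mq L.
HB.instance Definition _ := GRing.isLinear.Build R M cycMod *:%R cyc_class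
  (@mq_is_linear R M L).

Lemma lspan_cycIdeal x : lspan (V := M) L x -> L x.
Proof.
elim=> // [|c y z _ Ly _ Lz]; first exact: cycIdeal0.
by apply: cycIdealD => //; apply: cycIdealZ.
Qed.

Lemma cyc_class_eq0 x : cyc_class x = 0 <-> L x.
Proof.
have -> : 0 = cyc_class 0 by rewrite linear0.
rewrite mq_eqP subr0; split; [exact: lspan_cycIdeal | exact: lspan_gen].
Qed.

Lemma cyc_class_surj (v : cycMod) : exists x, v = cyc_class x.
Proof. exact: mq_surj. Qed.

Section Induced.
Variables (g : E) (gL : forall x, L x -> L (g x)).

Definition induced_raw : M -> cycMod := fun x => cyc_class (g x).
Fact induced_raw_linear : linear induced_raw.
Proof. by move=> c x y; rewrite /induced_raw lend_add lend_scale linearP. Qed.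
HB.instance Definition _ :=
  GRing.isLinear.Build R M cycMod *:%R induced_raw induced_raw_linear.

Fact induced_raw0 x : L x -> induced_raw x = 0.
Proof. by move=> Lx; apply/cyc_class_eq0/gL. Qed.

Definition induced : lend cycMod := Lend (mqlift_is_linear induced_raw0).

Lemma inducedE x : induced (cyc_class x) = cyc_class (g x).
Proof. exact: (mqliftE induced_raw0). Qed.
End Induced.

Definition cycT i : lend cycMod := induced (@ideal_T i).
Definition cycA a : lend cycMod := induced (@ideal_A a).
Definition cycX l : lend cycMod := induced (@ideal_X l).

Lemma cycTE i x : cycT i (cyc_class x) = cyc_class (T i x).
Proof. exact: inducedE. Qed.
Lemma cycAE a x : cycA a (cyc_class x) = cyc_class (lA a x).
Proof. exact: inducedE. Qed.
Lemma cycXE l x : cycX l (cyc_class x) = cyc_class (X l x).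
Proof. exact: inducedE. Qed.

Lemma cycP (g g' : lend cycMod) :
  (forall x, g (cyc_class x) = g' (cyc_class x)) -> g = g'.
Proof. by move=> E0; apply: lendP => v; have [x ->] := cyc_class_surj v. Qed.

Lemma cycT_comm i j : (i.+1 < j)%N || (j.+1 < i)%N ->
  cycT i * cycT j = cycT j * cycT i.
Proof.
by move=> ij; apply: cycP => x; rewrite !lendME !cycTE -!lendME T_comm.
Qed.

Lemma cycT_braid i j : j = i.+1 :> nat ->
  cycT i * cycT j * cycT i = cycT j * cycT i * cycT j.
Proof.
by move=> ij; apply: cycP => x; rewrite !lendME !cycTE -!lendME T_braid.
Qed.

Lemma cycT_quad i : cycT i * cycT i = cycA (qq i) * cycT i + 1.
Proof.
apply: cycP => x; rewrite lendDE !lendME lend1E !cycTE cycAE -linearD.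
by rewrite -!lendME (T_quad i).1.
Qed.

Lemma cycT_slide i a : cycT i * cycA a = cycA (sw i a) * cycT i.
Proof.
apply: cycP => x; rewrite !lendME !(cycAE, cycTE).
by rewrite -!lendME T_slide.
Qed.

Lemma cycXC l p : cycX l * cycX p = cycX p * cycX l.
Proof. by apply: cycP => x; rewrite !lendME !cycXE -!lendME pvarC. Qed.

Lemma cycT_X i l : l != lo i -> l != hi i -> cycT i * cycX l = cycX l * cycT i.
Proof.
move=> h1 h2; apply: cycP => x; rewrite !lendME !(cycXE, cycTE).
by rewrite -!lendME T_X.
Qed.

Lemma cycTXT i : cycT i * cycX (lo i) * cycT i = cycX (hi i).
Proof.
apply: cycP => x; rewrite !lendME !(cycXE, cycTE).
by rewrite -!lendME T_Xlo -mulrA (quadVl (T_quad i)) mulr1.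
Qed.

Lemma cycXA l a : cycX l * cycA a = cycA a * cycX l.
Proof.
apply: cycP => x; rewrite !lendME !(cycXE, cycAE).
by rewrite -!lendME lmul_X.
Qed.

(** For X_1 the inverse is read off from f = 0, a_(0) being invertible. The other variables follow
    from X_(i+1) = T_i X_i T_i with T_i invertible. *)
Lemma cycX_inv l : exists v, cycX l * v = 1 /\ v * cycX l = 1.
Proof.
pose P m := forall l : 'I_n, l = m :> nat ->
  exists v, cycX l * v = 1 /\ v * cycX l = 1.
suff HH : forall m, (m < n)%N -> P m by apply: (HH l (ltn_ord l)).
apply: (@ltn_ord_ind n P) => [p p0|i IH p pi].
  have -> : p = i1 by apply: val_inj; rewrite /= p0 i1_0.
  have [d' dd] : exists d', d = d'.+1 by exists d.-1; rewrite prednK.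
  (* The quotient of f - a_(0) by X_1. Modulo f, g X_1 equals - a_(0), which makes - a_(0)^(-1) g
     the inverse of X_1. *)
  pose g : E := X i1 ^+ d' +
    \sum_(m < d | m != Ordinal d_gt0) lA (coef m) * X i1 ^+ m.-1.
  have gX : g * X i1 = f - lA (coef (Ordinal d_gt0)).
    rewrite mulrDl mulr_suml -exprSr -dd /f.
    rewrite [in RHS](bigD1 (Ordinal d_gt0)) //= expr0 mulr1.
    rewrite [lA _ + _]addrC addrA addrK; congr (_ + _); apply: eq_bigr => m m0.
    rewrite -mulrA -exprSr prednK // lt0n.
    by apply: contra m0 => /eqP m0; apply/eqP/val_inj.
  have Xg : X i1 * g = g * X i1.
    have XXm m : X i1 * X i1 ^+ m = X i1 ^+ m * X i1 by apply: commrX.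
    rewrite mulrDl mulrDr XXm; congr (_ + _).
    rewrite mulr_suml mulr_sumr; apply: eq_bigr => m _.
    by rewrite mulrA -lmul_X -!mulrA XXm.
  have gL x : L x -> L ((- (lA ainv * g)) x).
    move=> Lx; rewrite lendNE lendME; apply: cycIdealN; apply: ideal_A.
    rewrite lendDE; apply: cycIdealD.
      by elim: d' {dd gX Xg g} => [|m IH] //; rewrite exprS lendME;
        apply: ideal_X.
    rewrite lend_sumE; elim/big_rec: _ => [|m y _ Ly]; first exact: cycIdeal0.
    apply: cycIdealD => //; rewrite lendME; apply: ideal_A.
    by elim: (m.-1) => [|e IH] //; rewrite exprS lendME; apply: ideal_X.
  have E1 : - (lA ainv * g) * X i1 = 1 - lA ainv * f.
    by rewrite mulNr -mulrA gX mulrBr -lmulM ainv_coef0 lmul1 opprB.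
  have E2 : X i1 * - (lA ainv * g) = 1 - lA ainv * f.
    by rewrite -E1 mulrN mulNr mulrA -lmul_X -!mulrA Xg.
  have one x : cyc_class ((1 - lA ainv * f) x) = cyc_class x.
    rewrite lendBE linearB lendME /= [cyc_class (lA ainv _)](_ : _ = 0) ?subr0
      //.
    by apply/cyc_class_eq0/ideal_A/ideal_cyc_op.
  exists (induced gL); split; apply: cycP => x; rewrite lendME lend1E.
    by rewrite inducedE cycXE -lendME E2 one.
  by rewrite cycXE inducedE -lendME E1 one.
have -> : p = hi i by apply: val_inj.
have [v [Xv vX]] := IH (lo i) erefl.
have Tq : cycT i * cycA (qq i) = cycA (qq i) * cycT i.
  apply: cycP => x; rewrite !lendME !(cycAE, cycTE).
  by rewrite -!lendME (T_quad i).2.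
have Q : quad (cycT i) (cycA (qq i)) by split=> //; apply: cycT_quad.
have uT := quadVl Q; have Tu := quadVr Q.
move: (cycT i - cycA (qq i)) uT Tu => u uT Tu.
exists (u * v * u); rewrite -cycTXT; split.
  rewrite -!mulrA (mulrA (cycT i) u) Tu mul1r (mulrA (cycX _) v) Xv mul1r.
  exact: Tu.
rewrite -!mulrA (mulrA u (cycT i)) uT mul1r (mulrA v) vX mul1r.
exact: uT.
Qed.

Lemma cyc_op_cyc_class x :
  (cycX i1 ^+ d + \sum_(m < d) cycA (coef m) * cycX i1 ^+ m) (cyc_class x) = 0.
Proof.
have Xm m y : (cycX i1 ^+ m) (cyc_class y) = cyc_class ((X i1 ^+ m) y).
  by elim: m => [|m IH]; rewrite ?expr0 // !exprS !lendME IH cycXE.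
rewrite lendDE lend_sumE Xm; apply: etrans (_ : cyc_class (f x) = 0).
  rewrite lendDE linearD lend_sumE linear_sum; congr (_ + _).
  by apply: eq_bigr => m _; rewrite !lendME Xm cycAE.
exact/cyc_class_eq0/ideal_cyc_op.
Qed.

Lemma prodX lam : \prod_(l < n) X l ^+ lam l = shift H lam.
Proof.
have HH (s : seq 'I_n) : \prod_(l <- s) X l ^+ lam l =
    shift H [ffun k => (\sum_(l <- s) (k == l) * lam l)%N].
  elim: s => [|l s IH].
    rewrite big_nil -shift0; congr shift; apply/ffunP => k.
    by rewrite !ffunE big_nil.
  rewrite big_cons IH shiftX shiftM; congr shift; apply/ffunP => k.
  by rewrite !ffunE big_cons.
rewrite HH; congr shift; apply/ffunP => k; rewrite ffunE (bigD1 k) //= eqxx.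
by rewrite mul1n big1 ?addn0 // => l /negPf lk; rewrite eq_sym lk.
Qed.

Lemma cyc_mon lam h :
  (\prod_(l < n) cycX l ^+ lam l) (cyc_class (pconst n h)) =
    cyc_class (mon lam h).
Proof.
have Xm l m y : (cycX l ^+ m) (cyc_class y) = cyc_class ((X l ^+ m) y).
  by elim: m => [|m IH]; rewrite ?expr0 // !exprS !lendME IH cycXE.
rewrite -shift_pconst -prodX; elim: (index_enum _) => [|l s IH].
  by rewrite !big_nil.
by rewrite !big_cons !lendME IH Xm.
Qed.

(** * Evaluating polynomials in an algebra where f vanishes *)

Section Evaluation.
Variables (D : pzAlgType R) (eh : H -> D) (eX : 'I_n -> D).
Hypothesis eh_linear : linear eh.
Hypothesis ehM : monoid_morphism eh.
Hypothesis eXC : forall l p, eX l * eX p = eX p * eX l.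
Hypothesis eTX : forall i l, l != lo i -> l != hi i ->
  eh (hT i) * eX l = eX l * eh (hT i).
Hypothesis eTXT : forall i, eh (hT i) * eX (lo i) * eh (hT i) = eX (hi i).
Hypothesis eXA : forall l a, eX l * eh (hA a) = eh (hA a) * eX l.
Hypothesis e_cyc : eX i1 ^+ d + \sum_(m < d) eh (hA (coef m)) * eX i1 ^+ m = 0.

Fact eval_subproof lam : linear (fun h => (\prod_l eX l ^+ lam l) * eh h).
Proof.
by move=> c h h'; rewrite eh_linear mulrDr -pzalg_scalerAr.
Qed.
Definition eval : M -> D := plift (fun lam h => (\prod_l eX l ^+ lam l) * eh h).
HB.instance Definition _ :=
  GRing.isLinear.Build R M D *:%R eval (plift_linear eval_subproof).

Lemma eval_mon lam h : eval (mon lam h) = (\prod_l eX l ^+ lam l) * eh h.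
Proof. exact: (plift_mon eval_subproof). Qed.

Lemma eval_pconst h : eval (pconst n h) = eh h.
Proof.
rewrite eval_mon big1 ?mul1r // => l _; by rewrite ffunE expr0.
Qed.

Lemma eval_X l x : eval (X l x) = eX l * eval x.
Proof.
elim/pmod_ind: x => [|x y Ex Ey|lam h].
- by rewrite lend_zero linear0 mulr0.
- by rewrite lend_add !linearD /= Ex Ey mulrDr.
rewrite pvar_mon !eval_mon mulrA; congr (_ * _).
have HH (s : seq 'I_n) : uniq s ->
    \prod_(k <- s) eX k ^+ expo_add lam (expo1 l) k =
    (if l \in s then eX l else 1) * \prod_(k <- s) eX k ^+ lam k.
  elim: s => [|k s IH]; first by rewrite !big_nil mulr1.
  move=> /= /andP[ks us]; rewrite !big_cons in_cons IH //.
  rewrite !ffunE; have [kl|kl] := eqVneq k l.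
    by rewrite kl in ks *; rewrite (negPf ks) mul1r addn1 exprS mulrA.
  rewrite addn0 /= !mulrA; congr (_ * _).
  case: ifP => _; last by rewrite mulr1 mul1r.
  apply: esym; apply: commrX; exact: eXC.
by rewrite (HH _ (index_enum_uniq _)) mem_index_enum.
Qed.

Lemma eval_sub x y : eval (x - y) = eval x - eval y.
Proof. exact: linearB. Qed.

Lemma eval_A a x : eval (lA a x) = eh (hA a) * eval x.
Proof.
elim/pmodX_ind: x => [|x y Ex Ey|h|l x Ex].
- by rewrite lend_zero linear0 mulr0.
- by rewrite lend_add !linearD /= Ex Ey mulrDr.
- by rewrite lmul_pconst !eval_pconst ehM.2.
by rewrite -lendME lmul_X lendME !eval_X Ex !mulrA eXA.
Qed.

(** T_i moves past the variables by the same rules in the polynomial module and in D, so agreement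
    on constants propagates. *)
Lemma eval_T i x : eval (T i x) = eh (hT i) * eval x.
Proof.
have Q : quad (eh (hT i)) (eh (hA (qq i))).
  have [TT Tq] := h_quad i; split; last by rewrite -!ehM.2 Tq.
  rewrite -!ehM.2 TT -ehM.1.
  exact: linear_mapD.
have Xlo : eh (hT i) * eX (lo i) = eX (hi i) * (eh (hT i) - eh (hA (qq i))).
  by rewrite -eTXT -mulrA (quadVr Q) mulr1.
have Xhi : eh (hT i) * eX (hi i) =
    eX (lo i) * eh (hT i) + eh (hA (qq i)) * eX (hi i).
  by rewrite -eTXT !mulrA Q.1 !mulrDl mul1r addrC.
elim/pmodX_ind: x => [|x y Ex Ey|h|l x Ex].
- by rewrite lend_zero linear0 mulr0.
- by rewrite lend_add !linearD /= Ex Ey mulrDr.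
- by rewrite T_pconst !eval_pconst ehM.2.
rewrite -lendME eval_X; have [->|ll] := eqVneq l (lo i).
  rewrite T_Xlo lendME eval_X lendBE eval_sub Ex eval_A mulrA Xlo.
  by rewrite -mulrA mulrBl.
have [->|lh] := eqVneq l (hi i); last first.
  by rewrite (T_X ll lh) lendME eval_X Ex !mulrA eTX.
rewrite T_Xhi lendDE !lendME linearD /= eval_A !eval_X Ex [RHS]mulrA Xhi mulrDl.
by rewrite !mulrA.
Qed.

Lemma eval_cyc_op x : eval (f x) = 0.
Proof.
have Xm m y : eval ((X i1 ^+ m) y) = eX i1 ^+ m * eval y.
  elim: m => [|m IH]; first by rewrite !expr0 mul1r.
  by rewrite !exprS lendME eval_X IH mulrA.
transitivity
    ((eX i1 ^+ d + \sum_(m < d) eh (hA (coef m)) * eX i1 ^+ m) * eval x);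
  last by rewrite e_cyc mul0r.
rewrite lendDE linearD /= lend_sumE linear_sum Xm.
rewrite mulrDl mulr_suml; congr (_ + _); apply: eq_bigr => m _.
by rewrite lendME /= eval_A Xm mulrA.
Qed.

Lemma eval_ideal x : L x -> eval x = 0.
Proof.
elim=> {x} [p h _||x y _ Ex _ Ey|l x _ Ex].
- move: (pconst n h) => y; pose P m := forall y, eval (conjf T f m y) = 0.
  suff HH : forall m, (m < n)%N -> P m by apply: HH.
  apply: (@ltn_ord_ind n P) => [z|i IH z]; first exact: eval_cyc_op.
  by rewrite conjf_next !lendME eval_T IH mulr0.
- exact: linear0.
- by rewrite linearD /= Ex Ey addr0.
- by rewrite eval_X Ex mulr0.
Qed.

(** The c that preserve the image of [eval] form a subalgebra. As 1 is in that image, [eval] is onto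
    once this subalgebra is all of D. *)
Definition eval_stable (c : D) := forall x, exists y, c * eval x = eval y.

Lemma eval_stable_lin c u v :
  eval_stable u -> eval_stable v -> eval_stable (c *: u + v).
Proof.
move=> su sv x; have [y Ey] := su x; have [y' Ey'] := sv x.
exists (c *: y + y'); rewrite linearP /= -Ey -Ey' mulrDl.
by rewrite pzalg_scalerAl.
Qed.

Lemma eval_stableM u v : eval_stable u -> eval_stable v -> eval_stable (u * v).
Proof.
move=> su sv x; have [y Ey] := sv x; have [y' Ey'] := su y.
by exists y'; rewrite -mulrA Ey.
Qed.

Lemma eval_stable0 : eval_stable 0.
Proof. by move=> x; exists 0; rewrite mul0r linear0. Qed.

Lemma eval_stable1 : eval_stable 1.
Proof. by move=> x; exists x; rewrite mul1r. Qed.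

Lemma eval_stableD u v : eval_stable u -> eval_stable v -> eval_stable (u + v).
Proof. by move=> su sv; rewrite -[u]scale1r; apply: eval_stable_lin. Qed.

Lemma eval_stableN u : eval_stable u -> eval_stable (- u).
Proof.
move=> su; rewrite -[- u]addr0 -scaleN1r; apply: eval_stable_lin su _.
exact: eval_stable0.
Qed.

Lemma eval_stable_X l : eval_stable (eX l).
Proof. by move=> x; exists (X l x); rewrite eval_X. Qed.

Lemma eval_stable_A a : eval_stable (eh (hA a)).
Proof. by move=> x; exists (lA a x); rewrite eval_A. Qed.

Lemma eval_stable_T i : eval_stable (eh (hT i)).
Proof. by move=> x; exists (T i x); rewrite eval_T. Qed.

(** An inverse of X_1 is forced to be - a_(0)^(-1) g, an expression in elements already known to be
    stable. An inverse of X_(i+1) is conjugated down to one of X_i. *)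
Lemma eval_stable_Xinv l v : eX l * v = 1 -> v * eX l = 1 -> eval_stable v.
Proof.
pose P m := forall (l : 'I_n) v, l = m :> nat ->
  eX l * v = 1 -> v * eX l = 1 -> eval_stable v.
suff HH : forall m, (m < n)%N -> P m by apply: (HH l (ltn_ord l)).
apply: (@ltn_ord_ind n P) => [p w p0|i IH p w pi].
  have -> : p = i1 by apply: val_inj; rewrite /= p0 i1_0.
  have [d' dd] : exists d', d = d'.+1 by exists d.-1; rewrite prednK.
  move=> Xw wX.
  pose g := eX i1 ^+ d' +
    \sum_(m < d | m != Ordinal d_gt0) eh (hA (coef m)) * eX i1 ^+ m.-1.
  have gX : g * eX i1 = - eh (hA (coef (Ordinal d_gt0))).
    have E0 := e_cyc; rewrite (bigD1 (Ordinal d_gt0)) //= expr0 mulr1 in E0.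
    apply/eqP; rewrite -addr_eq0 -[X in _ == X]E0; apply/eqP.
    rewrite mulrDl mulr_suml -exprSr -dd -addrA [X in _ + X]addrC.
    congr (_ + (_ + _)); apply: eq_bigr => m m0.
    rewrite -mulrA -exprSr prednK // lt0n.
    by apply: contra m0 => /eqP m0; apply/eqP/val_inj.
  have -> : w = - (eh (hA ainv) * g).
    rewrite -[RHS]mulr1 -Xw mulrA; rewrite -[LHS]mul1r; congr (_ * _).
    by rewrite mulNr -mulrA gX mulrN opprK -ehM.2 ainv_coef0 ehM.1.
  have sX m : eval_stable (eX i1 ^+ m).
    elim: m => [|m IH]; first exact: eval_stable1.
    by rewrite exprS; apply: eval_stableM => //; apply: eval_stable_X.
  apply: eval_stableN; apply: eval_stableM; first exact: eval_stable_A.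
  apply: eval_stableD => //; elim/big_rec: _ => [|m y _ sy].
    exact: eval_stable0.
  apply: eval_stableD => //; apply: eval_stableM => //.
  exact: eval_stable_A.
have -> : p = hi i by apply: val_inj.
move=> Xw wX.
have Q : quad (eh (hT i)) (eh (hA (qq i))).
  have [TT Tq] := h_quad i; split; last by rewrite -!ehM.2 Tq.
  rewrite -!ehM.2 TT -ehM.1.
  exact: linear_mapD.
pose u := eh (hT i) - eh (hA (qq i)).
have uT : u * eh (hT i) = 1 by apply: quadVl.
have Tu : eh (hT i) * u = 1 by apply: quadVr.
have su : eval_stable u.
  by apply: eval_stableD; [apply: eval_stable_T |
    apply/eval_stableN/eval_stable_A].
(* T_i w T_i inverts X_lo = u X_hi u, so the induction hypothesis applies to it. *)
have wE : w = u * (eh (hT i) * w * eh (hT i)) * u.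
  by rewrite !mulrA uT mul1r -mulrA Tu mulr1.
rewrite wE; apply: eval_stableM => //; apply: eval_stableM => //.
apply: (IH (lo i)) => //.
  have E1 : eX (lo i) = u * eX (hi i) * u.
    by rewrite -eTXT !mulrA uT mul1r -mulrA Tu mulr1.
  by rewrite E1 -!mulrA (mulrA u (eh _)) uT mul1r (mulrA (eX _)) Xw mul1r uT.
have E1 : eX (lo i) = u * eX (hi i) * u.
  by rewrite -eTXT !mulrA uT mul1r -mulrA Tu mulr1.
by rewrite E1 -!mulrA (mulrA (eh _) u) Tu mul1r (mulrA w) wX mul1r Tu.
Qed.

Lemma eval_reduced x : exists2 y, supported cyc_reduced y & eval x = eval y.
Proof.
have [y sy Ly] := ideal_complement x; exists y => //.
by have := eval_ideal Ly; rewrite eval_sub => /eqP; rewrite subr_eq0 => /eqP ->.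
Qed.

End Evaluation.
End CyclotomicModule.

(** * Bases of the cyclotomic quotients *)

Lemma is_basis_intro (R : comNzRingType) (V : lmodType R) (J : finType)
    (e : J -> V) :
    (forall v, exists c : J -> R, v = \sum_j c j *: e j) ->
    (forall c : J -> R, \sum_j c j *: e j = 0 -> forall j, c j = 0) ->
  is_basis e.
Proof.
move=> span free v; have [c ->] := span v; exists [ffun j => c j]; split.
  by apply: eq_bigr => j _; rewrite ffunE.
move=> c' E; apply/ffunP => j; rewrite ffunE; apply/eqP; rewrite -subr_eq0.
apply/eqP; apply: (free (fun j => c j - c' j)); apply/eqP.
under eq_bigr => i _ do rewrite scalerBl.
by rewrite sumrB E subrr.
Qed.

Lemma at_pos_central (R : comNzRingType) (A : superAlgType R) n (i : 'I_n)
    (c : A) (x : tpow A n) :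
  supercentral false c -> at_pos i c * x = x * at_pos i c.
Proof.
case=> hc cc; elim/at_pos_ind: x => [||e x y Ex Ey|l p u x hu Ex].
- by rewrite mulr0 mul0r.
- by rewrite mulr1 mul1r.
- by rewrite mulrDr mulrDl -pzalg_scalerAr -pzalg_scalerAl Ex Ey.
suff E : at_pos i c * at_pos l u = at_pos l u * at_pos i c :> tpow A n.
  by rewrite mulrA E -!mulrA Ex.
have [->|il] := eqVneq l i; first by rewrite !at_posM (cc _ _ hu) scale1r.
by rewrite (at_posC _ hc hu) 1?eq_sym // scale1r.
Qed.

Lemma aq_linear (R : pzRingType) (E : pzAlgType R) (S : E -> Prop) :
  linear (@aq R E S).
Proof. exact: linearP. Qed.

Lemma subalg_valL (R : pzRingType) (E : pzAlgType R) (S : E -> Prop) c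
    (x y : subalg S) : val (c *: x + y) = c *: val x + val y.
Proof. by []. Qed.

Lemma subalg_val1 (R : pzRingType) (E : pzAlgType R) (S : E -> Prop) :
  val (1 : subalg S) = 1.
Proof. by []. Qed.

Lemma subalg_valM (R : pzRingType) (E : pzAlgType R) (S : E -> Prop)
    (x y : subalg S) : val (x * y) = val x * val y.
Proof. by []. Qed.

Section Final.
Variables (R : comNzRingType) (A : superAlgType R).
Variables (tr : {scalar A}) (tr_symm : trace_form tr).
Variables (I : finType) (B Bd : I -> A).
Hypothesis B_homog : forall b, homogeneous (B b).
Hypothesis B_basis : is_basis B.
Hypothesis B_dual : forall a b, tr (Bd a * B b) = (a == b)%:R.
Variables (n : nat) (z : R) (i1 : 'I_n).
Hypothesis i1_0 : i1 = 0%N :> nat.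
Variables (d : nat) (d_gt0 : (0 < d)%N) (a : 'I_d -> A).
Hypothesis a_central : forall i, supercentral false (a i).
Variable u : A.
Hypothesis u_inv : u * a (Ordinal d_gt0) = 1.
Variable red : 'S_n -> seq 'I_n.-1.
Hypothesis redP : forall w, len_expression w (red w).

Local Notation S := (tpow A n).
Local Notation H := (hecke n z B Bd).
Local Notation hA := (@hecke_tensor R A n z I B Bd).
Local Notation hT := (@hecke_T R A n z I B Bd).
Local Notation tt := (@simple_tp R A I B Bd n).
Local Notation HA := (haff n z B Bd).
Local Notation HP := (haffp n z B Bd).

Definition simple_act (i : 'I_n.-1) (x : S) : S := superperm (simple i) x.
Definition quad_coef (i : 'I_n.-1) : S := z *: tt i.
Definition coef_at (m : 'I_d) : S := at_pos i1 (a m).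
Definition inv_at : S := at_pos i1 u.

Let hM := @hecke_tensorM R A n z I B Bd.
Let hL := @hecke_tensor_linear R A n z I B Bd.
Let hZ c x : hA (c *: x) = c *: hA x. Proof. exact: linearZ. Qed.

Let h_slide i x : hT i * hA x = hA (simple_act i x) * hT i.
Proof. exact: hecke_slide. Qed.

Let q_slide i x : hA (simple_act i x) * hA (quad_coef i) =
  hA (quad_coef i) * hA x.
Proof.
rewrite -!hM /quad_coef -pzalg_scalerAr -pzalg_scalerAl.
by rewrite (simple_tp_slide tr_symm B_homog B_basis B_dual).
Qed.

Let simple_actZ i c x : simple_act i (c *: x) = c *: simple_act i x.
Proof. exact: linearZ. Qed.

Let h_quad i : quad (hT i) (hA (quad_coef i)).
Proof.
split; first by rewrite hecke_quadratic hZ -pzalg_scalerAl.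
rewrite h_slide /quad_coef simple_actZ /simple_act.
by rewrite (simple_tp_fixed tr_symm B_homog B_basis B_dual).
Qed.

Let h_comm (i j : 'I_n.-1) : (i.+1 < j)%N || (j.+1 < i)%N ->
  hT i * hT j = hT j * hT i.
Proof. exact: hecke_T_comm. Qed.

Let h_braid (i j : 'I_n.-1) : j = i.+1 :> nat ->
  hT i * hT j * hT i = hT j * hT i * hT j.
Proof. exact: hecke_T_braid. Qed.

Let simple_actK i : involutive (simple_act i).
Proof. exact: superperm_simpleK. Qed.

Let quad_coef_far (i j : 'I_n.-1) : (i.+1 < j)%N || (j.+1 < i)%N ->
  simple_act i (quad_coef j) = quad_coef j.
Proof.
by move=> ij; rewrite /quad_coef simple_actZ /simple_act simple_tp_far.
Qed.

Let quad_coef_braid (i j : 'I_n.-1) : j = i.+1 :> nat ->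
  simple_act i (quad_coef j) = simple_act j (quad_coef i).
Proof.
by move=> ij; rewrite /quad_coef !simple_actZ /simple_act
  (simple_tp_braid _ _ ij).
Qed.

Let coef_at_central m x : hA (coef_at m) * hA x = hA x * hA (coef_at m).
Proof. by rewrite -!hM at_pos_central. Qed.

Let coef_at_fixed (i : 'I_n.-1) m : (0 < i)%N ->
  simple_act i (coef_at m) = coef_at m.
Proof.
move=> i0; rewrite /simple_act /coef_at superperm_at_pos.
by rewrite simple_other // -val_eqE /= i1_0; apply/eqP; lia.
Qed.

Let inv_at_coef0 : hA inv_at * hA (coef_at (Ordinal d_gt0)) = 1.
Proof. by rewrite -hM at_posM u_inv at_pos1 hecke_tensor1. Qed.

Local Notation Q := (cycMod hA hT quad_coef i1 coef_at).
Local Notation cqm := (cyc_class hA hT quad_coef i1 coef_at).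
Let cT := cycT h_quad h_comm h_braid h_slide q_slide simple_actK
  quad_coef_far quad_coef_braid i1_0 d_gt0 coef_at_central coef_at_fixed :
  'I_n.-1 -> lend Q.
Let cA := cycA h_slide q_slide simple_actK i1 coef_at_central : S -> lend Q.
Let cX := cycX hA hT quad_coef i1 coef_at : 'I_n -> lend Q.

Let cAE x y : cA x (cqm y) = cqm (lmul n (hA x) y).
Proof. exact: cycAE. Qed.

Let cTE i y : cT i (cqm y) = cqm (aT hA hT quad_coef i y).
Proof. exact: cycTE. Qed.

Let cQP (g g' : lend Q) : (forall x, g (cqm x) = g' (cqm x)) -> g = g'.
Proof. exact: cycP. Qed.

Let cAL : linear cA.
Proof.
move=> c x y; apply: cQP => v; rewrite lendDE lendZE !cAE -linearP hL.
by rewrite lmul_linear lendDE lendZE.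
Qed.

Let cqL : linear cqm. Proof. exact: linearP. Qed.

Lemma hecke_cyc : exists fh : H -> lend Q, [/\ linear fh, monoid_morphism fh,
  forall x, fh (hA x) = cA x & forall i, fh (hT i) = cT i].
Proof.
apply: (@hecke_universal R A n z I B Bd (lend Q) cA cT) => //.
- split=> [|x y]; apply: cQP => v.
    by rewrite cAE hecke_tensor1 lmul1 !lend1E.
  by rewrite lendME !cAE hM lmulM lendME.
- by move=> i j ij; exact: cycT_comm ij.
- by move=> i j ij; exact: cycT_braid ij.
- move=> i; rewrite [LHS]cycT_quad; congr (_ + _).
  rewrite -[cycA _ _ _ _ _ _]/(cA (quad_coef i))
    -[cycT _ _ _ _ _ _ _ _ _ _ _ _ i]/(cT i).
  by rewrite (linear_mapZ cAL) pzalg_scalerAl.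
- by move=> i x; apply: cycT_slide.
Qed.

(** The affine algebra acts on the quotient module since the variables are invertible there, and f
    acts as 0 since its image lies in L. That H multiplies constants from the left fixes the value
    of a monomial at the class of 1. *)
Lemma haff_cyc : exists2 fh : H -> lend Q,
    linear fh /\ (forall x y, fh x (cqm (pconst n y)) = cqm (pconst n (x * y)))
      &
  exists phi : HA -> lend Q, [/\ linear phi, monoid_morphism phi,
    forall x, phi (haff_hecke z B Bd x) = fh x &
    (forall l, phi (haff_X z B Bd l) = cX l) /\
    phi (cyc_poly (haff_hecke z B Bd) (haff_X z B Bd) i1 a) = 0].
Proof.
have [fh [fL [f1 fM] fA fT]] := hecke_cyc.
exists fh.
  split=> // x y; elim/hecke_ind: x y => [||c x x' IH IH'|b x IH|i x IH] y.
  - by rewrite (linear_map0 fL) lend0E mul0r [pconst n 0]linear0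
      (linear_map0 cqL).
  - by rewrite f1 lend1E mul1r.
  - by rewrite fL lendDE lendZE IH IH' -!linearP mulrDl pzalg_scalerAl.
  - by rewrite fM lendME IH fA cAE lmul_pconst mulrA.
  - by rewrite fM lendME IH fT cTE aT_pconst mulrA.
have [fV fVP] := choice (cycX_inv h_quad h_comm h_braid h_slide q_slide
  simple_actK quad_coef_far
  quad_coef_braid i1_0 coef_at_central coef_at_fixed inv_at_coef0).
have [|||||||phi [pL [p1 pM] ph pX]] :=
    @haff_universal R A n z I B Bd (lend Q) fh cX fV fL.
- by [].
- by move=> i j; apply: cycXC.
- by move=> l; have [] := fVP l.
- by move=> l; have [] := fVP l.
- by move=> i j h1 h2; rewrite fT; apply: cycT_X.
- by move=> i; rewrite fT; apply: cycTXT.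
- by move=> l x; rewrite fA; apply: cycXA.
exists phi; split=> //; split=> //.
apply: cQP => x; rewrite lend0E -[RHS](cyc_op_cyc_class h_slide q_slide
  simple_actK i1_0 coef_at_central x).
congr (lend_fun _ _).
have pXm m : phi (haff_X z B Bd i1 ^+ m) = cX i1 ^+ m.
  by elim: m => [|m IH]; rewrite ?expr0 // !exprS pM IH pX.
rewrite /cyc_poly (linear_mapD pL) pXm; congr (_ + _).
elim: (index_enum _) => [|m s IH]; first by rewrite !big_nil (linear_map0 pL).
by rewrite !big_cons (linear_mapD pL) IH pM pXm ph fA.
Qed.

Local Notation pure := (@pure_basis R A I B n).
Local Notation hW := (@hecke_word R A I B Bd n z red).
Local Notation J := ({ffun 'I_n -> 'I_d} * {ffun 'I_n -> I} * 'S_n)%type.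

Definition expo_of (g : {ffun 'I_n -> 'I_d}) : expo n := [ffun l => g l : nat].

(** Acting on the class of 1 turns a vanishing combination into a reduced polynomial lying in L,
    which is therefore 0; each of its coefficients is then a relation among the basis elements of
    H. *)
Lemma cyc_free (c : J -> R) :
  \sum_j c j *: to_cyc i1 a (monomial (haff_hecke z B Bd) (haff_X z B Bd)
         (fun i => j.1.1 i) (pure j.1.2) (red j.2)) = 0 ->
  forall j, c j = 0.
Proof.
have [fh [fL fE] [phi [pL [p1 pM] ph [pX pf]]]] := haff_cyc.
pose mn (j : J) : HA := monomial (haff_hecke z B Bd) (haff_X z B Bd)
         (fun i => j.1.1 i) (pure j.1.2) (red j.2).
have p0 : phi 0 = 0 by exact: (linear_map0 pL).
pose w (j : J) := hA (pure j.1.2) * hW j.2.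
have pmn (j : J) : phi (mn j) (cqm (pconst n 1)) =
  cqm (mon (expo_of j.1.1) (w j)).
  rewrite /mn /monomial !pM !lendME !ph !fE mulr1.
  rewrite -(cyc_mon hA hT quad_coef i1 coef_at (expo_of j.1.1));
    congr (lend_fun _ _).
  elim: (index_enum _) => [|l s IH]; first by rewrite !big_nil p1.
  rewrite !big_cons pM IH; congr (_ * _); rewrite ffunE.
  by elim: (nat_of_ord _) => [|m IHm]; rewrite ?expr0 // !exprS pM IHm pX.
move=> E0; have : aq _ (\sum_j c j *: mn j) = aq _ 0 :> cyc z B Bd i1 a.
  by rewrite linear_sum linear0 -[RHS]E0; apply: eq_bigr => j _;
    rewrite linearZ.
move=> /aq_eqP; rewrite subr0 => Lsum.
have : phi (\sum_j c j *: mn j) = 0.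
  elim: Lsum => [_ [x y v ->]||e x y _ Ex _ Ey] //.
    by rewrite !pM pf mulr0 mul0r.
  by rewrite pL Ex Ey scaler0 addr0.
move/(congr1 (fun g : lend Q => g (cqm (pconst n 1)))); rewrite lend0E.
have -> : phi (\sum_j c j *: mn j) (cqm (pconst n 1)) =
    cqm (\sum_j c j *: mon (expo_of j.1.1) (w j)).
  elim: (index_enum _) => [|j s IH]; first
    by rewrite !big_nil p0 (linear_map0 cqL).
  by rewrite !big_cons pL lendDE lendZE IH pmn cqL.
move/cyc_class_eq0 => Lx.
have sx : supported (cyc_reduced d) (\sum_j c j *: mon (expo_of j.1.1) (w j)).
  elim/big_rec: _ => [|j x _ sx]; first exact: supported0.
  apply: supportedD => //; apply: supportedZ; apply: supported_mon => l.
  by rewrite ffunE.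
have := ideal_reduced h_quad h_comm h_braid h_slide q_slide simple_actK
  quad_coef_far quad_coef_braid
  i1_0 d_gt0 coef_at_central coef_at_fixed Lx sx.
move=> M0 [[g b] s]; pose c' p := c (g, p.1, p.2).
suff E1 : \sum_p c' p *: (hA (pure p.1) * hW p.2) = 0.
  exact: (hecke_basis_free tr_symm B_homog B_basis B_dual redP E1 (b, s)).
have /(congr1 (pcoef (expo_of g))) := M0; rewrite pcoef0 => E2.
apply: etrans E2.
transitivity (\sum_(j : J | j.1.1 == g) c j *: w j).
  rewrite (reindex (fun p : {ffun 'I_n -> I} * 'S_n => (g, p.1, p.2) : J)) /=.
    by apply: eq_big => [p|p _]; rewrite ?eqxx.
  exists (fun j : J => (j.1.2, j.2)) => [[b' s'] _ //|[[g' b'] s']].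
  by rewrite inE /= => /eqP ->.
rewrite big_mkcond /=; elim: (index_enum _) => [|j r IH].
  by rewrite !big_nil pcoef0.
rewrite !big_cons pcoefD pcoefZ IH pcoef_mon; congr (_ + _).
have -> : (expo_of j.1.1 == expo_of g) = (j.1.1 == g).
  apply/eqP/eqP => [/ffunP E3|->//]; apply/ffunP => l; apply: val_inj.
  by have := E3 l; rewrite !ffunE.
by case: eqP => // _; rewrite scaler0.
Qed.

(** * Spanning, for both affine algebras at once *)

Section Spanning.
Variables (G D : pzAlgType R) (gh : H -> G) (gX : 'I_n -> G) (p : G -> D).
Hypothesis gh_linear : linear gh.
Hypothesis gh_monoid : monoid_morphism gh.
Hypothesis gXC : forall l l', gX l * gX l' = gX l' * gX l.
Hypothesis gTX : forall (i : 'I_n.-1) (l : 'I_n), l != lo i -> l != hi i ->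
  gh (hT i) * gX l = gX l * gh (hT i).
Hypothesis gTXT : forall i, gh (hT i) * gX (lo i) * gh (hT i) = gX (hi i).
Hypothesis gXA : forall l x, gX l * gh (hA x) = gh (hA x) * gX l.
Hypothesis p_linear : linear p.
Hypothesis p_monoid : monoid_morphism p.
Hypothesis p_surj : forall v, exists x, v = p x.
Hypothesis p_cyc : p (cyc_poly gh gX i1 a) = 0.

Let eh x : D := p (gh x).
Let eX l : D := p (gX l).
Let pM := p_monoid.2.
Let p1 := p_monoid.1.
Let p0 : p 0 = 0.
Proof. exact: linear_map0. Qed.
Let pD x y : p (x + y) = p x + p y.
Proof. exact: linear_mapD. Qed.
Let pX x m : p (x ^+ m) = p x ^+ m.
Proof. by elim: m => [|m IH]; rewrite ?expr0 // !exprS pM IH. Qed.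

Let ehL : linear eh.
Proof. by move=> c x y; rewrite /eh gh_linear p_linear. Qed.
Let ehM : monoid_morphism eh.
Proof.
split=> [|x y]; first by rewrite /eh gh_monoid.1 p1.
by rewrite /eh gh_monoid.2 pM.
Qed.
Let eXC l l' : eX l * eX l' = eX l' * eX l.
Proof. by rewrite /eX -!pM gXC. Qed.
Let eTX (i : 'I_n.-1) (l : 'I_n) : l != lo i -> l != hi i ->
  eh (hT i) * eX l = eX l * eh (hT i).
Proof. by move=> h1 h2; rewrite /eX /eh -!pM gTX. Qed.
Let eTXT i : eh (hT i) * eX (lo i) * eh (hT i) = eX (hi i).
Proof. by rewrite /eX /eh -!pM gTXT. Qed.
Let eXA l x : eX l * eh (hA x) = eh (hA x) * eX l.
Proof. by rewrite /eX /eh -!pM gXA. Qed.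
Let e_cyc : eX i1 ^+ d + \sum_(m < d) eh (hA (coef_at m)) * eX i1 ^+ m = 0.
Proof.
rewrite -[RHS]p_cyc /cyc_poly pD pX; congr (_ + _).
elim: (index_enum _) => [|m s IH]; first by rewrite !big_nil p0.
by rewrite !big_cons pD pM pX IH.
Qed.

Definition stable (x : G) := eval_stable eh eX (p x).

Lemma stable1 : stable 1.
Proof. by rewrite /stable p1; apply: eval_stable1. Qed.
Lemma stable_lin c x y : stable x -> stable y -> stable (c *: x + y).
Proof. by rewrite /stable p_linear; apply: eval_stable_lin. Qed.
Lemma stable0 : stable 0.
Proof. by rewrite /stable p0; apply: eval_stable0. Qed.
Lemma stableM x y : stable x -> stable y -> stable (x * y).
Proof. by rewrite /stable pM; apply: eval_stableM. Qed.
Lemma stable_X l : stable (gX l).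
Proof. exact: (eval_stable_X ehL eXC). Qed.
Lemma stable_Xinv l v : gX l * v = 1 -> v * gX l = 1 -> stable v.
Proof.
move=> Xv vX; apply: (eval_stable_Xinv h_quad i1_0 inv_at_coef0 ehL ehM
  eXC eTX eTXT eXA e_cyc (l := l)); by rewrite /eX -pM ?Xv ?vX p1.
Qed.
Lemma stable_hecke x : stable (gh x).
Proof.
elim/hecke_ind: x => [||c x y Sx Sy|b x Sx|i x Sx].
- by rewrite (linear_map0 gh_linear); apply: stable0.
- by rewrite gh_monoid.1; apply: stable1.
- by rewrite gh_linear; apply: stable_lin.
- rewrite gh_monoid.2; apply: stableM => //.
  exact: (eval_stable_A ehL ehM eXC eXA).
- rewrite gh_monoid.2; apply: stableM => //.
  exact: (eval_stable_T h_quad ehL ehM eXC eTX eTXT eXA).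
Qed.

(** Stability applied to 1, the value of [eval] at the constant 1, makes every element the value of
    a polynomial, which may be taken reduced because [eval] kills L; its coefficients are then
    expanded in the basis of H. *)
Lemma monomials_span : (forall x, stable x) -> forall v, exists c : J -> R,
  v = \sum_j c j *: p (monomial gh gX (fun i => j.1.1 i) (pure j.1.2)
    (red j.2)).
Proof.
move=> st v; pose e (j : J) : D :=
  p (monomial gh gX (fun i => j.1.1 i) (pure j.1.2) (red j.2)).
pose P w := exists c : J -> R, w = \sum_j c j *: e j.
have P0 : P 0 by exists (fun=> 0); rewrite big1 // => j _; rewrite scale0r.
have PL c w w' : P w -> P w' -> P (c *: w + w').
  move=> [c1 ->] [c2 ->]; exists (fun j => c * c1 j + c2 j).
  rewrite scaler_sumr -big_split; apply: eq_bigr => j _ /=.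
  by rewrite scalerA scalerDl.
have Pe j : P (e j).
  exists (fun j' => if j' == j then 1 else 0);
    rewrite (bigD1 j) //= eqxx scale1r.
  by rewrite big1 ?addr0 // => j' /negPf ->; rewrite scale0r.
have [x ->] := p_surj v; have [y0 Ey] := st x (pconst n 1).
have := eval_reduced h_quad h_slide q_slide i1_0 d_gt0 ehL ehM eXC eTX eTXT eXA
  e_cyc y0.
case=> y sy Eyy; have -> : p x = eval eh eX y.
  by rewrite -Eyy -Ey (eval_pconst eX ehL) ehM.1 mulr1.
have eL : linear (eval eh eX) := plift_linear (eval_subproof eX ehL).
move: {y0 Ey Eyy} y sy.
apply: (@supported_ind _ _ _ _ (fun y => P (eval eh eX y))).
- by rewrite (linear_map0 eL).
- by move=> y1 y2 Py1 Py2; rewrite -[y1]scale1r eL; apply: PL.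
move=> lam h rl; rewrite (eval_mon eX ehL).
have [c ->] := hecke_basis_span B_basis B_dual redP h.
set m := \prod_l _; elim: (index_enum _) => [|[b w] s IH].
  by rewrite big_nil (linear_map0 ehL) mulr0.
rewrite big_cons ehL mulrDr -pzalg_scalerAr; apply: PL => //.
suff -> : m * eh (hA (pure b) * hW w) =
    e ([ffun l => Ordinal (rl l)], b, w) by [].
rewrite /m /e /monomial /= !pM ehM.2 mulrA; congr (_ * _ * _).
elim: (index_enum _) => [|l s' IHs]; first by rewrite !big_nil p1.
by rewrite !big_cons pM IHs pX ffunE.
Qed.

End Spanning.

Lemma cyc_span v : exists c : J -> R, v = \sum_j c j *:
  to_cyc i1 a (monomial (haff_hecke z B Bd) (haff_X z B Bd)
         (fun i => j.1.1 i) (pure j.1.2) (red j.2)).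
Proof.
have hl := @haff_hecke_linear R A n z I B Bd.
have hm : monoid_morphism (haff_hecke z B Bd : H -> HA).
  by split; [exact: haff_hecke1 | exact: haff_heckeM].
have TX (i : 'I_n.-1) (l : 'I_n) (h1 : l != lo i) (h2 : l != hi i) :=
  haff_TX z B Bd h1 h2.
pose p : HA -> cyc z B Bd i1 a := aq _.
have pL : linear p by move=> c x y; rewrite /p linearP.
have pM : monoid_morphism p by split=> [|x y]; [exact: aq1 | exact: aqM].
have ps w : exists x, w = p x by exact: aq_surj.
have p0 : p (cyc_poly (haff_hecke z B Bd) (haff_X z B Bd) i1 a) = 0.
  rewrite -[RHS](linear0 (aq _)); apply/aq_eqP; rewrite subr0; apply: lspan_gen.
  set f := cyc_poly _ _ _ _.
  by have := @IdealGen R _ (fun x => x = f) 1 f 1 erefl; rewrite mul1r mulr1.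
have XC := @haff_XC R A n z I B Bd.
have TXT := @haff_TXT R A n z I B Bd.
have XA := @haff_XA R A n z I B Bd.
apply: (monomials_span hl hm XC TX TXT XA pL pM ps p0) => x.
elim/haff_ind: x => [||c x y Sx Sy|x y Sy|l y Sy|l y Sy].
- exact: (stable0 _ hl pL).
- exact: (stable1 _ _ pM).
- exact: (stable_lin hl pL).
- by apply: (stableM pM) => //; apply: (stable_hecke hl hm XC TX TXT XA pL pM).
- by apply: (stableM pM) => //; apply: (stable_X hl XC pL pM).
- apply: (stableM pM) => //.
  apply: (stable_Xinv hl hm XC TX TXT XA pL pM p0 (l := l)).
    exact: haff_XV.
  exact: haff_VX.
Qed.

Lemma haffp_valL c (x y : HP) : val (c *: x + y) = c *: val x + val y.
Proof. exact: (@subalg_valL R HA (@haffp_gen R A n z I B Bd)). Qed.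

Lemma haffp_inj (x y : HP) : val x = val y -> x = y.
Proof. exact: val_inj. Qed.

Lemma haffp_val1 : val (1 : HP) = 1.
Proof. exact: (@subalg_val1 R HA (@haffp_gen R A n z I B Bd)). Qed.

Lemma haffp_valM (x y : HP) : val (x * y) = val x * val y.
Proof. exact: (@subalg_valM R HA (@haffp_gen R A n z I B Bd)). Qed.

Lemma cycp_span v : exists c : J -> R, v = \sum_j c j *:
  to_cycp i1 a (monomial (haffp_hecke z B Bd) (haffp_X z B Bd)
         (fun i => j.1.1 i) (pure j.1.2) (red j.2)).
Proof.
have hl : linear (haffp_hecke z B Bd : H -> HP).
  move=> c x y; apply: haffp_inj; rewrite haffp_valL.
  exact: (@haff_hecke_linear R A n z I B Bd).
have hm : monoid_morphism (haffp_hecke z B Bd : H -> HP).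
  split=> [|x y]; apply: haffp_inj; first by rewrite haffp_val1 -haff_hecke1.
  by rewrite haffp_valM; exact: haff_heckeM.
have TX (i : 'I_n.-1) (l : 'I_n) (h1 : l != lo i) (h2 : l != hi i) :
    haffp_hecke z B Bd (hT i) * haffp_X z B Bd l =
    haffp_X z B Bd l * haffp_hecke z B Bd (hT i) :> HP.
  by apply: haffp_inj; rewrite !haffp_valM; exact: haff_TX.
have XC l l' : haffp_X z B Bd l * haffp_X z B Bd l' =
    haffp_X z B Bd l' * haffp_X z B Bd l :> HP.
  by apply: haffp_inj; rewrite !haffp_valM; exact: haff_XC.
have TXT i : haffp_hecke z B Bd (hT i) * haffp_X z B Bd (lo i) *
    haffp_hecke z B Bd (hT i) = haffp_X z B Bd (hi i) :> HP.
  by apply: haffp_inj; rewrite !haffp_valM; exact: haff_TXT.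
have XA l x : haffp_X z B Bd l * haffp_hecke z B Bd (hA x) =
    haffp_hecke z B Bd (hA x) * haffp_X z B Bd l :> HP.
  by apply: haffp_inj; rewrite !haffp_valM; exact: haff_XA.
pose p : HP -> cycp z B Bd i1 a := aq _.
have pL : linear p by move=> c x y; rewrite /p linearP.
have pM : monoid_morphism p by split=> [|x y]; [exact: aq1 | exact: aqM].
have ps w : exists x, w = p x by exact: aq_surj.
have p0 : p (cyc_poly (haffp_hecke z B Bd) (haffp_X z B Bd) i1 a) = 0.
  rewrite -[RHS](linear0 (aq _)); apply/aq_eqP; rewrite subr0; apply: lspan_gen.
  set f := cyc_poly _ _ _ _.
  by have := @IdealGen R _ (fun x => x = f) 1 f 1 erefl; rewrite mul1r mulr1.
apply: (monomials_span hl hm XC TX TXT XA pL pM ps p0) => v'.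
have gv : subalg_gen (@haffp_gen R A n z I B Bd) (val v')
  by apply/subalgP/(valP v').
(* The induction runs over membership in the subalgebra, for all elements of the subtype with the
   given value. *)
move Ex: (val v') gv => x gx; elim: gx v' Ex => {x}.
- move=> _ [x|l] v' Ex.
    have -> : v' = haffp_hecke z B Bd x by exact: haffp_inj.
    exact: (stable_hecke hl hm XC TX TXT XA pL pM).
  have -> : v' = haffp_X z B Bd l by exact: haffp_inj.
  exact: (stable_X hl XC pL pM).
- move=> v' Ex; have -> : v' = 1 by apply: haffp_inj; rewrite haffp_val1.
  exact: (stable1 _ _ pM).
- move=> c x y /(introT (subalgP _ x)) gx Sx.
  move=> /(introT (subalgP _ y)) gy Sy v' Ex.
  pose x' : HP := exist _ x gx; pose y' : HP := exist _ y gy.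
  have -> : v' = c *: x' + y' by apply: haffp_inj; rewrite haffp_valL.
  by apply: (stable_lin hl pL); [apply: Sx | apply: Sy].
move=> x y /(introT (subalgP _ x)) gx Sx /(introT (subalgP _ y)) gy Sy v' Ex.
pose x' : HP := exist _ x gx; pose y' : HP := exist _ y gy.
have -> : v' = x' * y' by apply: haffp_inj; rewrite haffp_valM.
by apply: (stableM pM); [apply: Sx | apply: Sy].
Qed.

(** The inclusion of the positive subalgebra sends f to f, so it induces a map between the quotients
    that takes monomials to monomials; a relation upstairs maps to one already known to be
    trivial. *)
Lemma cycp_free (c : J -> R) :
  \sum_j c j *: to_cycp i1 a (monomial (haffp_hecke z B Bd) (haffp_X z B Bd)
         (fun i => j.1.1 i) (pure j.1.2) (red j.2)) = 0 ->
  forall j, c j = 0.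
Proof.
move=> E0; apply: cyc_free.
pose mp (j : J) : HP := monomial (haffp_hecke z B Bd) (haffp_X z B Bd)
         (fun i => j.1.1 i) (pure j.1.2) (red j.2).
pose m (j : J) : HA := monomial (haff_hecke z B Bd) (haff_X z B Bd)
         (fun i => j.1.1 i) (pure j.1.2) (red j.2).
have mpE j : val (mp j) = m j.
  rewrite /mp /monomial !haffp_valM; congr (_ * _ * _).
  elim: (index_enum _) => [|l s IH]; first by rewrite !big_nil haffp_val1.
  rewrite !big_cons haffp_valM IH; congr (_ * _).
  elim: (nat_of_ord _) => [|m' IHm]; first by rewrite !expr0 haffp_val1.
  by rewrite !exprS haffp_valM IHm.
have : aq _ (\sum_j c j *: mp j) = aq _ 0 :> cycp z B Bd i1 a.
  by rewrite linear_sum linear0 -[RHS]E0; apply: eq_bigr => j _;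
    rewrite linearZ.
move=> /aq_eqP; rewrite subr0 => Lsum.
have qL e (x y : HA) :
    to_cyc i1 a (e *: x + y) = e *: to_cyc i1 a x + to_cyc i1 a y.
  exact: (@aq_linear R HA).
have q0 : to_cyc i1 a (0 : HA) = 0 by exact: (linear0 (aq _)).
have val0 : val (0 : HP) = 0 by [].
have : to_cyc i1 a (val (\sum_j c j *: mp j)) = 0.
  elim: Lsum => [_ [x y v ->]||e x y _ Ex _ Ey].
  - rewrite !haffp_valM val_cyc_poly -q0; apply/aq_eqP; rewrite subr0.
    by apply: lspan_gen; constructor.
  - by rewrite val0.
  by rewrite haffp_valL qL Ex Ey scaler0 addr0.
move=> E1; rewrite -[RHS]E1; elim: (index_enum _) => [|j s IH].
  by rewrite !big_nil val0 q0.
by rewrite !big_cons haffp_valL qL IH mpE.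
Qed.

End Final.

Theorem theorem4p10
  (k : comNzRingType) (char_k : 2%N \notin [pchar k]) (z : k)
  (A : superAlgType k) (tr : {scalar A}) (tr_symm : trace_form tr)
  (I : finType) (B Bdual : I -> A)
  (B_homog : forall b, homogeneous (B b)) (B_basis : is_basis B)
  (B_dual : forall a b, tr (Bdual a * B b) = (a == b)%:R)
  (n : nat) (n_gt0 : (0 < n)%N)
  (d : nat) (d_gt0 : (0 < d)%N) (a : 'I_d -> A)
  (a_central : forall i, supercentral false (a i))
  (a0_inv : invertible (a (Ordinal d_gt0)))
  (red : 'S_n -> seq 'I_n.-1) (redP : forall w, reduced_expression w (red w)) :
  let i1 := Ordinal n_gt0 in
  let J := ({ffun 'I_n -> 'I_d} * {ffun 'I_n -> I} * 'S_n)%type in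
  let tens (b : {ffun 'I_n -> I}) : tpow A n := tensor [ffun i => B (b i)] in
  is_basis (fun j : J =>
    to_cycp i1 a
      (monomial (haffp_hecke z B Bdual) (haffp_X z B Bdual)
         (fun i => j.1.1 i) (tens j.1.2) (red j.2)))
  /\
  is_basis (fun j : J =>
    to_cyc i1 a
      (monomial (haff_hecke z B Bdual) (haff_X z B Bdual)
         (fun i => j.1.1 i) (tens j.1.2) (red j.2))).
Proof.
move=> i1 J tens; have i1_0 : i1 = 0%N :> nat by [].
have len_red w : len_expression w (red w) by exact: reduced_len_expression.
have [u [_ u_inv]] := a0_inv.
split; apply: is_basis_intro.
- exact: (cycp_span tr_symm B_homog B_basis B_dual i1_0 d_gt0 len_red).
- exact: (cycp_free tr_symm B_homog B_basis B_dual i1_0 a_central u_inv len_red).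
- exact: (cyc_span tr_symm B_homog B_basis B_dual i1_0 u_inv len_red).
exact: (cyc_free tr_symm B_homog B_basis B_dual i1_0 a_central u_inv len_red).
Qed.
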